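(* Let $\mathcal{S}$ be a smooth surface in $\mathbb{C}^2$ that is described near $(0,0)\in\mathcal{S}$ by $$\mathcal{S}:\quad w=\sum_{j=0}^{k}C_j z^{k-j}\overline{z}^{\,j}+G(z)\equiv C_0z^k+\Sigma(z)+G(z),$$ where $k>2$, $G$ is a function of class $\mathcal{C}^1$ around $z=0$, and $G=O(|z|^{k+1})$. Define the set $I(\mathcal{S}):=\{j\in\mathbb{N}: k/2<j\le k \text{ and } C_j\neq0\}$ and, for each $j\in I(\mathcal{S})$, define $$\tau_j(z):=\frac{\Sigma(z)-C_jz^{k-j}\overline{z}^{\,j}}{C_jz^{k-j}\overline{z}^{\,j}}\qquad\text{for all } z\neq0.$$ Suppose $I(\mathcal{S})\neq\emptyset$ and that there exists an integer $M\in I(\mathcal{S})$ such that $$\sup_{|\zeta|=1}|\tau_M(\zeta)|<\frac{\tan\{\pi/(2M-k)\}}{1+\tan\{\pi/(2M-k)\}}$$ and $$k\sup_{|\zeta|=1}|\tau_M(\zeta)|+\Bigl\{1-\sup_{|\zeta|=1}|\tau_M(\zeta)|\Bigr\}^{-1}\sup_{|\zeta|=1}|\zeta|\,\|\nabla\tau_M(\zeta)\|<2M-k.$$ Then there exists a small constant $\varepsilon>0$ such that $\mathcal{S}\cap\{(z,w):|z|\le\varepsilon\}$ is polynomially convex. Furthermore, writing $\Phi(z):=\sum_{j=0}^{k}C_jz^{k-j}\overline{z}^{\,j}+G(z)$ for the right-hand side of the equation describing $\mathcal{S}$, we have $\mathcal{C}(\overline{D(0;\varepsilon)})=[z,\P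hi]_{\overline{D(0;\varepsilon)}}$.
   Context: Coordinates on $\mathbb{C}^2$ are $(z,w)$, and surfaces are real surfaces. Here $k$ is an integer, the $C_j$ are complex constants, $\Sigma(z)=\sum_{j=1}^{k}C_jz^{k-j}\overline{z}^{\,j}$, $G$ is complex-valued, and $G=O(|z|^{k+1})$ is meant as $z\to0$. The surface $\mathcal{S}$ is identified near $(0,0)$ with the graph $w=\Phi(z)$, so that for small $\varepsilon>0$ the set $\mathcal{S}\cap\{(z,w):|z|\le\varepsilon\}$ is $\{(z,\Phi(z)):|z|\le\varepsilon\}$. A compact set $K\subset\mathbb{C}^n$ is polynomially convex if for each point $\zeta\notin K$ there exists a holomorphic polynomial $P$ such that $P(\zeta)=1$ and $\sup_K|P|<1$. For a complex-valued function $\phi$ of class $\mathcal{C}^1$ on an open region $\Omega\subset\mathbb{C}$, $\|\nabla\phi(\zeta)\|:=\left|\frac{\partial\phi}{\partial z}(\zeta)\right|+\left|\frac{\partial\phi}{\partial\overline{z}}(\zeta)\right|$ for $\zeta\in\Omega$. $\overline{D(0;\varepsilon)}=\{z\in\mathbb{C}:|z|\le\varepsilon\}$ is the closed disc of radius $\varepsilon$ centered at $0$. For a compact $K\subset\mathbb{C}$, $\mathcal{C}(K)$ is the algebra of complex-valued continuous functions on $K$; for $\phi_1,\dots,\phi_N\in\mathcal{C}(K)$, $[\phi_1,\dots,\phi_N]_K$ denotes the set of all $f\in\mathcal{C}(K)$ that can be approximated uniformly on $K$ by complex polynomials in $\phi_1,\dots,\phi_N$. In $[z,\Phi]_K$,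 $z$ denotes the identity function. *)

(* Defs.v *)
From HB Require Import structures.
From mathcomp Require Import all_boot all_order all_algebra.
From mathcomp Require Import all_classical all_reals all_analysis.
From mathcomp.real_closed Require Export complex.

Set Implicit Arguments.
Unset Strict Implicit.
Unset Printing Implicit Defensive.
Import Order.TTheory GRing.Theory Num.Theory.
Import numFieldNormedType.Exports.
Local Open Scope classical_set_scope.
Local Open Scope ring_scope.

(* The complex field is [Rcomplex R], the copy of [R[i]] which is a module over
   [R] and whose norm [`|z|] is the modulus as an element of [R].  With the
   instances below it is a normed [R]-space, so that [differentiable], ['D_v f]
   and ['d f x] on [Rcomplex R] and on [Rcomplex R * Rcomplex R] are
   REAL derivatives. *)
Lemma Rcomplex_normrZ (R : realType) (a : R) (z : Rcomplex R) :
  `|a *: z| = `|a| * `|z|.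
Proof.
case: z => x y; rewrite -[LHS]/(Num.sqrt ((a * x) ^+ 2 + (a * y) ^+ 2)).
rewrite -[`|_ : Rcomplex R|]/(Num.sqrt (x ^+ 2 + y ^+ 2)).
by rewrite !exprMn -mulrDr sqrtrM ?sqr_ge0// sqrtr_sqr.
Qed.

HB.instance Definition _ (R : realType) :=
  PseudoMetric.copy (Rcomplex R) (pseudoMetric_normed (Rcomplex R)).
HB.instance Definition _ (R : realType) := isPointed.Build (Rcomplex R) 0.
HB.instance Definition _ (R : realType) :=
  NormedZmod_PseudoMetric_eq.Build R (Rcomplex R) erefl.
HB.instance Definition _ (R : realType) :=
  PseudoMetricNormedZmod_Lmodule_isNormedModule.Build R (Rcomplex R)
    (@Rcomplex_normrZ R).

Notation Cplx R := (Rcomplex R).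
Notation Cplx2 R := (Rcomplex R * Rcomplex R)%type.

(* [f] is of class C^n on the open set [U], in the real sense. *)
Fixpoint Cclass (R : realType) (V W : normedModType R) (n : nat)
    (U : set V) (f : V -> W) : Prop :=
  match n with
  | 0%N => forall x, U x -> {for x, continuous f}
  | m.+1 => (forall x, U x -> differentiable f x) /\
            (forall v : V, Cclass m U (fun x => 'D_v f x))
  end.

(* Smooth (C^infinity) embedded real surface in C^2: locally the zero set of a
   smooth submersion onto C, i.e. of two real functions with independent
   differentials. *)
Definition smooth_surface (R : realType) (S : set (Cplx2 R)) : Prop :=
  forall p, S p ->
    exists (U : set (Cplx2 R)) (rho : Cplx2 R -> Cplx R),
      [/\ open U, U p,
          (forall n, Cclass n U rho),
          (forall c : Cplx R, exists v : Cplx2 R, 'd rho p v = c) &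
          forall q, U q -> (S q <-> rho q = 0)].

(* Wirtinger derivatives: d/dz = (d/dx - i d/dy)/2, d/dzbar = (d/dx + i d/dy)/2 *)
Definition dz (R : realType) (phi : Cplx R -> Cplx R) (zeta : Cplx R) : Cplx R :=
  ('D_(1 : Cplx R) phi zeta
     - ('i%C : Cplx R) * 'D_('i%C : Cplx R) phi zeta) / 2.

Definition dzbar (R : realType) (phi : Cplx R -> Cplx R) (zeta : Cplx R)
    : Cplx R :=
  ('D_(1 : Cplx R) phi zeta
     + ('i%C : Cplx R) * 'D_('i%C : Cplx R) phi zeta) / 2.

Definition norm_nabla (R : realType) (phi : Cplx R -> Cplx R) (zeta : Cplx R)
    : R :=
  `|dz phi zeta| + `|dzbar phi zeta|.

Definition closed_disc (R : realType) (eps : R) : set (Cplx R) :=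
  [set z | `|z| <= eps].

Definition unit_circle (R : realType) : set (Cplx R) := [set z | `|z| = 1].
Arguments unit_circle R : clear implicits.

(* A polynomial in two variables is an element of C[z][w]. *)
Definition eval2 (R : realType) (P : {poly {poly (Cplx R)}}) (z w : Cplx R)
    : Cplx R :=
  (P.[w%:P]).[z].

(* The supremum is the real-valued [sup]; it is meaningful since [K] is compact
   (and it is 0 when [K] is empty). *)
Definition polynomially_convex (R : realType) (K : set (Cplx2 R)) : Prop :=
  compact K /\
  forall zeta, ~ K zeta ->
    exists P : {poly {poly (Cplx R)}},
      eval2 P zeta.1 zeta.2 = 1 /\
      sup [set `|eval2 P x.1 x.2| | x in K] < 1.

(* Elements of C(K) are represented by total functions; only their values on
   [K] matter. *)
Definition continuous_on (R : realType) (K : set (Cplx R))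
    : set (Cplx R -> Cplx R) :=
  [set f | {within K, continuous f}].

(* [phi1, phi2]_K *)
Definition uniform_algebra2 (R : realType) (K : set (Cplx R))
    (phi1 phi2 : Cplx R -> Cplx R) : set (Cplx R -> Cplx R) :=
  [set f | continuous_on K f /\
     forall delta : R, 0 < delta ->
       exists P : {poly {poly (Cplx R)}},
         forall x, K x -> `|eval2 P (phi1 x) (phi2 x) - f x| < delta].

Section SurfaceData.
Context (R : realType) (k : nat) (C : nat -> Cplx R).

Definition monom (j : nat) (z : Cplx R) : Cplx R :=
  C j * z ^+ (k - j) * (conjc z : Cplx R) ^+ j.

Definition Sigma (z : Cplx R) : Cplx R := \sum_(1 <= j < k.+1) monom j z.

Definition Phi (G : Cplx R -> Cplx R) (z : Cplx R) : Cplx R :=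
  \sum_(0 <= j < k.+1) monom j z + G z.

Definition I_S : set nat := [set j | (k < 2 * j)%N /\ (j <= k)%N /\ C j != 0].

Definition tau (j : nat) (z : Cplx R) : Cplx R :=
  (Sigma z - monom j z) / monom j z.

Definition sup_tau (j : nat) : R :=
  sup [set `|tau j zeta| | zeta in unit_circle R].

Definition sup_nabla_tau (j : nat) : R :=
  sup [set `|zeta| * norm_nabla (tau j) zeta | zeta in unit_circle R].

End SurfaceData.

(* tan(pi/p) / (1 + tan(pi/p)).  For p = 2, tan(pi/2) = +oo and the quotient is
   its limit 1, whereas the library's [tan] takes the value 0 at pi/2. *)
Definition tan_bound (R : realType) (p : nat) : R :=
  if p == 2%N then 1
  else tan (pi / p%:R) / (1 + tan (pi / p%:R)).

(* Main.v *)
Require Import Defs.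
From HB Require Import structures.
From mathcomp Require Import all_boot all_order all_algebra.
From mathcomp Require Import all_classical all_reals all_analysis.
From mathcomp Require Import ring lra zify.
From mathcomp Require Import cyclic separable cyclotomic.

(** Write F = Phi - C_0 z^k and let W = F / (C_M z^(k-M) zbar^M), so that
    W = 1 + tau_M + O(|z|).  The hypothesis on sup |tau_M| forces this supremum to be
    smaller than 1, hence on a small disc W stays in a disc |W - 1| <= s < 1 inside the
    right half-plane, and the principal branch
      f(z) = zbar W(z)^(1/M)
    is well defined: it is an M-th root of zbar^M W = F / (C_M z^(k-M)).

    f is a uniform limit of polynomials in z and Phi ([rootf_ualg]).  With p = 2M - k and
    h = z^p F / C_M = |z|^(2M) W, which has values in the right half-plane, one has
    f = z^(p-1) (F / C_M) h^(1/M - 1).  Negative powers of a function with values in the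
    closed right half-plane, shifted by a small positive constant, are uniform limits of
    polynomials in that function, because they expand in a binomial series around a far
    enough centre ([pw_poly_approx]).

    f is Lipschitz and strongly monotone ([rootf_estimates]):
      Re ((z - c) (f z - f c)) >= kappa |z - c|^2 with kappa > 0.
    Along a line of direction v the derivative of f is vbar W^(1/M) plus a correction
    bounded by |W|^(1/M) |z| |DW| |v| / (M |W|), and the condition on the gradient of tau_M
    makes the first term dominate ([gradient_condition]).  This also needs
    |DG| = O(|z|^k), which does not follow from G = O(|z|^(k+1)) for a function of class C^1;
    it comes from the smoothness of the surface ([gradient_bound]): if rho is
    a smooth defining function and P the polynomial part of Phi, then z |-> rho (z, P z) is
    smooth and O(|z|^(k+1)), hence has a derivative O(|z|^k) by Taylor's formula, and DG is
    recovered from that derivative because the differential of rho is invertible in the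
    vertical direction.

    Together these give conjugation ([ualg_conj]).  By monotonicity, for d > 0 and c in the
    disc D the product (z - c) (f z - f c) + d has real part at least d, so the function
      (f z - f c) / ((z - c) (f z - f c) + d)
    is a uniform limit of polynomials in z and Phi.  As d tends to 0 it tends to 1 / (z - c),
    and the normalized area integral of 1 / (z - c) over c in D is zbar.  Replacing the
    integral by a finite sum over concentric circles shows that zbar is such a limit too.

    From z and zbar, Bernstein polynomials reach every continuous function
    ([ualg_continuous]).  Polynomial convexity of the graph follows from this density
    ([graph_polynomially_convex]): for (a, b) off the graph and over D, the function
    |z - a|^2 + |Phi - b|^2 has no zero on D, so 1 = (z - a) g1 + (Phi - b) g2 with g1 and
    g2 continuous; approximating g1 and g2 by polynomials P1 and P2 in z and Phi,
    the polynomial 1 - (z - a) P1 - (w - b) P2 is small on the graph and equal to 1 at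
    (a, b). *)

Set Implicit Arguments.
Unset Strict Implicit.
Unset Printing Implicit Defensive.
Import Order.TTheory GRing.Theory Num.Theory.
Import numFieldNormedType.Exports.
Local Open Scope classical_set_scope.
Local Open Scope ring_scope.

(** * Modulus, real and imaginary parts *)

Local Notation Re := complex.Re.
Local Notation Im := complex.Im.

Section Modulus.
Variable R : realType.
Local Notation K := (Cplx R).
Implicit Types (z w : K) (x y : R).

Definition rc (x : R) : K := (x%:C)%C.

Lemma le_of_eq x y : x = y -> x <= y. Proof. by move=> ->. Qed.

Lemma normcE z : `|z| = Num.sqrt (Re z ^+ 2 + Im z ^+ 2).
Proof. by case: z. Qed.

Lemma sqr_modulus z : `|z| ^+ 2 = Re z ^+ 2 + Im z ^+ 2.
Proof. by rewrite normcE sqr_sqrtr// addr_ge0 ?sqr_ge0. Qed.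

Lemma modM z w : `|(z * w : K)| = `|z| * `|w|.
Proof. exact: Normc.normcM. Qed.

Lemma modV z : `|(z^-1 : K)| = `|z|^-1.
Proof. exact: Normc.normcV. Qed.

Lemma mod1 : `|1 : K| = 1. Proof. exact: Normc.normc1. Qed.

Lemma modX z n : `|(z ^+ n : K)| = `|z| ^+ n.
Proof. by elim: n => [|n IH]; rewrite ?expr0 ?mod1// !exprS modM IH. Qed.

Lemma mod_rc x : `|(rc x : K)| = `|x|.
Proof. by rewrite normcE /= expr0n /= addr0 sqrtr_sqr. Qed.

Lemma mod_conj z : `|(conjc z : K)| = `|z|.
Proof. by case: z => a b; rewrite !normcE /= sqrrN. Qed.

Lemma mod_i : `|('i%C : K)| = 1.
Proof. by rewrite normcE /= expr0n /= add0r expr1n sqrtr1. Qed.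

Lemma Re_le_mod z : `|Re z| <= `|z|.
Proof. by rewrite normcE -sqrtr_sqr ler_wsqrtr// lerDl sqr_ge0. Qed.

Lemma Im_le_mod z : `|Im z| <= `|z|.
Proof. by rewrite normcE -sqrtr_sqr ler_wsqrtr// lerDr sqr_ge0. Qed.

Lemma ReD z w : Re (z + w) = Re z + Re w.
Proof. by case: z; case: w. Qed.
Lemma ImD z w : Im (z + w) = Im z + Im w.
Proof. by case: z; case: w. Qed.
Lemma ReN z : Re (- z) = - Re z.
Proof. by case: z. Qed.
Lemma ImN z : Im (- z) = - Im z.
Proof. by case: z. Qed.
Lemma ReM z w : Re (z * w) = Re z * Re w - Im z * Im w.
Proof. by case: z; case: w. Qed.
Lemma ImM z w : Im (z * w) = Re z * Im w + Im z * Re w.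
Proof. by case: z; case: w. Qed.
Lemma Rerc x : Re (rc x) = x. Proof. by []. Qed.
Lemma Imrc x : Im (rc x) = 0. Proof. by []. Qed.
Lemma Reconj z : Re (conjc z : K) = Re z. Proof. by case: z. Qed.
Lemma Imconj z : Im (conjc z : K) = - Im z. Proof. by case: z. Qed.

Lemma cplx_eqP z w : Re z = Re w -> Im z = Im w -> z = w.
Proof. by case: z; case: w => a b c d /= -> ->. Qed.

Lemma rcM x y : rc (x * y) = rc x * rc y.
Proof. by apply: cplx_eqP; rewrite ?ReM ?ImM ?Rerc ?Imrc; ring. Qed.
Lemma rcD x y : rc (x + y) = rc x + rc y.
Proof. by apply: cplx_eqP; rewrite ?ReD ?ImD ?Rerc ?Imrc; ring. Qed.
Lemma rcN x : rc (- x) = - rc x.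
Proof. by apply: cplx_eqP; rewrite ?ReN ?ImN ?Rerc ?Imrc; ring. Qed.
Lemma rc1 : rc 1 = 1. Proof. by []. Qed.
Lemma rc0 : rc 0 = 0. Proof. by []. Qed.
Lemma rcX x n : rc (x ^+ n) = rc x ^+ n.
Proof. by elim: n => [|n IH]; rewrite ?expr0 ?rc1// !exprS rcM IH. Qed.
Lemma rcn n : rc n%:R = n%:R.
Proof. by elim: n => // n IH; rewrite -!natr1 rcD IH. Qed.
Lemma rc_eq0 x : (rc x == 0) = (x == 0).
Proof. by rewrite -normr_eq0 mod_rc normr_eq0. Qed.
Lemma rcV x : rc x^-1 = (rc x)^-1.
Proof.
have [->|x0] := eqVneq x 0; first by rewrite invr0 !rc0 invr0.
by apply: (@mulfI _ (rc x)); rewrite ?rc_eq0// -rcM !divff ?rc_eq0.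
Qed.
Lemma rcZ x z : x *: z = rc x * z.
Proof. by case: z => a b; apply: cplx_eqP; rewrite ?ReM ?ImM /=; ring. Qed.

Lemma Re_i : Re ('i%C : K) = 0. Proof. by []. Qed.
Lemma Im_i : Im ('i%C : K) = 1. Proof. by []. Qed.

Lemma cplxE z : z = rc (Re z) + 'i%C * rc (Im z).
Proof. by apply: cplx_eqP; rewrite !(ReD, ImD) !(ReM, ImM) !(Re_i, Im_i) !(Rerc, Imrc); ring. Qed.

Lemma conjM z w : (conjc (z * w : K) : K) = (conjc z : K) * (conjc w : K).
Proof. by apply: cplx_eqP; rewrite ?Reconj ?Imconj ?ReM ?ImM ?Reconj ?Imconj; ring. Qed.
Lemma conj_rc x : (conjc (rc x) : K) = rc x.
Proof. by apply: cplx_eqP; rewrite ?Reconj ?Imconj ?Rerc ?Imrc; ring. Qed.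
Lemma mulzJ z : z * (conjc z : K) = rc (`|z| ^+ 2).
Proof. by apply: cplx_eqP; rewrite ?ReM ?ImM ?Reconj ?Imconj ?Rerc ?Imrc ?sqr_modulus; ring. Qed.

Lemma mod_le_ReIm z : `|z| <= `|Re z| + `|Im z|.
Proof.
rewrite {1}(cplxE z); apply: le_trans (ler_normD _ _) _.
by rewrite modM mod_i mul1r !mod_rc.
Qed.

Lemma disc_convex (d : R) (c z : K) (t : R) : `|c| < d -> `|z| < d -> 0 <= t <= 1 -> `|c + rc t * (z - c) : K| < d.
Proof.
move=> cd zd /andP[t0 t1].
have -> : c + rc t * (z - c) = rc (1 - t) * c + rc t * z by rewrite rcD rcN rc1; ring.
apply: le_lt_trans (ler_normD _ _) _; rewrite !modM !mod_rc (ger0_norm t0) ger0_norm ?subr_ge0//.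
have [->|tn] := eqVneq t 0; first by rewrite subr0 mul0r mul1r addr0.
have tp : 0 < t by rewrite lt_neqAle eq_sym tn.
have l1 : (1 - t) * `|c| <= (1 - t) * d by rewrite ler_wpM2l ?subr_ge0// ltW.
have l2 : t * `|z| < t * d by rewrite ltr_pM2l.
lra.
Qed.

Lemma Re_inv z : Re z^-1 = Re z / `|z| ^+ 2.
Proof. by rewrite sqr_modulus; case: z. Qed.

Lemma Im_inv z : Im z^-1 = - Im z / `|z| ^+ 2.
Proof. by rewrite sqr_modulus; case: z => a b /=; rewrite mulNr. Qed.

End Modulus.

(** * Uniform limits of polynomials in z and F *)

Section UniformAlgebra.
Variable R : realType.
Local Notation K := (Cplx R).
Variables (D : set K) (F : K -> K).

(** Bounded functions that are uniform limits on D of polynomials in z and F.  Asking for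
    a bound makes the class stable under products for arbitrary D and F. *)
Definition ualg (g : K -> K) : Prop :=
  (exists B : R, forall x, D x -> `|g x| <= B) /\
  forall e : R, 0 < e -> exists P : {poly {poly K}},
    forall x, D x -> `|eval2 P x (F x) - g x : K| <= e.

Lemma eval2D P Q (z w : K) : eval2 (P + Q) z w = eval2 P z w + eval2 Q z w.
Proof. by rewrite /eval2 !hornerD. Qed.

Lemma eval2M P Q (z w : K) : eval2 (P * Q) z w = eval2 P z w * eval2 Q z w.
Proof. by rewrite /eval2 !hornerM. Qed.

Lemma eval2C (c z w : K) : eval2 (c%:P%:P) z w = c.
Proof. by rewrite /eval2 !hornerC. Qed.

Lemma eval2X (z w : K) : eval2 'X z w = w.
Proof. by rewrite /eval2 hornerX hornerC. Qed.

Lemma eval2XP (z w : K) : eval2 ('X%:P) z w = z.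
Proof. by rewrite /eval2 hornerC hornerX. Qed.

Lemma ualg_eq g g' : (forall x, D x -> g x = g' x) -> ualg g -> ualg g'.
Proof.
move=> gg' [[B gB] ga]; split; first by exists B => x Dx; rewrite -gg'//; apply: gB.
by move=> e /ga[P hP]; exists P => x Dx; rewrite -gg'//; apply: hP.
Qed.

Lemma ualg_cst c : ualg (fun=> c).
Proof.
split; first by exists `|c|.
by move=> e e0; exists (c%:P%:P) => x Dx; rewrite eval2C subrr normr0 ltW.
Qed.

Lemma ualg_gen B : (forall x, D x -> `|F x| <= B) -> ualg F.
Proof.
move=> FB; split; first by exists B.
by move=> e e0; exists 'X => x Dx; rewrite eval2X subrr normr0 ltW.
Qed.

Lemma ualg_id B : (forall x, D x -> `|x| <= B) -> ualg id.
Proof.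
move=> FB; split; first by exists B.
by move=> e e0; exists ('X%:P) => x Dx; rewrite eval2XP subrr normr0 ltW.
Qed.

Lemma ualgD g h : ualg g -> ualg h -> ualg (fun x => g x + h x).
Proof.
move=> [[B gB] ga] [[C hC] ha]; split.
  exists (B + C) => x Dx; apply: le_trans (ler_normD _ _) _.
  by apply: lerD; [exact: gB|exact: hC].
move=> e e0; have e2 : 0 < e / 2 by rewrite divr_gt0.
have [P hP] := ga _ e2; have [Q hQ] := ha _ e2.
exists (P + Q) => x Dx; rewrite eval2D.
have -> : eval2 P x (F x) + eval2 Q x (F x) - (g x + h x) =
   (eval2 P x (F x) - g x) + (eval2 Q x (F x) - h x) :> K by ring.
apply: le_trans (ler_normD _ _) _; rewrite [leRHS]splitr.
by apply: lerD; [exact: hP|exact: hQ].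
Qed.

Lemma ualgM g h : ualg g -> ualg h -> ualg (fun x => g x * h x).
Proof.
move=> [[B0 gB0] ga] [[C0 hC0] ha].
pose B := `|B0| + 1; pose C := `|C0| + 1.
have B1 : 1 <= B by rewrite /B lerDr.
have C1 : 1 <= C by rewrite /C lerDr.
have gB x : D x -> `|g x| <= B.
  by move=> /gB0/le_trans; apply; rewrite (le_trans (ler_norm _))// lerDl.
have hC x : D x -> `|h x| <= C.
  by move=> /hC0/le_trans; apply; rewrite (le_trans (ler_norm _))// lerDl.
split.
  exists (B * C) => x Dx; rewrite modM ler_pM//; [exact: gB|exact: hC].
move=> e e0.
pose d := Num.min 1 (e / (2 * (B + C))).
have BC0 : 0 < 2 * (B + C) by lra.
have d0 : 0 < d by rewrite lt_min ltr01 divr_gt0.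
have d1 : d <= 1 by rewrite ge_min lexx.
have de : d * (2 * (B + C)) <= e by rewrite -ler_pdivlMr// ge_min lexx orbT.
have [P hP] := ga _ d0; have [Q hQ] := ha _ d0.
exists (P * Q) => x Dx; rewrite eval2M.
have -> : eval2 P x (F x) * eval2 Q x (F x) - g x * h x =
   (eval2 P x (F x) - g x) * (eval2 Q x (F x) - h x) +
   (g x * (eval2 Q x (F x) - h x) + h x * (eval2 P x (F x) - g x)) :> K by ring.
have {}hP := hP _ Dx; have {}hQ := hQ _ Dx.
have {}gB := gB _ Dx; have {}hC := hC _ Dx.
apply: le_trans (ler_normD _ _) _; rewrite modM.
apply: le_trans (lerD (lexx _) (ler_normD _ _)) _; rewrite !modM.
have := normr_ge0 (eval2 P x (F x) - g x : K); have := normr_ge0 (eval2 Q x (F x) - h x : K).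
have := normr_ge0 (g x); have := normr_ge0 (h x).
move: `|_ - h x : K| `|_ - g x : K| `|g x| `|h x| hP hQ gB hC => u v a b.
move=> ? ? ? ? ? ? ? ?.
have : v * u <= d * 1 by apply: ler_pM => //; apply: le_trans d1.
have : a * u <= B * d by apply: ler_pM.
have : b * v <= C * d by apply: ler_pM.
nra.
Qed.

Lemma ualgN g : ualg g -> ualg (fun x => - g x).
Proof.
move=> /(ualgM (ualg_cst (-1))); apply: ualg_eq => x _; ring.
Qed.

Lemma ualgB g h : ualg g -> ualg h -> ualg (fun x => g x - h x).
Proof. by move=> ? ?; apply: ualgD => //; exact: ualgN. Qed.

Lemma ualgX g n : ualg g -> ualg (fun x => g x ^+ n).
Proof.
move=> ag; elim: n => [|n IH]; first exact: ualg_cst.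
apply: ualg_eq (ualgM ag IH) => x _; by rewrite exprS.
Qed.

Lemma ualg_sum (I : Type) (s : seq I) (P : pred I) (g : I -> K -> K) :
  (forall i, P i -> ualg (g i)) -> ualg (fun x => \sum_(i <- s | P i) g i x).
Proof.
move=> ag; elim: s => [|i s IH].
  by apply: ualg_eq (ualg_cst 0) => x _; rewrite big_nil.
have [Pi|nPi] := boolP (P i).
  apply: ualg_eq (ualgD (ag _ Pi) IH) => x _; by rewrite big_cons Pi.
by apply: ualg_eq IH => x _; rewrite big_cons (negbTE nPi).
Qed.

Lemma ualg_poly (p : {poly K}) g : ualg g -> ualg (fun x => p.[g x]).
Proof.
move=> ag; elim/poly_ind: p => [|p c IH].
  by apply: ualg_eq (ualg_cst 0) => x _; rewrite horner0.
apply: ualg_eq (ualgD (ualgM IH ag) (ualg_cst c)) => x _.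
by rewrite hornerMXaddC.
Qed.

Lemma ualg_lim g :
  (forall e, 0 < e -> exists2 h, ualg h & forall x, D x -> `|h x - g x : K| <= e) ->
  ualg g.
Proof.
move=> ha; split.
  have [h [[B hB] _] hg] := ha 1 ltr01.
  exists (B + 1) => x Dx; rewrite -(subrK (h x) (g x)) addrC.
  apply: le_trans (ler_normD _ _) _; apply: lerD; first exact: hB.
  by rewrite distrC; exact: hg.
move=> e e0; have e2 : 0 < e / 2 by rewrite divr_gt0.
have [h [_ /(_ _ e2)[P hP]] hg] := ha _ e2.
exists P => x Dx; rewrite -(subrK (h x) (eval2 _ _ _)) -addrA.
apply: le_trans (ler_normD _ _) _; rewrite [leRHS]splitr.
by apply: lerD; [exact: hP|exact: hg].
Qed.

End UniformAlgebra.

(** * Derivatives of curves in the plane *)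

Section Calculus.
Variable R : realType.
Local Notation K := (Cplx R).

Lemma rderD (f g : R -> R) (t a b : R) : is_derive t 1 f a -> is_derive t 1 g b ->
  is_derive t 1 (fun s => f s + g s) (a + b).
Proof. exact: is_deriveD. Qed.

Lemma rderN (f : R -> R) (t a : R) : is_derive t 1 f a -> is_derive t 1 (fun s => - f s) (- a).
Proof. exact: is_deriveN. Qed.

Lemma rderM (f g : R -> R) (t a b : R) : is_derive t 1 f a -> is_derive t 1 g b ->
  is_derive t 1 (fun s => f s * g s) (a * g t + f t * b).
Proof.
move=> fa gb; apply: (is_derive_eq (is_deriveM fa gb)).
by rewrite addrC /GRing.scale /= mulrC.
Qed.

Lemma rderc (c t : R) : is_derive t 1 (fun=> c) (0 : R).
Proof. exact: is_derive_cst. Qed.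

Lemma rderV (f : R -> R) (t a : R) : f t != 0 -> is_derive t 1 f a ->
  is_derive t 1 (fun s => (f s)^-1) (- a / f t ^+ 2).
Proof.
move=> f0 fa; apply: (is_derive_eq (is_deriveV f0 fa)).
by rewrite /GRing.scale /= mulNr mulrC mulNr.
Qed.

Lemma rder_comp (f g : R -> R) (t a b : R) : is_derive (g t) 1 f a -> is_derive t 1 g b ->
  is_derive t 1 (fun s => f (g s)) (a * b).
Proof. exact: is_derive1_comp. Qed.

Lemma rder_eq (f g : R -> R) (t a b : R) : f =1 g -> a = b ->
  is_derive t 1 f a -> is_derive t 1 g b.
Proof. by move=> /funext <- <-. Qed.

(** Differentiating coordinate by coordinate gives access to the mean value theorem for
    real functions. *)
Definition cder (f : R -> K) (t : R) (d : K) : Prop :=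
  is_derive t 1 (fun s => Re (f s)) (Re d) /\
  is_derive t 1 (fun s => Im (f s)) (Im d).

Lemma cder_eq f g t a b : f =1 g -> a = b -> cder f t a -> cder g t b.
Proof. by move=> /funext <- <-. Qed.

Lemma cderD f g t a b : cder f t a -> cder g t b ->
  cder (fun s => f s + g s) t (a + b).
Proof.
move=> [f1 f2] [g1 g2]; split.
  by apply: rder_eq (rderD f1 g1) => [s|]; rewrite ReD.
by apply: rder_eq (rderD f2 g2) => [s|]; rewrite ImD.
Qed.

Lemma cderN f t a : cder f t a -> cder (fun s => - f s) t (- a).
Proof.
move=> [f1 f2]; split.
  by apply: rder_eq (rderN f1) => [s|]; rewrite ReN.
by apply: rder_eq (rderN f2) => [s|]; rewrite ImN.
Qed.

Lemma cderB f g t a b : cder f t a -> cder g t b ->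
  cder (fun s => f s - g s) t (a - b).
Proof. by move=> fa gb; apply: cderD => //; exact: cderN. Qed.

Lemma cderM f g t a b : cder f t a -> cder g t b ->
  cder (fun s => f s * g s) t (a * g t + f t * b).
Proof.
move=> [f1 f2] [g1 g2]; split.
  apply: rder_eq (rderD (rderM f1 g1) (rderN (rderM f2 g2))) => [s|].
    by rewrite ReM.
  by rewrite ReD !ReM; ring.
apply: rder_eq (rderD (rderM f1 g2) (rderM f2 g1)) => [s|].
  by rewrite ImM.
by rewrite ImD !ImM; ring.
Qed.

Lemma cderc (c : K) t : cder (fun=> c) t 0.
Proof. by split; exact: rderc. Qed.

Lemma cderZ (c : K) f t a : cder f t a -> cder (fun s => c * f s) t (c * a).
Proof.
by move=> fa; apply: cder_eq (cderM (cderc c t) fa) => //; rewrite mul0r add0r.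
Qed.

Lemma cder_rc (f : R -> R) (t a : R) : is_derive t 1 f a -> cder (fun s => rc (f s)) t (rc a).
Proof. by move=> fa; split => //; exact: rderc. Qed.

Lemma cder_conj f t a : cder f t a ->
  cder (fun s => (conjc (f s) : K)) t (conjc a : K).
Proof.
move=> [f1 f2]; split.
  by apply: rder_eq f1 => [s|]; rewrite Reconj.
by apply: rder_eq (rderN f2) => [s|]; rewrite Imconj.
Qed.

Lemma cderX f t a n : cder f t a ->
  cder (fun s => f s ^+ n) t (n%:R * f t ^+ n.-1 * a).
Proof.
move=> fa; elim: n => [|n IH].
  by apply: cder_eq (cderc 1 t); rewrite ?mul0r.
apply: cder_eq (cderM fa IH) => [s|]; first by rewrite exprS.
case: n {IH} => [|n] /=; first by rewrite expr0; ring.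
rewrite -[n.+2]add1n natrD; rewrite exprS; ring.
Qed.

(** The inverse is written as conj(f) / |f|^2, whose coordinates are real quotients. *)
Lemma cderV f t a : f t != 0 -> cder f t a ->
  cder (fun s => (f s)^-1) t (- a / f t ^+ 2).
Proof.
move=> f0 [f1 f2].
have q0 : `|f t| ^+ 2 != 0 by rewrite sqrf_eq0 normr_eq0.
pose q s := Re (f s) * Re (f s) + Im (f s) * Im (f s).
have qE s : q s = `|f s| ^+ 2 by rewrite sqr_modulus /q; ring.
have dq := rderD (rderM f1 f1) (rderM f2 f2).
have dV := rderV (_ : q t != 0) dq; rewrite qE in dV; have {}dV := dV q0.
have -> : - a / f t ^+ 2 = - a * ((conjc (f t) : K) * (conjc (f t) : K)) * rc ((q t)^-1 ^+ 2).
  have c0 : (conjc (f t) : K) != 0 by rewrite -normr_eq0 mod_conj normr_eq0.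
  rewrite qE rcX rcV -mulzJ; move: c0; set c : K := conjc _ => c0.
  by field; rewrite c0.
split.
  apply: rder_eq (rderM f1 dV) => [s|]; first by rewrite Re_inv -qE.
  rewrite !(ReM, ReN, ImM, ImN) Rerc Imrc Reconj Imconj -qE.
  have : q t != 0 by rewrite qE.
  rewrite /q; move: (Re (f t)) (Im (f t)) => u v h.
  by field.
apply: rder_eq (rderM (rderN f2) dV) => [s|]; first by rewrite Im_inv -qE.
rewrite !(ReM, ReN, ImM, ImN) Rerc Imrc Reconj Imconj -qE.
have : q t != 0 by rewrite qE.
rewrite /q; move: (Re (f t)) (Im (f t)) => u v h.
by field.
Qed.

Lemma cder_affine (c v : K) t : cder (fun s => c + rc s * v) t v.
Proof.
have h := cderD (cderc c t) (cderM (cder_rc (is_derive_id t (1:R))) (cderc v t)).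
by apply: cder_eq h => //; rewrite mulr0 addr0 add0r rc1 mul1r.
Qed.

End Calculus.

(** * Principal powers on the right half-plane *)

Section PrincipalPower.
Variable R : realType.
Local Notation K := (Cplx R).
Implicit Types (z w : K) (a b : R).

(** On the right half-plane this is the principal argument. *)
Definition carg z : R := atan (Im z / Re z).

Fact pw_key : unit. Proof. by []. Qed.
(** The principal power z^a for Re z > 0. *)
Definition pw a z : K := locked_with pw_key
  (rc (expR (a * ln `|z|)) * (rc (cos (a * carg z)) + 'i%C * rc (sin (a * carg z)))).

Lemma Re_pw a z : Re (pw a z) = expR (a * ln `|z|) * cos (a * carg z).
Proof. by rewrite /pw !locked_withE ReM ReD ReM Re_i Im_i !Rerc !Imrc; ring. Qed.

Lemma Im_pw a z : Im (pw a z) = expR (a * ln `|z|) * sin (a * carg z).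
Proof. by rewrite /pw !locked_withE ImM ImD ImM ReD ReM Re_i Im_i !Rerc !Imrc; ring. Qed.

Lemma mod_pw a z : `|pw a z| = expR (a * ln `|z|).
Proof.
rewrite normcE Re_pw Im_pw !exprMn -mulrDr cos2Dsin2 mulr1 sqrtr_sqr.
by rewrite ger0_norm// expR_ge0.
Qed.

Lemma pwD a b z : pw (a + b) z = pw a z * pw b z.
Proof.
apply: cplx_eqP.
  rewrite Re_pw [RHS]ReM !Re_pw !Im_pw !mulrDl expRD cosD; ring.
rewrite Im_pw [RHS]ImM !Re_pw !Im_pw !mulrDl expRD sinD; ring.
Qed.

Lemma pw0 z : pw 0 z = 1.
Proof. by rewrite /pw !locked_withE !mul0r expR0 cos0 sin0 rc1 rc0 mulr0 addr0 mulr1. Qed.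

Lemma ReP_mod_gt0 z : 0 < Re z -> 0 < `|z|.
Proof. by move=> h; apply: lt_le_trans h (le_trans (ler_norm _) (Re_le_mod z)). Qed.

Lemma cos_carg z : 0 < Re z -> `|z| * cos (carg z) = Re z.
Proof.
move=> x0; rewrite /carg cos_atan; have z0 := ReP_mod_gt0 x0.
suff -> : Num.sqrt (1 + (Im z / Re z) ^+ 2) = `|z| / Re z.
  by rewrite invf_div mulrCA divff ?mulr1// gt_eqF.
have -> : 1 + (Im z / Re z) ^+ 2 = (`|z| / Re z) ^+ 2.
  by rewrite !expr_div_n sqr_modulus; field; rewrite gt_eqF.
by rewrite sqrtr_sqr ger0_norm// divr_ge0// ltW.
Qed.

Lemma carg_bounds z : - (pi / 2) < carg z < pi / 2.
Proof. by rewrite atan_gtNpi2 atan_ltpi2. Qed.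

Lemma sin_carg z : 0 < Re z -> `|z| * sin (carg z) = Im z.
Proof.
move=> x0; have c0 : cos (carg z) != 0 by rewrite gt_eqF// cos_gt0_pihalf// carg_bounds.
have : tan (carg z) = Im z / Re z by rewrite /carg atanK.
rewrite /tan => h; have -> : sin (carg z) = Im z / Re z * cos (carg z).
  by rewrite -h divfK.
rewrite mulrCA cos_carg// divfK// gt_eqF//.
Qed.

Lemma pw1 z : 0 < Re z -> pw 1 z = z.
Proof.
move=> x0; apply: cplx_eqP; rewrite ?Re_pw ?Im_pw !mul1r lnK ?posrE ?ReP_mod_gt0//.
  by rewrite cos_carg.
by rewrite sin_carg.
Qed.

(** For exponents in [0, 1] the power can only decrease the absolute value of the argument,
    hence increase its cosine. *)
Lemma Re_pw_ge a z : 0 <= a <= 1 -> 0 < Re z ->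
  `|pw a z| * (Re z / `|z|) <= Re (pw a z).
Proof.
move=> /andP[a0 a1] x0; rewrite mod_pw Re_pw ler_wpM2l ?expR_ge0//.
rewrite -cos_carg// mulrAC divff ?mul1r ?gt_eqF ?ReP_mod_gt0//.
rewrite -cos_norm -(cos_norm (a * _)) normrM (ger0_norm a0).
have := carg_bounds z; rewrite -ltr_norml => cb.
have piT := pi_gt0 R.
have := normr_ge0 (carg z); move: `|carg z| cb => c cb c0.
have ac : a * c <= c by rewrite ler_piMl.
have ac0 : 0 <= a * c by rewrite mulr_ge0.
by rewrite leNgt ltr_cos ?in_itv ?/=  ?c0 ?ac0 -?leNgt //=; lra.
Qed.

Lemma half_ln_sqr (x : R) : 0 <= x -> 2^-1 * ln (x ^+ 2) = ln x.
Proof.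
rewrite le_eqVlt => /orP[/eqP <-|h]; first by rewrite expr0n /= ln0// mulr0.
by rewrite lnXn// -(mulr_natl (ln x)); lra.
Qed.

(** With [cder_carg], the two coordinates of the logarithmic derivative d / f. *)
Lemma cder_lnmod (f : R -> K) t d : cder f t d -> 0 < Re (f t) ->
  is_derive t 1 (fun s => ln `|f s|) (Re (d / f t)).
Proof.
move=> [f1 f2] x0; have z0 := ReP_mod_gt0 x0.
pose q s := Re (f s) * Re (f s) + Im (f s) * Im (f s).
have qE s : q s = `|f s| ^+ 2 by rewrite sqr_modulus /q; ring.
have dq := rderD (rderM f1 f1) (rderM f2 f2).
have q0 : 0 < q t by rewrite qE exprn_gt0.
have dl := rder_comp (is_derive1_ln q0) dq.
apply: rder_eq (rderM (rderc (2^-1) t) dl) => [s|].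
  by rewrite qE; exact: half_ln_sqr.
rewrite ReM Re_inv Im_inv -qE; have := q0; rewrite /q => /lt0r_neq0.
move: (Re (f t)) (Im (f t)) => u v h.
by field; rewrite h.
Qed.

Lemma cder_carg (f : R -> K) t d : cder f t d -> 0 < Re (f t) ->
  is_derive t 1 (fun s => carg (f s)) (Im (d / f t)).
Proof.
move=> [f1 f2] x0; have z0 := ReP_mod_gt0 x0.
have x1 : Re (f t) != 0 by rewrite gt_eqF.
have dl := rder_comp (is_derive1_atan _) (rderM f2 (rderV x1 f1)).
apply: rder_eq dl => //.
rewrite ImM Re_inv Im_inv; have := exprn_gt0 2 z0; rewrite sqr_modulus => /lt0r_neq0.
move: (Re (f t)) (Im (f t)) x1 => u v x1 h.
by field; rewrite ?x1 ?h -?expr2 ?h.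
Qed.

Lemma cder_pw a (f : R -> K) t d : cder f t d -> 0 < Re (f t) ->
  cder (fun s => pw a (f s)) t (rc a * pw a (f t) * (d / f t)).
Proof.
move=> fd x0; have dl := cder_lnmod fd x0; have dc := cder_carg fd x0.
have de := rder_comp (is_derive_expR _) (rderM (rderc a t) dl).
have dC := rder_comp (is_derive_cos _) (rderM (rderc a t) dc).
have dS := rder_comp (is_derive_sin _) (rderM (rderc a t) dc).
split.
  apply: rder_eq (rderM de dC) => [s|]; first by rewrite Re_pw.
  rewrite !(ReM (rc a * _)) !(ReM (rc a)) !(ImM (rc a)) Re_pw Im_pw Rerc Imrc; ring.
apply: rder_eq (rderM de dS) => [s|]; first by rewrite Im_pw.
rewrite !(ImM (rc a * _)) !(ReM (rc a)) !(ImM (rc a)) Re_pw Im_pw Rerc Imrc; ring.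
Qed.

Lemma pw_scale a x z : 0 < x -> 0 < Re z ->
  pw a (rc x * z) = rc (expR (a * ln x)) * pw a z.
Proof.
move=> x0 z0; have z1 := ReP_mod_gt0 z0.
have cE : carg (rc x * z) = carg z.
  rewrite /carg ReM ImM Rerc Imrc !mul0r subr0 addr0; congr atan.
  by field; rewrite !gt_eqF.
have nE : ln `|(rc x * z : K)| = ln x + ln `|z|.
  by rewrite modM mod_rc (gtr0_norm x0) lnM.
by rewrite /pw !locked_withE cE nE [a * (_ + _)]mulrDr expRD rcM mulrA.
Qed.

End PrincipalPower.

(** * Mean value estimates *)

Section MeanValue.
Variable R : realType.
Local Notation K := (Cplx R).

Lemma exp_small (q e : R) : 0 <= q < 1 -> 0 < e -> exists n0, forall n, (n0 <= n)%N -> q ^+ n <= e.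
Proof.
move=> /andP[q0 q1] e0.
have : geometric 1 q @ \oo --> (0 : R) by apply: cvg_geometric; rewrite ger0_norm.
move=> /cvgr0Pnorm_le /(_ _ e0) [n0 _ h]; exists n0 => n /h.
by rewrite /= mul1r ger0_norm// exprn_ge0.
Qed.

(** The powers of sqrt q make up for the linear factor, since (n + 1) y^n is bounded by
    1 / (1 - y). *)
Lemma exp_lin_small (q e : R) : 0 <= q < 1 -> 0 < e ->
  exists n0, forall n, (n0 <= n)%N -> n.+1%:R * q ^+ n <= e.
Proof.
move=> /andP[q0 q1] e0; pose y := Num.sqrt q.
have y0 : 0 <= y by rewrite sqrtr_ge0.
have y1 : y < 1 by rewrite -sqrtr1 ltr_sqrt// ltr01.
have yq : q = y * y by rewrite -expr2 sqr_sqrtr.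
have bnd n : n.+1%:R * y ^+ n <= (1 - y)^-1.
  rewrite -[leRHS]mul1r ler_pdivlMr ?subr_gt0//.
  suff : n.+1%:R * y ^+ n * (1 - y) <= 1 - y ^+ n.+1.
    by move=> /le_trans; apply; rewrite lerBlDr lerDl exprn_ge0.
  elim: n => [|n IH]; first by rewrite !expr0 expr1 mul1r mul1r.
  have hn := exprn_ge0 n y0; have hn1 := exprn_ge0 n.+1 y0.
  have hle : y ^+ n.+1 <= y ^+ n by rewrite exprS ler_piMl// ltW.
  have : n.+1%:R * y ^+ n.+1 * (1 - y) <= n.+1%:R * y ^+ n * (1 - y).
    by apply: ler_wpM2r; [rewrite subr_ge0 ltW|exact: ler_wpM2l].
  have e1 : y ^+ n.+2 = y * y ^+ n.+1 by rewrite exprS.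
  have e2 : n.+2%:R = n.+1%:R + 1 :> R by rewrite -natr1.
  rewrite e1 e2 => h; move: IH.
  by move: (n.+1%:R : R) (y ^+ n.+1) (y ^+ n) h => c u v h IH; nra.
have d0 : 0 < e * (1 - y) by rewrite mulr_gt0// subr_gt0.
have [n0 h] := exp_small (introT andP (conj y0 y1)) d0.
exists n0 => n /h hn; rewrite yq exprMn mulrA.
apply: le_trans (_ : (1 - y)^-1 * (e * (1 - y)) <= e).
  by apply: ler_pM => //; rewrite ?mulr_ge0 ?exprn_ge0.
by rewrite mulrCA mulVf ?mulr1// gt_eqF// subr_gt0.
Qed.

Lemma real_mvt (f df : R -> R) (a b : R) : a <= b ->
  (forall t, a <= t <= b -> is_derive t 1 f (df t)) ->
  exists2 t, a <= t <= b & f b - f a = df t * (b - a).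
Proof.
move=> ab h; have [t tab e] := @MVT_segment R f df a b ab
  (fun t tab => h t (subset_itv_oo_cc tab))
  (derivable_within_continuous (fun t (tab : t \in `[a, b]) => @ex_derive _ _ _ _ _ _ _ (h t tab))).
by exists t.
Qed.

(** The mean value theorem applied to both coordinates at two unrelated points, whence the
    factor 2. *)
Lemma cder_mvt (f df : R -> K) (a b B : R) : a <= b ->
  (forall t, a <= t <= b -> cder f t (df t)) ->
  (forall t, a <= t <= b -> `|df t| <= B) ->
  `|f b - f a : K| <= 2 * B * (b - a).
Proof.
move=> ab hd hB; apply: le_trans (mod_le_ReIm _) _.
have [t tab e1] := real_mvt ab (fun t tab => (hd t tab).1).
have [u uab e2] := real_mvt ab (fun t tab => (hd t tab).2).
rewrite ReD ImD ReN ImN e1 e2 !normrM (ger0_norm (_ : 0 <= b - a)) ?subr_ge0//.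
rewrite -mulrDl ler_wpM2r ?subr_ge0//.
have := le_trans (Re_le_mod _) (hB t tab); have := le_trans (Im_le_mod _) (hB u uab).
by lra.
Qed.

Lemma cder_horner (p : {poly K}) (f : R -> K) t d : cder f t d ->
  cder (fun s => p.[f s]) t (p^`().[f t] * d).
Proof.
move=> fd; elim/poly_ind: p => [|p c IH].
  by apply: cder_eq (cderc 0 t) => [s|]; rewrite ?deriv0 horner0 ?mul0r.
apply: cder_eq (cderD (cderM IH fd) (cderc c t)) => [s|].
  by rewrite hornerMXaddC.
rewrite derivD derivM derivX derivC !hornerE; ring.
Qed.

End MeanValue.

(** * The binomial series *)

Section BinomialSeries.
Variable R : realType.
Local Notation K := (Cplx R).
Variable a : R.
Hypothesis a01 : 0 <= a <= 1.

(** The coefficients of the binomial series of (1 - x)^(-a). *)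
Fixpoint bcoef (n : nat) : R :=
  if n is m.+1 then (a + m%:R) / m.+1%:R * bcoef m else 1.

Definition bpoly n : {poly K} := \sum_(j < n.+1) (rc (bcoef j)) *: 'X^j.

Lemma bcoef_bounds n : 0 <= bcoef n <= 1.
Proof.
have /andP[a0 a1] := a01.
elim: n => [|n /andP[b0 b1]]; first by rewrite ler01 lexx.
rewrite /=; apply/andP; split.
  by rewrite mulr_ge0// divr_ge0// addr_ge0.
rewrite -[leRHS]mul1r ler_pM// ?divr_ge0 ?addr_ge0//.
by rewrite ler_pdivrMr ?ltr0n// mul1r -natr1 addrC lerD2l.
Qed.

(** The function (1 - x)^(-a) solves (1 - x) u' = a u; a partial sum of its series
    satisfies the equation up to one monomial. *)
Lemma bpoly_ode n y : (1 - y) * (bpoly n)^`().[y] - rc a * (bpoly n).[y] =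
  - (rc (a + n%:R) * rc (bcoef n) * y ^+ n).
Proof.
elim: n => [|n IH].
  rewrite /bpoly big_ord_recl big_ord0 addr0 /= expr0 alg_polyC derivC !hornerE ?addr0 ?rc1.
  ring.
rewrite /bpoly big_ord_recr /= -/(bpoly n) derivD derivZ derivXn !hornerE hornerMn !hornerE /=.
have -> : (1 - y) * ((bpoly n)^`().[y] + rc ((a + n%:R) / n.+1%:R * bcoef n) * (y ^+ n *+ n.+1)) -
   rc a * ((bpoly n).[y] + rc ((a + n%:R) / n.+1%:R * bcoef n) * y ^+ n.+1) =
   ((1 - y) * (bpoly n)^`().[y] - rc a * (bpoly n).[y]) +
   (1 - y) * rc ((a + n%:R) / n.+1%:R * bcoef n) * (y ^+ n *+ n.+1)
   - rc a * rc ((a + n%:R) / n.+1%:R * bcoef n) * y ^+ n.+1 by ring.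
rewrite IH -(mulr_natl (y ^+ n)) exprS !rcM rcV !rcD !rcn -natr1.
have : (n%:R + 1 : K) != 0 by rewrite natr1 -rcn rc_eq0 pnatr_eq0.
move: (n%:R : K) => N N0.
by field.
Qed.

Lemma pw_one (b : R) : pw b 1 = 1 :> K.
Proof.
have e1 : `|(1 : K)| = 1 by exact: mod1.
by rewrite /pw locked_withE /carg e1 ln1 mulr0 expR0 /= mul0r atan0 mulr0 cos0 sin0 rc1 rc0 mulr0 addr0 mulr1.
Qed.

(** By [bpoly_ode] the derivative of (partial sum) * (1 - x)^a along a ray consists of one
    explicit term, so the mean value theorem shows that this product stays close to its value
    1 at the origin. *)
Lemma bpoly_approx (q e : R) : 0 <= q < 1 -> 0 < e ->
  exists n, forall x : K, `|x| <= q -> `|(bpoly n).[x] - pw (- a) (1 - x) : K| <= e.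
Proof.
move=> /andP[q0 q1] e0; have /andP[a0 a1] := a01.
have q1' : 0 < 1 - q by rewrite subr_gt0.
pose d := e * (1 - q) ^+ 2 / 4.
have d0 : 0 < d by rewrite !mulr_gt0 ?invr_gt0 ?exprn_gt0.
have [n0 hn0] := exp_lin_small (introT andP (conj q0 q1)) d0.
have := hn0 n0 (leqnn _); set n := n0 => hn {hn0}.
exists n => x xq.
have Re1 (s : R) : 0 <= s <= 1 -> 1 - q <= Re (1 - rc s * x : K).
  move=> /andP[s0 s1]; rewrite ReD ReN ReM Rerc Imrc mul0r subr0.
  have : s * Re x <= 1 * q.
    apply: le_trans (ler_norm _) _; rewrite normrM ger0_norm// ler_pM//.
    exact: le_trans (Re_le_mod x) xq.
  have -> : Re (1 : K) = 1 by [].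
  lra.
pose u s : K := (bpoly n).[rc s * x] * pw a (1 - rc s * x).
pose du s : K := - (rc (a + n%:R) * rc (bcoef n) * (rc s * x) ^+ n) * x * pw a (1 - rc s * x) / (1 - rc s * x).
have hu s : 0 <= s <= 1 -> cder u s (du s).
  move=> s01; have re := lt_le_trans q1' (Re1 s s01).
  have c1 : cder (fun s => rc s * x) s x.
    by apply: cder_eq (cder_affine 0 x s) => // t; rewrite add0r.
  have c2 : cder (fun s => 1 - rc s * x) s (- x).
    by apply: cder_eq (cderB (cderc 1 s) c1) => //; rewrite sub0r.
  have h := cderM (cder_horner (bpoly n) c1) (cder_pw a c2 re).
  apply: cder_eq h => //; rewrite /du -bpoly_ode.
  have : 1 - rc s * x != 0 by rewrite -normr_eq0 gt_eqF// (ReP_mod_gt0 re).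
  set y := rc s * x => y0; set A := pw a _; set E := horner (deriv _) y; set B := horner _ y.
  by field.
have mb s : 0 <= s <= 1 -> 1 - q <= `|(1 - rc s * x : K)| <= 2.
  move=> s01; rewrite (le_trans (Re1 s s01)) ?(le_trans (ler_norm _) (Re_le_mod _))//=.
  apply: le_trans (ler_normD _ _) _; rewrite mod1 normrN modM mod_rc.
  have /andP[s0 s1] := s01; rewrite ger0_norm//.
  have : s * `|x| <= 1 * 1 by rewrite ler_pM// (le_trans xq)// ltW.
  lra.
have hB s : 0 <= s <= 1 -> `|du s| <= n.+1%:R * q ^+ n * 2 / (1 - q).
  move=> s01; have /andP[m1 m2] := mb s s01; have /andP[s0 s1] := s01.
  have mp := lt_le_trans q1' m1.
  rewrite /du !modM normrN !modM modV modX modM !mod_rc.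
  have /andP[b0 b1] := bcoef_bounds n.
  rewrite (ger0_norm s0) (ger0_norm b0) ger0_norm ?addr_ge0//.
  have sx0 : 0 <= s * `|x| by rewrite mulr_ge0.
  apply: ler_pM; rewrite ?invr_ge0 ?mulr_ge0 ?exprn_ge0 ?addr_ge0//; last first.
    by rewrite lef_pV2 ?posrE.
  apply: ler_pM; rewrite ?mulr_ge0 ?exprn_ge0 ?addr_ge0//; last first.
    rewrite mod_pw -[leRHS](@lnK R) ?posrE// ler_expR.
    have [l0|l0] := leP 0 (ln `|(1 - rc s * x : K)|).
      apply: le_trans (_ : 1 * ln `|(1 - rc s * x : K)| <= _); first by rewrite ler_wpM2r.
      by rewrite mul1r ler_ln ?posrE.
    apply: le_trans (_ : 0 <= _); first by rewrite mulr_ge0_le0// ltW.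
    by rewrite ln_ge0// ler1n.
  rewrite -[leRHS]mulr1; apply: ler_pM; rewrite ?mulr_ge0 ?exprn_ge0 ?addr_ge0//; last by rewrite (le_trans xq)// ltW.
  apply: ler_pM; rewrite ?mulr_ge0 ?exprn_ge0 ?addr_ge0//; last first.
    rewrite lerXn2r ?nnegrE ?mulr_ge0//.
    by apply: le_trans xq; rewrite ler_piMl.
  rewrite -[leRHS]mulr1 ler_pM ?addr_ge0// -natr1 addrC lerD2l//.
have := cder_mvt ler01 hu hB.
(* the mean value bound is used at the end of the ray, where s = 1 *)
have m10 : `|(1 - x : K)| = `|(1 - rc 1 * x : K)| by rewrite rc1 mul1r.
have s11 : 0 <= (1:R) <= 1 by rewrite ler01 lexx.
have /andP[m1 m2] := mb _ s11.
rewrite /u rc1 rc0 mul1r mul0r subr0 pw_one mulr1.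
have -> : (bpoly n).[0] = 1.
  rewrite /bpoly horner_sum big_ord_recl /= hornerZ hornerXn expr0 mulr1 big1 ?addr0// => i _.
  by rewrite hornerZ hornerXn expr0n /= mulr0.
move=> hfin.
have -> : (bpoly n).[x] - pw (- a) (1 - x) = ((bpoly n).[x] * pw a (1 - x) - 1) * pw (- a) (1 - x).
  by rewrite mulrBl mul1r -mulrA -pwD subrr pw0 mulr1.
rewrite modM.
have pb : `|pw (- a) (1 - x)| <= (1 - q)^-1.
  rewrite mod_pw -[leRHS](@lnK R) ?posrE ?invr_gt0// ler_expR lnV ?posrE//.
  rewrite mulNr lerN2 m10.
  have l1 : ln (1 - q) <= 0 by rewrite ln_le0// gerBl.
  apply: le_trans (_ : a * ln (1 - q) <= _); first by move: (ln _) l1 => L; nra.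
  by rewrite ler_wpM2l// ler_ln ?posrE// (lt_le_trans q1').
apply: le_trans (ler_pM _ _ hfin pb) _ => //.
rewrite subr0 mulr1.
apply: le_trans (_ : 2 * (d * 2 / (1 - q)) / (1 - q) <= _).
  by rewrite ler_wpM2r ?invr_ge0 ?(ltW q1')// ler_wpM2l// ler_wpM2r ?invr_ge0 ?(ltW q1')// ler_wpM2r.
rewrite /d; apply: le_of_eq; field.
by rewrite gt_eqF.
Qed.

End BinomialSeries.

(** * Polynomial approximation of powers on half-discs *)

Section PowerApproximation.
Variable R : realType.
Local Notation K := (Cplx R).

(** The translated half-disc z + d lies in a disc centred at r + d, of radius smaller than
    r + d once r is large: writing z + d = (r + d) (1 - x), one gets
    |x|^2 <= (r^2 + B^2) / (r + d)^2 < 1, and the binomial series in x converges uniformly. *)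
Lemma pw_poly_approx (a d B e : R) : 0 <= a <= 1 -> 0 < d -> 0 < e ->
  exists p : {poly K}, forall z : K, 0 <= Re z -> `|z| <= B ->
    `|p.[z] - pw (- a) (z + rc d) : K| <= e.
Proof.
move=> a01 d0 e0.
have [B0|B0] := ltP B 0.
  by exists 0 => z _ zB; have := le_lt_trans zB B0; rewrite normr_lt0.
(* then (r + d)^2 - (r^2 + B^2) = B^2 + d^2 > 0 *)
pose r := B ^+ 2 / d.
have r0 : 0 <= r by rewrite divr_ge0// ?sqr_ge0// ltW.
have rd : 0 < r + d by rewrite ltr_wpDl.
pose q := Num.sqrt (r ^+ 2 + B ^+ 2) / (r + d).
have q01 : 0 <= q < 1.
  rewrite divr_ge0 ?sqrtr_ge0 ?(ltW rd)//= ltr_pdivrMr// mul1r.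
  rewrite -[ltRHS](ger0_norm (ltW rd)) -sqrtr_sqr ltr_sqrt ?exprn_gt0//.
  have rdB : r * d = B ^+ 2 by rewrite /r divfK// gt_eqF.
  have := exprn_gt0 2 d0; have := sqr_ge0 B; nra.
pose C := expR (- a * ln (r + d)).
have C0 : 0 < C by rewrite expR_gt0.
have [n hn] := bpoly_approx a01 q01 (divr_gt0 e0 C0).
exists (rc C *: (bpoly a n \Po ((rc (r + d))^-1 *: ((rc r)%:P - 'X)))) => z z0 zB.
rewrite hornerZ horner_comp !hornerE.
set x : K := _ * (rc r - z).
have rdK : rc (r + d) != 0 by rewrite rc_eq0 gt_eqF.
have xE : z + rc d = rc (r + d) * (1 - x).
  by rewrite /x mulrBr mulr1 mulrA mulfV// mul1r rcD; ring.
have xq : `|x| <= q.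
  rewrite /x modM modV mod_rc (gtr0_norm rd) mulrC ler_wpM2r ?invr_ge0 ?(ltW rd)//.
  rewrite normcE ler_wsqrtr// ReD ImD ReN ImN Rerc Imrc.
  have : `|z| ^+ 2 <= B ^+ 2 by rewrite lerXn2r ?nnegrE.
  rewrite sqr_modulus; nra.
have re1 : 0 < Re (1 - x : K).
  rewrite ReD ReN; have := le_trans (le_trans (ler_norm _) (Re_le_mod x)) xq.
  have -> : Re (1 : K) = 1 by [].
  by move: q01 => /andP[]; lra.
rewrite xE pw_scale// -/C -mulrBr modM mod_rc (gtr0_norm C0).
rewrite -ler_pdivlMl// mulrC; exact: hn.
Qed.

End PowerApproximation.

(** * Cauchy and Poisson sums over roots of unity *)

Section RootsOfUnity.
Variable R : realType.
Local Notation K := (Cplx R).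

Lemma prim_root_exists n : (n > 0)%N -> exists w : K, n.-primitive_root w.
Proof.
pose p : {poly K} := 'X^n - 1; have [r Dp] := closed_field_poly_normal p.
move=> n_gt0; rewrite (monicP _) ?monicXnsubC // scale1r in Dp.
have rn1: all n.-unity_root r by apply/allP=> z; rewrite -root_prod_XsubC -Dp.
have sz_r: (n < (size r).+1)%N.
  by rewrite -(size_prod_XsubC r id) -Dp size_XnsubC.
have [|z] := hasP (has_prim_root n_gt0 rn1 _ sz_r); last by exists z.
rewrite -separable_prod_XsubC -Dp separable_Xn_sub_1 //.
by rewrite -rcn rc_eq0 pnatr_eq0 -lt0n.
Qed.

Variables (n : nat) (w : K).
Hypothesis n0 : (0 < n)%N.
Hypothesis wP : n.-primitive_root w.

Lemma mod_prim_root : `|w| = 1.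
Proof.
have := prim_expr_order wP => /(congr1 (fun x : K => `|x|)).
by rewrite modX mod1 => /eqP; rewrite pexpr_eq1// => /eqP.
Qed.

Lemma prim_root_power_sum k : (0 < k < n)%N -> \sum_(j < n) w ^+ (k * j) = 0 :> K.
Proof.
move=> /andP[k0 kn].
have wk1 : w ^+ k - 1 != 0.
  rewrite subr_eq0 -(prim_order_dvd wP); apply/negP => /(dvdn_leq k0).
  by rewrite leqNgt kn.
apply: (mulfI wk1); rewrite mulr0.
under eq_bigr do rewrite exprM.
by rewrite -subrX1 -exprM mulnC exprM (prim_expr_order wP) expr1n subrr.
Qed.

(** The logarithmic derivative of z^n - c^n. *)
Lemma sum_inv_roots (z c : K) : z ^+ n - c ^+ n != 0 ->
  \sum_(j < n) (z - c * w ^+ j)^-1 = n%:R * z ^+ n.-1 / (z ^+ n - c ^+ n).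
Proof.
move=> h.
have inv j : (z - c * w ^+ j)^-1 =
   (\sum_(i < n) z ^+ (n.-1 - i) * (c * w ^+ j) ^+ i) / (z ^+ n - c ^+ n).
  have e : z ^+ n - c ^+ n = z ^+ n - (c * w ^+ j) ^+ n.
    by rewrite exprMn exprAC (prim_expr_order wP) expr1n mulr1.
  rewrite e subrXX; rewrite e subrXX mulf_eq0 negb_or in h.
  by move: h => /andP[h1 h2]; rewrite invfM mulrCA mulfV// mulr1.
under eq_bigr do rewrite inv.
rewrite -mulr_suml; congr (_ / _).
rewrite exchange_big /=.
under eq_bigr => i _ do under eq_bigr => j _ do rewrite exprMn -exprM mulnC mulrA.
under eq_bigr => i _ do rewrite -mulr_sumr.
case: n n0 wP prim_root_power_sum => // m _ _ ps.
rewrite big_ord_recl /= subn0 expr0 mulr1.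
rewrite [X in _ + X]big1 => [|i _]; last by rewrite ps ?mulr0// /bump /= ltnS.
by rewrite addr0; under eq_bigr do rewrite mul0n expr0; rewrite sumr_const card_ord mulrC.
Qed.

(** The Poisson kernel as a real part. *)
Lemma poisson_term (z c : K) : z != c ->
  (`|z| ^+ 2 - `|c| ^+ 2) / `|z - c : K| ^+ 2 = Re (2%:R * z / (z - c) - 1 : K).
Proof.
move=> zc; have h : z - c != 0 by rewrite subr_eq0.
have h2 : `|z - c : K| ^+ 2 != 0 by rewrite sqrf_eq0 normr_eq0.
have -> : 2%:R * z / (z - c) - 1 = (z + c) * (conjc (z - c : K) : K) / ((z - c) * (conjc (z - c : K) : K)).
  have c0 : (conjc (z - c : K) : K) != 0 by rewrite -normr_eq0 mod_conj normr_eq0.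
  rewrite -mulf_div divff// mulr1; by field.
rewrite mulzJ -rcV ReM Rerc Imrc mulr0 subr0; congr (_ / _).
rewrite ReM Reconj Imconj !(ReD, ImD, ReN, ImN) !sqr_modulus; ring.
Qed.

(** Averaging the Poisson kernel over the orbit of c under the n-th roots of unity gives the
    Poisson kernel of the n-th powers.  It is the source of the bound on the average of
    |z - c|^(-2), hence of |z - c|^(-1), over a circle that passes near z. *)
Lemma poisson_sum (z c : K) : z ^+ n - c ^+ n != 0 ->
  (`|z| ^+ 2 - `|c| ^+ 2) * \sum_(j < n) (`|z - c * w ^+ j : K| ^+ 2)^-1 =
  n%:R * Re ((z ^+ n + c ^+ n) / (z ^+ n - c ^+ n) : K).
Proof.
move=> h; rewrite mulr_sumr.
have E j : (`|z| ^+ 2 - `|c| ^+ 2) * (`|z - c * w ^+ j : K| ^+ 2)^-1 =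
   Re (2%:R * z * (z - c * w ^+ j)^-1 - 1 : K).
  rewrite -poisson_term ?modM ?modX ?mod_prim_root ?expr1n ?mulr1//.
  apply/eqP => e; move/eqP: h; apply.
  by rewrite e exprMn exprAC (prim_expr_order wP) expr1n mulr1 subrr.
have ReS (F : 'I_n -> K) : Re (\sum_j F j : K) = \sum_j Re (F j).
  by elim/big_rec2: _ => // i x y _ <-; rewrite ReD.
under eq_bigr do rewrite E.
rewrite -ReS sumrB -mulr_sumr sum_inv_roots// sumr_const card_ord.
rewrite -[n%:R in RHS]Rerc.
transitivity (Re (rc n%:R * ((z ^+ n + c ^+ n) / (z ^+ n - c ^+ n)) : K)).
  rewrite rcn -{3}(prednK n0) -(prednK n0) in h *.
  congr Re; move: h; rewrite (prednK n0).
  have -> : z ^+ n = z * z ^+ n.-1 by rewrite -exprS prednK.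
  by move: (z ^+ n.-1) (c ^+ n) (n%:R : K) => a b N h; field.
by rewrite ReM Imrc mul0r subr0.
Qed.

End RootsOfUnity.

(** * Averages of the Cauchy kernel over a circle *)

Section CircleAverages.
Variable R : realType.
Local Notation K := (Cplx R).

(** 1 / sqrt (u + 1/2) <= 2 (sqrt (u + 1) - sqrt u), and the right-hand side telescopes. *)
Lemma sum_invsqrt_le (N L : nat) :
  \sum_(d < N) (if (d < L)%N then (Num.sqrt (d%:R + 2^-1))^-1 else 0) <=
  2 * Num.sqrt (L%:R : R).
Proof.
apply: le_trans (_ : _ <= 2 * Num.sqrt (minn N L)%:R) _; last first.
  by rewrite ler_wpM2l// ler_wsqrtr// ler_nat geq_minr.
elim: N => [|N IH]; first by rewrite big_ord0 min0n sqrtr0 mulr0.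
rewrite big_ord_recr /=; case: ltnP => NL; last first.
  by rewrite addr0 (minn_idPr _) 1?leqW//; rewrite (minn_idPr NL) in IH.
rewrite (minn_idPl _)//; rewrite (minn_idPl (ltnW NL)) in IH.
apply: le_trans (lerD IH (lexx _)) _.
set u : R := N%:R; have u0 : 0 <= u by rewrite ler0n.
have -> : N.+1%:R = u + 1 :> R by rewrite natr1.
set r := Num.sqrt u; set s := Num.sqrt (u + 1); set h := Num.sqrt _.
have r2 : r ^+ 2 = u by rewrite sqr_sqrtr.
have s2 : s ^+ 2 = u + 1 by rewrite sqr_sqrtr// addr_ge0.
have h2 : h ^+ 2 = u + 2^-1 by rewrite sqr_sqrtr// addr_ge0// invr_ge0.
have r0 : 0 <= r by rewrite sqrtr_ge0.
have s0 : 0 <= s by rewrite sqrtr_ge0.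
have h0 : 0 < h by rewrite sqrtr_gt0 ltr_wpDl// invr_gt0.
have rsh : r + s <= 2 * h.
  rewrite -(ler_pXn2r (_ : 0 < 2)%N) ?nnegrE ?addr_ge0 ?mulr_ge0 ?(ltW h0)//.
  have := sqr_ge0 (r - s); nra.
rewrite -(ler_pM2r h0) mulrDl mulVf ?gt_eqF//.
(* r + s <= 2h, so the telescoping term s - r = 1 / (r + s) is at least 1 / (2h) *)
have e : (s - r) * (s + r) = 1 by nra.
have sr : r <= s by rewrite ler_wsqrtr// lerDl.
have : 0 <= (s - r) * (2 * h - (r + s)) by rewrite mulr_ge0 ?subr_ge0.
lra.
Qed.

Section OneCircle.
Variables (n : nat) (w : K).
Hypothesis n0 : (0 < n)%N.
Hypothesis wP : n.-primitive_root w.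
Variables (z c : K) (eta : R).
Hypothesis eta0 : 0 <= eta.
Hypothesis eta3 : eta <= 3^-1.
Hypothesis z0 : z != 0.
(** When X = |c|^n and Y = |z|^n are far apart, in ratio at most eta, the discrete
    average over the circle through c behaves as the integral would. *)
Variables X Y : R.
Hypothesis modc_pow : `|c ^+ n : K| = X.
Hypothesis modz_pow : `|z ^+ n : K| = Y.

Lemma Y_gt0 : 0 < Y. Proof. by rewrite -modz_pow modX exprn_gt0// normr_gt0. Qed.
Lemma X_ge0 : 0 <= X. Proof. by rewrite -modc_pow. Qed.

Lemma X_gt0 : Y <= eta * X -> 0 < X.
Proof.
move=> h; rewrite lt_neqAle X_ge0 andbT; apply/eqP => e; move: h.
by rewrite -e mulr0 leNgt Y_gt0.
Qed.

Lemma sub_pow_in : X <= eta * Y -> 2 / 3 * Y <= `|z ^+ n - c ^+ n : K|.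
Proof.
move=> h; have := lerB_dist (z ^+ n : K) (c ^+ n); rewrite modz_pow modc_pow.
have : eta * Y <= 3^-1 * Y by rewrite ler_wpM2r// ltW// Y_gt0.
lra.
Qed.

Lemma sub_pow_out : Y <= eta * X -> 2 / 3 * X <= `|z ^+ n - c ^+ n : K|.
Proof.
move=> h; have := lerB_dist (c ^+ n : K) (z ^+ n); rewrite modz_pow modc_pow distrC.
have : eta * X <= 3^-1 * X by rewrite ler_wpM2r// X_ge0.
lra.
Qed.

Lemma sub_pow_neq0 : X <= eta * Y \/ Y <= eta * X -> z ^+ n - c ^+ n != 0.
Proof.
move=> h; rewrite -normr_gt0; have Y0 := Y_gt0.
case: h => h; first by apply: lt_le_trans (sub_pow_in h); lra.
have X0 := X_gt0 h.
by apply: lt_le_trans (sub_pow_out h); lra.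
Qed.

Let avg : K := n%:R^-1 * \sum_(j < n) (z - c * w ^+ j)^-1.

Lemma avgE : z ^+ n - c ^+ n != 0 -> avg = z ^+ n.-1 / (z ^+ n - c ^+ n).
Proof.
move=> h; rewrite /avg (sum_inv_roots n0 wP)// -mulrA mulKf//.
by rewrite -rcn rc_eq0 pnatr_eq0 -lt0n.
Qed.

(** The average of 1 / (z - c) over a circle is 1 / z when z is outside the circle, and by
    [avg_outside] it is 0 when z is inside. *)
Lemma avg_inside : X <= eta * Y -> `|avg - z^-1 : K| <= 2 * eta / `|z|.
Proof.
move=> h; have d0 := sub_pow_neq0 (or_introl h).
rewrite avgE//.
have -> : z ^+ n.-1 / (z ^+ n - c ^+ n) - z^-1 = c ^+ n / (z ^+ n - c ^+ n) * z^-1 :> K.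
  move: d0; have -> : z ^+ n = z * z ^+ n.-1 by rewrite -exprS prednK.
  by move: (z ^+ n.-1) (c ^+ n) => u v d0; field; rewrite z0 d0.
rewrite !modM modc_pow !modV ler_wpM2r ?invr_ge0//.
have Y0 := Y_gt0; have := sub_pow_in h => h2.
have := ler_wpM2l eta0 h2; have := mulr_ge0 eta0 (ltW Y0).
rewrite ler_pdivrMr; first by lra.
by apply: lt_le_trans h2; lra.
Qed.

Lemma avg_outside : Y <= eta * X -> `|avg| <= 2 * eta / `|z|.
Proof.
move=> h; have d0 := sub_pow_neq0 (or_intror h).
rewrite avgE//.
have -> : z ^+ n.-1 / (z ^+ n - c ^+ n) = z ^+ n / (z ^+ n - c ^+ n) * z^-1 :> K.
  have -> : z ^+ n = z * z ^+ n.-1 by rewrite -exprS prednK.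
  rewrite [z * _]mulrC -!mulrA; congr (_ * _); rewrite mulrCA mulfV// mulr1 //.
rewrite !modM modz_pow !modV ler_wpM2r ?invr_ge0//.
have Y0 := Y_gt0; have := sub_pow_out h => h2.
have X0 := X_gt0 h.
have := ler_wpM2l eta0 h2; have := mulr_ge0 eta0 (ltW X0).
rewrite ler_pdivrMr; first by lra.
by apply: lt_le_trans h2; lra.
Qed.

Lemma avg_sqr_le : X <= eta * Y \/ Y <= eta * X ->
  `| `|z| ^+ 2 - `|c| ^+ 2| * (n%:R^-1 * \sum_(j < n) (`|z - c * w ^+ j : K| ^+ 2)^-1) <= 2.
Proof.
move=> h; have d0 := sub_pow_neq0 h.
have S0 : 0 <= \sum_(j < n) (`|z - c * w ^+ j : K| ^+ 2)^-1.
  by apply: sumr_ge0 => j _; rewrite invr_ge0 exprn_ge0.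
have nn : n%:R != 0 :> R by rewrite pnatr_eq0 -lt0n.
rewrite mulrCA -[X in `|_| * X](ger0_norm S0) -normrM (poisson_sum n0 wP)//.
rewrite normrM [`|n%:R|]ger0_norm ?ler0n// mulrA mulVf// mul1r.
apply: le_trans (Re_le_mod _) _; rewrite modM modV ler_pdivrMr ?normr_gt0//.
apply: le_trans (ler_normD _ _) _; rewrite modz_pow modc_pow.
have hX : eta * X <= 3^-1 * X by rewrite ler_wpM2r// X_ge0.
have hY : eta * Y <= 3^-1 * Y by rewrite ler_wpM2r// ltW// Y_gt0.
by case: h => h; [have := sub_pow_in h|have := sub_pow_out h]; lra.
Qed.

(** By the arithmetic-geometric inequality, from the bound on the average of squares. *)
Lemma avg_inv_le : X <= eta * Y \/ Y <= eta * X -> `|z| ^+ 2 != `|c| ^+ 2 ->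
  n%:R^-1 * \sum_(j < n) (`|z - c * w ^+ j : K|)^-1 <=
  Num.sqrt (2 / `| `|z| ^+ 2 - `|c| ^+ 2|).
Proof.
move=> h ne; have := avg_sqr_le h.
set q := `| _ - _|; have q0 : 0 < q by rewrite normr_gt0 subr_eq0.
set A := _ * \sum_(j < n) _ => hA.
have hA2 : A <= 2 / q by rewrite ler_pdivlMr// mulrC.
set l := Num.sqrt _; have l2 : l ^+ 2 = 2 / q by rewrite sqr_sqrtr// divr_ge0// ltW.
have l0 : 0 < l by rewrite sqrtr_gt0 divr_gt0.
have amgm (u : R) : u^-1 <= 2^-1 * l + (2 * l)^-1 * (u ^+ 2)^-1.
  rewrite -exprVn; move: u^-1 => v.
  rewrite -(ler_pM2l l0) mulrDr.
  have -> : l * ((2 * l)^-1 * v ^+ 2) = 2^-1 * v ^+ 2 by field; rewrite gt_eqF.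
  have := sqr_ge0 (l - v); nra.
have nn : 0 < n%:R :> R by rewrite ltr0n.
apply: le_trans (_ : n%:R^-1 * \sum_(j < n) (2^-1 * l + (2 * l)^-1 * (`|z - c * w ^+ j : K| ^+ 2)^-1) <= _).
  by rewrite ler_wpM2l ?invr_ge0 ?(ltW nn)//; apply: ler_sum => j _; exact: amgm.
rewrite big_split /= sumr_const card_ord -mulr_sumr mulrDr -(mulr_natl (2^-1 * l)).
rewrite mulrA mulVf ?gt_eqF// mul1r mulrCA -/A.
apply: le_trans (lerD (lexx _) (ler_wpM2l _ hA2)) _.
  by rewrite invr_ge0 mulr_ge0// ltW.
rewrite -l2; apply: le_of_eq; field.
by rewrite gt_eqF.
Qed.

End OneCircle.
End CircleAverages.

(** * Powers of elements of the algebra *)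

Section PowerInAlgebra.
Variable R : realType.
Local Notation K := (Cplx R).

(** The polynomial approximating the power depends only on a bound for g, so it can be
    composed with g. *)
Lemma ualg_pw (D : set K) (F g : K -> K) (a d : R) : 0 <= a <= 1 -> 0 < d ->
  ualg D F g -> (forall x, D x -> 0 <= Re (g x)) ->
  ualg D F (fun x => pw (- a) (g x + rc d)).
Proof.
move=> a01 d0 ag g0; have [[B gB] _] := ag.
apply: ualg_lim => e e0.
have [p hp] := pw_poly_approx B a01 d0 e0.
by exists (fun x => p.[g x]); [exact: ualg_poly|move=> x Dx; apply: hp; [exact: g0|exact: gB]].
Qed.

Lemma pwN1 (w : K) : 0 < Re w -> pw (- 1) w = w^-1.
Proof.
move=> w0; have w1 : w != 0 by rewrite -normr_eq0 gt_eqF// ReP_mod_gt0.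
by apply: (mulIf w1); rewrite mulVf// -{2}(pw1 w0) -pwD addNr pw0.
Qed.

End PowerInAlgebra.

(** * Regularized Cauchy kernels *)

Section MonotoneKernel.
Variable R : realType.
Local Notation K := (Cplx R).
Variables (rho L kap : R) (F f : K -> K).
Local Notation D := (closed_disc rho).
Hypothesis rho0 : 0 < rho.
Hypothesis kap0 : 0 < kap.
Hypothesis L0 : 0 <= L.
Hypothesis af : ualg D F f.
Hypothesis fL : forall z c, D z -> D c -> `|f z - f c : K| <= L * `|z - c : K|.
Hypothesis fm : forall z c, D z -> D c ->
  kap * `|z - c : K| ^+ 2 <= Re ((z - c) * (f z - f c) : K).

(** A regularization of the Cauchy kernel 1 / (z - c), which it tends to as d tends to 0. *)
Definition mker (d : R) (c z : K) : K := (f z - f c) / ((z - c) * (f z - f c) + rc d).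

Lemma mker_denom d c z : 0 < d -> D z -> D c ->
  d + kap * `|z - c : K| ^+ 2 <= `|(z - c) * (f z - f c) + rc d : K|.
Proof.
move=> d0 Dz Dc; apply: le_trans (le_trans (ler_norm _) (Re_le_mod _)).
by rewrite ReD Rerc addrC lerD2r fm.
Qed.

Lemma mker_denom_ge d c z : 0 < d -> D z -> D c ->
  d <= `|(z - c) * (f z - f c) + rc d : K|.
Proof.
by move=> d0 Dz Dc; apply: le_trans (mker_denom d0 Dz Dc); rewrite lerDl mulr_ge0 ?sqr_ge0// ltW.
Qed.

Lemma mker_denom_neq0 d c z : 0 < d -> D z -> D c ->
  (z - c) * (f z - f c) + rc d != 0.
Proof.
by move=> d0 Dz Dc; rewrite -normr_gt0; apply: lt_le_trans (mker_denom_ge d0 Dz Dc).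
Qed.

Lemma mker_err d c z : 0 < d -> D z -> D c -> z != c ->
  `|mker d c z - (z - c)^-1 : K| = d / (`|z - c : K| * `|(z - c) * (f z - f c) + rc d : K|).
Proof.
move=> d0 Dz Dc zc; have n0 := mker_denom_neq0 d0 Dz Dc.
have h : z - c != 0 by rewrite subr_eq0.
have -> : mker d c z - (z - c)^-1 = - rc d / ((z - c) * ((z - c) * (f z - f c) + rc d)).
  rewrite /mker; move: n0; set u := z - c in h *; set v := f z - f c.
  by move=> n0; field; rewrite h n0.
by rewrite modM normrN mod_rc (gtr0_norm d0) modV modM.
Qed.

(** An integrable bound, uniform in d, for the points c close to z; [mker_err_far] gives
    smallness at a distance s from z. *)
Lemma mker_err_near d c z : 0 < d -> D z -> D c -> z != c ->
  `|mker d c z - (z - c)^-1 : K| <= `|z - c : K|^-1.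
Proof.
move=> d0 Dz Dc zc; rewrite mker_err// invfM mulrCA -[leRHS]mulr1.
rewrite ler_wpM2l ?invr_ge0// ler_pdivrMr ?mul1r ?mker_denom_ge//.
by rewrite normr_gt0 mker_denom_neq0.
Qed.

Lemma mker_err_far d c z s : 0 < d -> D z -> D c -> 0 < s -> s <= `|z - c : K| ->
  `|mker d c z - (z - c)^-1 : K| <= d / (kap * s ^+ 3).
Proof.
move=> d0 Dz Dc s0 sz.
have zc : z != c by rewrite -subr_eq0 -normr_gt0 (lt_le_trans s0).
rewrite mker_err// ler_wpM2l ?(ltW d0)// lef_pV2 ?posrE ?mulr_gt0 ?exprn_gt0//; last first.
- by rewrite normr_gt0 mker_denom_neq0.
- by rewrite normr_gt0 subr_eq0.
have -> : kap * s ^+ 3 = s * (kap * s ^+ 2) by ring.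
apply: ler_pM => //; rewrite ?mulr_ge0 ?exprn_ge0 ?(ltW s0) ?(ltW kap0)//.
apply: le_trans (mker_denom d0 Dz Dc); rewrite ler_wpDl ?(ltW d0)//.
by rewrite ler_wpM2l ?(ltW kap0)// lerXn2r ?nnegrE ?(ltW s0).
Qed.

(** Strong monotonicity puts (z - c) (f z - f c) in the right half-plane, where the inverse is
    a principal power. *)
Lemma mker_ualg d c : 0 < d -> D c -> ualg D F (mker d c).
Proof.
move=> d0 Dc.
have aid : ualg D F id by apply: (@ualg_id _ _ _ rho) => x.
have af1 := ualgB af (ualg_cst D F (f c)).
have aH := ualgM (ualgB aid (ualg_cst D F c)) af1.
have h0 x : D x -> 0 <= Re ((x - c) * (f x - f c) : K).
  by move=> Dx; apply: le_trans (fm Dx Dc); rewrite mulr_ge0 ?sqr_ge0// ltW.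
have a1 : 0 <= (1 : R) <= 1 by rewrite ler01 lexx.
apply: ualg_eq (ualgM af1 (ualg_pw a1 d0 aH h0)) => x Dx.
by rewrite pwN1//= ReD Rerc ltr_wpDl// h0.
Qed.

(** The Lipschitz bound is uniform in c, which allows the estimates on sums of kernels to be
    made at selected points z only. *)
Lemma mker_equicont d c z z' : 0 < d -> D z -> D z' -> D c ->
  `|mker d c z - mker d c z' : K| <=
  (L / d + (2 * L * rho) ^+ 2 / d ^+ 2) * `|z - z' : K|.
Proof.
move=> d0 Dz Dz' Dc.
have n0 := mker_denom_neq0 d0 Dz Dc; have n0' := mker_denom_neq0 d0 Dz' Dc.
have -> : mker d c z - mker d c z' =
  (rc d * (f z - f z') + (f z - f c) * (f z' - f c) * (z' - z)) /
  (((z - c) * (f z - f c) + rc d) * ((z' - c) * (f z' - f c) + rc d)).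
  rewrite /mker; move: n0 n0'.
  move: (f z) (f z') (f c) => u v w n0 n0'.
  by field; rewrite n0 n0'.
have dz := mker_denom_ge d0 Dz Dc; have dz' := mker_denom_ge d0 Dz' Dc.
rewrite modM modV ler_pdivrMr ?normr_gt0 ?mulf_neq0//.
have bd x : D x -> `|f x - f c : K| <= 2 * L * rho.
  move=> Dx; apply: le_trans (fL Dx Dc) _.
  rewrite -mulrA mulrCA ler_wpM2l//; apply: le_trans (ler_normB _ _) _.
  by rewrite mulrDl !mul1r; apply: lerD.
apply: le_trans (ler_normD _ _) _; rewrite !modM mod_rc (gtr0_norm d0) [`|z' - z : K|]distrC.
have h1 : d * `|f z - f z' : K| <= d * (L * `|z - z' : K|) by rewrite ler_wpM2l ?(ltW d0)// fL.
have h2 : `|f z - f c : K| * `|f z' - f c : K| <= (2 * L * rho) ^+ 2.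
  by rewrite expr2 ler_pM// bd.
have h3 := ler_wpM2r (normr_ge0 (z - z' : K)) h2.
apply: le_trans (lerD h1 h3) _.
have h4 : d * d <= `|(z - c) * (f z - f c) + rc d : K| * `|(z' - c) * (f z' - f c) + rc d : K|.
  by apply: ler_pM => //; exact: ltW.
apply: le_trans (ler_wpM2l _ h4).
  apply: le_of_eq; field; rewrite gt_eqF//.
by rewrite mulr_ge0// addr_ge0// divr_ge0 ?sqr_ge0// ltW.
Qed.

End MonotoneKernel.

(** * A discretized Cauchy transform of the disc *)

Section CauchyTransformOfDisc.
Variable R : realType.
Local Notation K := (Cplx R).
Variables (rho L kap : R) (F f : K -> K).
Local Notation D := (closed_disc rho).
Hypothesis rho0 : 0 < rho.
Hypothesis kap0 : 0 < kap.
Hypothesis L0 : 0 <= L.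
Hypothesis af : ualg D F f.
Hypothesis fL : forall z c, D z -> D c -> `|f z - f c : K| <= L * `|z - c : K|.
Hypothesis fm : forall z c, D z -> D c ->
  kap * `|z - c : K| ^+ 2 <= Re ((z - c) * (f z - f c) : K).

Fact gstep_key : unit. Proof. by []. Qed.
(** The disc is cut into m annuli of equal area, each replaced by the circle whose squared
    radius [grad2] is the middle one, and each circle by the orbit of a point under rotations. *)
Definition gstep (m : nat) : R := locked_with gstep_key (rho ^+ 2 / m%:R).
Definition grad2 (m i : nat) : R := gstep m * (i%:R + 2^-1).
Definition gpoint (m : nat) (w : K) (i j : nat) : K := rc (Num.sqrt (grad2 m i)) * w ^+ j.

(** A Riemann sum for the normalized area integral over the disc of the regularized
    Cauchy kernel; the factors gstep m * n^-1 have total weight rho^2. *)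
Definition gsum (m n : nat) (w : K) (d : R) (z : K) : K :=
  \sum_(i < m) rc (gstep m) * (n%:R^-1 * \sum_(j < n) mker f d (gpoint m w i j) z).

Section Fixed.
Variables (m n : nat) (w : K).
Hypothesis m0 : (0 < m)%N.
Hypothesis n0 : (0 < n)%N.
Hypothesis wP : n.-primitive_root w.

Lemma gstep_gt0 : 0 < gstep m.
Proof. by rewrite /gstep locked_withE divr_gt0 ?exprn_gt0// ltr0n. Qed.

Lemma gstepM : gstep m * m%:R = rho ^+ 2.
Proof. by rewrite /gstep locked_withE divfK// pnatr_eq0 -lt0n. Qed.

Lemma grad2_gt0 i : 0 < grad2 m i.
Proof. by rewrite mulr_gt0 ?gstep_gt0// ltr_wpDl// invr_gt0. Qed.

Lemma grad2_le i : (i < m)%N -> grad2 m i <= rho ^+ 2.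
Proof.
move=> im; rewrite -gstepM ler_wpM2l ?(ltW gstep_gt0)//.
have : i.+1%:R <= m%:R :> R by rewrite ler_nat.
rewrite -(@natr1 R i); lra.
Qed.

Lemma mod_gpoint i j : `|gpoint m w i j| = Num.sqrt (grad2 m i).
Proof.
by rewrite modM modX (mod_prim_root n0 wP) expr1n mulr1 mod_rc ger0_norm ?sqrtr_ge0.
Qed.

Lemma gpoint_in i j : (i < m)%N -> D (gpoint m w i j).
Proof.
move=> im; rewrite /closed_disc /= mod_gpoint -[leRHS](ger0_norm (ltW rho0)) -sqrtr_sqr.
by rewrite ler_wsqrtr// grad2_le.
Qed.

Lemma gsum_ualg d : 0 < d -> ualg D F (gsum m n w d).
Proof.
move=> d0; rewrite /gsum; apply: ualg_sum => i _.
apply: ualgM; first exact: ualg_cst.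
apply: ualgM; first exact: ualg_cst.
apply: ualg_sum => j _; apply: (mker_ualg kap0 af fm d0).
exact: gpoint_in.
Qed.

Lemma gweight_le (g : nat -> nat -> K) (B : R) :
  (forall i j, (i < m)%N -> `|g i j| <= B) ->
  `|\sum_(i < m) rc (gstep m) * (n%:R^-1 * \sum_(j < n) g i j) : K| <= rho ^+ 2 * B.
Proof.
move=> gB; apply: le_trans (ler_norm_sum _ _ _) _.
apply: le_trans (_ : \sum_(i < m) gstep m * B <= _); last first.
  by rewrite sumr_const card_ord -mulr_natl mulrA [_%:R * _]mulrC gstepM.
apply: ler_sum => i _; rewrite modM mod_rc (gtr0_norm gstep_gt0) ler_wpM2l ?(ltW gstep_gt0)//.
have nn : 0 < n%:R :> R by rewrite ltr0n.
rewrite modM modV -rcn mod_rc (gtr0_norm nn) ler_pdivrMl//.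
apply: le_trans (ler_norm_sum _ _ _) _.
apply: le_trans (_ : \sum_(j < n) B <= _).
  by apply: ler_sum => j _; exact: gB.
by rewrite sumr_const card_ord mulr_natl.
Qed.

Lemma gsum_equicont d z z' : 0 < d -> D z -> D z' ->
  `|gsum m n w d z - gsum m n w d z' : K| <=
  rho ^+ 2 * ((L / d + (2 * L * rho) ^+ 2 / d ^+ 2) * `|z - z' : K|).
Proof.
move=> d0 Dz Dz'; rewrite /gsum -sumrB.
under eq_bigr do rewrite -mulrBr -mulrBr -sumrB.
apply: (gweight_le (g := fun i j => mker f d (gpoint m w i j) z - mker f d (gpoint m w i j) z')) => i j im.
by apply: (mker_equicont kap0 L0 fL fm) => //; exact: gpoint_in.
Qed.

End Fixed.

(** A point with |z|^2 = l * gstep m lies on the outer boundary of the l-th annulus; the i-th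
    circle is then the gdist l i -th closest one on its side, counting from 0. *)
Definition gdist (l i : nat) : nat := if (i < l)%N then (l.-1 - i)%N else (i - l)%N.

Lemma gdistE m l i :
  `|gstep m * l%:R - grad2 m i| = gstep m * ((gdist l i)%:R + 2^-1).
Proof.
have g0 : 0 <= gstep m by rewrite /gstep locked_withE divr_ge0 ?sqr_ge0.
rewrite /grad2 /gdist -mulrBr normrM (ger0_norm g0); congr (_ * _).
case: ltnP => il.
  have h : l%:R = (l.-1 - i)%:R + i%:R + 1 :> R.
    by rewrite -natrD natr1; congr _%:R; lia.
  by rewrite h ger0_norm; [lra|have := ler0n R (l.-1 - i); lra].
have h : i%:R = (i - l)%:R + l%:R :> R by rewrite -natrD; congr _%:R; lia.
by rewrite h ler0_norm; [lra|have := ler0n R (i - l); lra].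
Qed.

(** There are two circles at each distance, one inside and one outside. *)
Lemma sum_near_le (m l q : nat) : (l <= m)%N ->
  \sum_(i < m) (if (gdist l i < q)%N then (Num.sqrt ((gdist l i)%:R + 2^-1))^-1 else 0) <=
  4 * Num.sqrt (q%:R : R).
Proof.
move=> lm; pose h d : R := if (d < q)%N then (Num.sqrt (d%:R + 2^-1))^-1 else 0.
rewrite -(big_mkord xpredT (fun i => h (gdist l i))) (big_cat_nat (leq0n l) lm) /=.
have -> : \sum_(0 <= i < l) h (gdist l i) = \sum_(i < l) h i.
  rewrite big_nat_rev big_mkord; apply: eq_bigr => i _; congr h.
  by have il := ltn_ord i; rewrite /gdist add0n; case: ltnP => ?; lia.
have -> : \sum_(l <= i < m) h (gdist l i) = \sum_(i < m - l) h i.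
  rewrite -{1}[l]add0n big_addn big_mkord; apply: eq_bigr => i _; congr h.
  by rewrite /gdist; case: ltnP => ?; lia.
have h1 := @sum_invsqrt_le R l q; have h2 := @sum_invsqrt_le R (m - l) q.
apply: le_trans (lerD h1 h2) _; lra.
Qed.

Section GoodPoint.
Variables (m N l q : nat) (w : K) (eta d : R) (z : K).
(* an even number of points, since the data are the squares of moduli *)
Let n := (2 * N)%N.
Hypothesis m0 : (0 < m)%N.
Hypothesis N0 : (0 < N)%N.
Hypothesis wP : n.-primitive_root w.
Hypothesis eta0 : 0 <= eta.
Hypothesis eta3 : eta <= 3^-1.
(* of |z|^2 and the squared radius of a circle, the smaller is at most 1 - 1/(2m) times the
   larger; raising them to the power N makes this ratio smaller than eta *)
Hypothesis hN : (1 - (2 * m%:R)^-1) ^+ N <= eta.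
Hypothesis l0 : (0 < l)%N.
Hypothesis lm : (l <= m)%N.
Hypothesis d0 : 0 < d.
Hypothesis q0 : (0 < q)%N.
Hypothesis zl : `|z| ^+ 2 = gstep m * l%:R.

Let n0 : (0 < n)%N. Proof. by rewrite /n; lia. Qed.
Let a0 := gstep_gt0 m0.

Let z2 : 0 < `|z| ^+ 2. Proof. by rewrite zl mulr_gt0// ltr0n. Qed.
Let z0 : z != 0.
Proof. by apply/eqP => e; move: z2; rewrite e normr0 expr0n /= ltxx. Qed.
Let Dz : D z.
Proof.
rewrite /closed_disc /= -(ler_pXn2r (_ : 0 < 2)%N) ?nnegrE ?(ltW rho0)//.
by rewrite zl -(gstepM m0) ler_wpM2l ?(ltW a0)// ler_nat.
Qed.

Let ratio (u v : R) : 0 <= u -> u + 2^-1 <= v -> v <= m%:R -> u ^+ N <= eta * v ^+ N.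
Proof.
move=> u0 uv vm; have v0 : 0 < v by lra.
have mm : 0 < m%:R :> R by rewrite ltr0n.
have m1 : 1 <= m%:R :> R by rewrite ler1n.
apply: le_trans (_ : ((1 - (2 * m%:R)^-1) * v) ^+ N <= _); last first.
  by rewrite exprMn ler_wpM2r// exprn_ge0// ltW.
have vv : (2 * m%:R)^-1 * v <= 2^-1.
  by rewrite mulrC ler_pdivrMr ?mulr_gt0//; lra.
have i1 : (2 * m%:R)^-1 <= 1 :> R by rewrite -[leRHS]invr1 lef_pV2 ?posrE ?mulr_gt0//; lra.
rewrite lerXn2r ?nnegrE ?mulr_ge0 ?subr_ge0 ?(ltW v0)//; lra.
Qed.

Let X i := grad2 m i ^+ N.
Let Y := (gstep m * l%:R) ^+ N.

Let ratio_in i : (i < l)%N -> X i <= eta * Y.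
Proof.
move=> il; rewrite /X /Y /grad2 !(exprMn N (gstep m)) mulrCA ler_wpM2l ?exprn_ge0 ?(ltW a0)//.
apply: ratio; [by rewrite addr_ge0// invr_ge0| |by rewrite ler_nat].
have : i.+1%:R <= l%:R :> R by rewrite ler_nat.
rewrite -(@natr1 R i); lra.
Qed.

Let ratio_out i : (i < m)%N -> (l <= i)%N -> Y <= eta * X i.
Proof.
move=> im li; rewrite /X /Y /grad2 !(exprMn N (gstep m)) mulrCA ler_wpM2l ?exprn_ge0 ?(ltW a0)//.
apply: ratio; first by [].
  by rewrite lerD2r ler_nat.
have : i.+1%:R <= m%:R :> R by rewrite ler_nat.
rewrite -(@natr1 R i); lra.
Qed.

Let c i : K := rc (Num.sqrt (grad2 m i)).
Let cn i : `|c i ^+ n : K| = X i.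
Proof.
rewrite modX mod_rc ger0_norm ?sqrtr_ge0// exprM sqr_sqrtr// ltW// grad2_gt0//.
Qed.
Let zn : `|z ^+ n : K| = Y.
Proof. by rewrite modX exprM zl. Qed.

Let c2 i : `|c i| ^+ 2 = grad2 m i.
Proof. by rewrite mod_rc ger0_norm ?sqrtr_ge0// sqr_sqrtr// ltW// grad2_gt0. Qed.

Let ratio_or i : (i < m)%N -> X i <= eta * Y \/ Y <= eta * X i.
Proof. by move=> im; case: (ltnP i l) => h; [left; exact: ratio_in|right; exact: ratio_out]. Qed.

Let ca i : K := n%:R^-1 * \sum_(j < n) (z - gpoint m w i j)^-1.

(** The l circles inside |z| each contribute 1 / z, the others nothing, and
    l * gstep m / z = |z|^2 / z is the conjugate of z. *)
Lemma cauchy_grid : `|\sum_(i < m) rc (gstep m) * ca i - (conjc z : K) : K| <=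
  rho ^+ 2 * (2 * eta / `|z|).
Proof.
(* the value of the integral average over the i-th circle *)
pose b (i : nat) : K := if (i < l)%N then z^-1 else 0.
have -> : (conjc z : K) = \sum_(i < m) rc (gstep m) * b i.
  rewrite -mulr_sumr -(big_mkord xpredT b) (big_cat_nat (leq0n l) lm) /=.
  have -> : \sum_(l <= i < m) b i = 0.
    by rewrite big_nat_cond big1// => i /andP[/andP[li _] _]; rewrite /b ltnNge li.
  rewrite addr0 big_mkord (eq_bigr (fun=> z^-1)) => [|i _]; last by rewrite /b ltn_ord.
  rewrite sumr_const card_ord -(mulr_natl z^-1) mulrA -rcn -rcM -zl -mulzJ mulrAC mulfV//.
  by rewrite mul1r.
rewrite -sumrB; under eq_bigr do rewrite -mulrBr.
apply: le_trans (ler_norm_sum _ _ _) _.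
apply: le_trans (_ : \sum_(i < m) gstep m * (2 * eta / `|z|) <= _); last first.
  by rewrite sumr_const card_ord -(mulr_natl (gstep m * _)) mulrA [_%:R * _]mulrC gstepM.
apply: ler_sum => i _; rewrite modM mod_rc (gtr0_norm a0) ler_wpM2l ?(ltW a0)//.
rewrite /b /ca; case: ltnP => il.
  exact: (avg_inside n0 wP eta0 eta3 z0 (cn i) zn (ratio_in il)).
rewrite subr0.
exact: (avg_outside n0 wP eta0 eta3 z0 (cn i) zn (ratio_out (ltn_ord i) il)).
Qed.

Let zne i j : (i < m)%N -> z != gpoint m w i j.
Proof.
move=> im; apply/eqP => e.
have := sub_pow_neq0 eta3 z0 (cn i) zn (ratio_or im).
rewrite e /gpoint exprMn exprAC (prim_expr_order wP) expr1n mulr1.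
by rewrite subrr eqxx.
Qed.

(** The q nearest circles on either side are estimated by the average of 1 / |z - c|.  For the
    others, | |z|^2 - |c|^2 | <= 2 rho |z - c| keeps z at a distance from the circle. *)
Lemma circle_err i : (i < m)%N ->
  n%:R^-1 * \sum_(j < n) `|mker f d (gpoint m w i j) z - (z - gpoint m w i j)^-1 : K| <=
  d / (kap * (gstep m * q%:R / (2 * rho)) ^+ 3) +
  (if (gdist l i < q)%N then Num.sqrt (2 / gstep m) * (Num.sqrt ((gdist l i)%:R + 2^-1))^-1 else 0).
Proof.
move=> im; have nn : 0 < n%:R :> R by rewrite ltr0n.
have s0 : 0 < gstep m * q%:R / (2 * rho) by rewrite divr_gt0 ?mulr_gt0// ?ltr0n.
have f0 : 0 <= d / (kap * (gstep m * q%:R / (2 * rho)) ^+ 3).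
  by rewrite ltW// divr_gt0// mulr_gt0// exprn_gt0.
case: ltnP => hq.
  apply: le_trans (_ : n%:R^-1 * \sum_(j < n) `|z - gpoint m w i j : K|^-1 <= _).
    rewrite ler_wpM2l ?invr_ge0 ?(ltW nn)//; apply: ler_sum => j _.
    by apply: (mker_err_near kap0 fm d0 Dz _ (zne j im)); exact: (gpoint_in m0 n0 wP).
  have ne : `|z| ^+ 2 != `|c i| ^+ 2.
    rewrite zl c2 -subr_eq0 -normr_gt0 gdistE mulr_gt0// ltr_wpDl// invr_gt0//.
  apply: le_trans (avg_inv_le n0 wP eta3 z0 (cn i) zn (ratio_or im) ne) _.
  rewrite zl c2 gdistE ler_wpDl//.
  rewrite -sqrtrV ?addr_ge0 ?invr_ge0// -sqrtrM ?divr_ge0 ?(ltW a0)//.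
  by rewrite invfM mulrA.
rewrite addr0.
have far j : gstep m * q%:R / (2 * rho) <= `|z - gpoint m w i j : K|.
  rewrite ler_pdivrMr ?mulr_gt0//.
  have := gdistE m l i; rewrite -zl -c2 => e.
  apply: le_trans (_ : gstep m * ((gdist l i)%:R + 2^-1) <= _).
    rewrite ler_wpM2l ?(ltW a0)// -[leLHS]addr0 lerD ?ler_nat// invr_ge0//.
  rewrite -e subr_sqr normrM ler_pM//; last first.
    rewrite ger0_norm ?addr_ge0//.
    have -> : 2 * rho = rho + rho by ring.
    apply: lerD => //.
    have := gpoint_in m0 n0 wP j im; rewrite /closed_disc /= (mod_gpoint _ n0 wP).
    by rewrite mod_rc ger0_norm ?sqrtr_ge0.
  have -> : `|c i| = `|gpoint m w i j|.
    by rewrite (mod_gpoint _ n0 wP) mod_rc ger0_norm ?sqrtr_ge0.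
  exact: ler_dist_dist.
apply: le_trans (_ : n%:R^-1 * \sum_(j < n) (d / (kap * (gstep m * q%:R / (2 * rho)) ^+ 3)) <= _).
  rewrite ler_wpM2l ?invr_ge0 ?(ltW nn)//; apply: ler_sum => j _.
  by apply: (mker_err_far kap0 fm d0 Dz) => //; exact: (gpoint_in m0 n0 wP).
by rewrite sumr_const card_ord -(mulr_natl (d / _)) mulKf// gt_eqF.
Qed.

(** The three terms are the discretization error, the regularization error away from z, and
    the contribution of the annulus near z, which is small with its area gstep m * q. *)
Lemma gsum_good : `|gsum m n w d z - (conjc z : K) : K| <=
  rho ^+ 2 * (2 * eta / `|z|) +
  (rho ^+ 2 * (d / (kap * (gstep m * q%:R / (2 * rho)) ^+ 3)) +
   4 * Num.sqrt (2 * (gstep m * q%:R))).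
Proof.
rewrite -(subrK (\sum_(i < m) rc (gstep m) * ca i) (gsum m n w d z)) -addrA.
apply: le_trans (ler_normD _ _) _; rewrite [leRHS]addrC.
apply: lerD; last exact: cauchy_grid.
rewrite /gsum /ca -sumrB; under eq_bigr do rewrite -mulrBr -mulrBr -sumrB.
apply: le_trans (ler_norm_sum _ _ _) _.
set A := d / _.
pose g i : R := if (gdist l i < q)%N then (Num.sqrt ((gdist l i)%:R + 2^-1))^-1 else 0.
apply: le_trans (_ : \sum_(i < m) (gstep m * A + gstep m * Num.sqrt (2 / gstep m) * g i) <= _).
  apply: ler_sum => i _.
  rewrite modM mod_rc (gtr0_norm a0) -mulrA -mulrDr ler_wpM2l ?(ltW a0)//.
  have nn : 0 < n%:R :> R by rewrite ltr0n.
  have := circle_err (ltn_ord i); rewrite -/A => h.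
  rewrite modM modV -rcn mod_rc (gtr0_norm nn).
  apply: le_trans (ler_wpM2l _ (ler_norm_sum _ _ _)) _; first by rewrite invr_ge0 ltW.
  apply: le_trans h _; rewrite lerD2l /g; case: ifP => //; by rewrite mulr0.
rewrite big_split /= sumr_const card_ord -(mulr_natl (gstep m * A)) mulrA [_%:R * _]mulrC gstepM//.
rewrite lerD2l -mulr_sumr.
apply: le_trans (ler_wpM2l _ (sum_near_le q lm)) _.
  by rewrite mulr_ge0 ?sqrtr_ge0 ?(ltW a0).
have -> : gstep m * Num.sqrt (2 / gstep m) = Num.sqrt (2 * gstep m).
  rewrite -{1}(sqr_sqrtr (ltW a0)) expr2 -mulrA -(sqrtrM _ (ltW a0)).
  rewrite [gstep m * _]mulrCA divff ?gt_eqF// mulr1 mulrC -sqrtrM//.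
by rewrite mulrCA ler_wpM2l// -sqrtrM ?mulr_ge0 ?(ltW a0)// mulrA.
Qed.

End GoodPoint.
End CauchyTransformOfDisc.

(** * Conjugation is a uniform limit of polynomials *)

Section ConjInAlgebra.
Variable R : realType.
Local Notation K := (Cplx R).
Variables (rho L kap : R) (F f : K -> K).
Local Notation D := (closed_disc rho).
Hypothesis rho0 : 0 < rho.
Hypothesis kap0 : 0 < kap.
Hypothesis L0 : 0 <= L.
Hypothesis af : ualg D F f.
Hypothesis fL : forall z c, D z -> D c -> `|f z - f c : K| <= L * `|z - c : K|.
Hypothesis fm : forall z c, D z -> D c ->
  kap * `|z - c : K| ^+ 2 <= Re ((z - c) * (f z - f c) : K).

Lemma sqrt_dist_le (x y a : R) : 0 <= x -> 0 <= y -> `|x - y| <= a ->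
  `|Num.sqrt x - Num.sqrt y| <= Num.sqrt a.
Proof.
move=> x0 y0 h; rewrite -[leLHS]ger0_norm// -sqrtr_sqr ler_wsqrtr//.
apply: le_trans h; rewrite -{2}(sqr_sqrtr x0) -{2}(sqr_sqrtr y0) subr_sqr normrM.
rewrite real_normK ?num_real// expr2.
rewrite -[X in X <= _]ger0_norm ?sqr_ge0 ?mulr_ge0// -?expr2 ?sqr_ge0//.
rewrite expr2 normrM ler_wpM2l// [leRHS]ger0_norm ?addr_ge0 ?sqrtr_ge0//.
by apply: le_trans (ler_normB _ _) _; rewrite !ger0_norm ?sqrtr_ge0.
Qed.

(** Any point can be moved to the outer boundary of an annulus, away from all the circles and
    from the origin. *)
Lemma good_point m z : (0 < m)%N -> D z -> exists z' l,
  [/\ (0 < l <= m)%N, `|z'| ^+ 2 = gstep rho m * l%:R & `|z - z' : K| <= Num.sqrt (gstep rho m)].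
Proof.
move=> m0 Dz; have a0 := gstep_gt0 rho0 m0; set a := gstep rho m in a0 *.
have zr : `|z| ^+ 2 <= rho ^+ 2 by rewrite lerXn2r ?nnegrE ?(ltW rho0).
pose y := `|z| ^+ 2 / a.
have y0 : 0 <= y by rewrite divr_ge0 ?sqr_ge0 ?(ltW a0).
have ym : y <= m%:R by rewrite ler_pdivrMr// mulrC gstepM.
have ya : `|z| ^+ 2 = a * y by rewrite mulrC divfK// gt_eqF.
have [l [lm dl]] : exists l, (0 < l <= m)%N /\ `|y - l%:R| <= 1.
  have /andP[t1 t2] := truncn_itv y0.
  have tm : (Num.truncn y <= m)%N by rewrite -(ler_nat R) (le_trans t1).
  case: (posnP (Num.truncn y)) => t0.
    exists 1%N; rewrite m0; split => //; rewrite t0 in t2.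
    by rewrite ler0_norm; lra.
  exists (Num.truncn y); rewrite t0 tm; split => //.
  by rewrite ger0_norm ?subr_ge0//; rewrite -natr1 in t2; lra.
pose s := Num.sqrt (a * l%:R).
have al : 0 <= a * l%:R by rewrite mulr_ge0// ltW.
have s2 : s ^+ 2 = a * l%:R by rewrite sqr_sqrtr.
have sz : `|Num.sqrt (`|z| ^+ 2) - s| <= Num.sqrt a.
  apply: sqrt_dist_le => //; rewrite ?sqr_ge0// ya -mulrBr normrM (gtr0_norm a0).
  by rewrite -[leRHS]mulr1 ler_wpM2l// ltW.
rewrite sqrtr_sqr normr_id in sz.
have [z0|z0] := eqVneq z 0.
  exists (rc s), l; split => //; first by rewrite mod_rc ger0_norm ?sqrtr_ge0.
  have n0 : `|z| = 0 by apply/eqP; rewrite normr_eq0 z0.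
  by move: sz; rewrite n0 z0 !add0r !normrN mod_rc.
have zn : `|z| != 0 by rewrite normr_eq0.
exists (rc (s / `|z|) * z), l; split => //.
  rewrite modM mod_rc ger0_norm ?divr_ge0 ?sqrtr_ge0// divfK//.
have -> : z - rc (s / `|z|) * z = rc ((`|z| - s) / `|z|) * z.
  by rewrite mulrBl divff// rcD rcN rc1; ring.
by rewrite modM mod_rc normrM normfV normr_id divfK.
Qed.

(** The parameters are chosen in the following order: the size xi of the annulus treated as
    near, the regularization d that makes the kernel accurate outside of it, the number m of
    circles according to the modulus of continuity that results from d, and the number 2N of
    points on each circle.  Each of the four errors is at most e / 4. *)
Lemma ualg_conj : ualg D F (fun z => (conjc z : K)).
Proof.
apply: ualg_lim => e e0.
(* the near annulus contributes at most 4 sqrt (4 xi) = 8 sqrt xi *)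
pose xi := (e / 32) ^+ 2.
have xi0 : 0 < xi by rewrite exprn_gt0// divr_gt0.
have xi3 : 0 < (xi / (2 * rho)) ^+ 3 by rewrite exprn_gt0// divr_gt0// mulr_gt0.
pose d := e / 4 * (kap * (xi / (2 * rho)) ^+ 3) / rho ^+ 2.
have r2 : 0 < rho ^+ 2 by rewrite exprn_gt0.
have d0 : 0 < d by rewrite divr_gt0// mulr_gt0 ?divr_gt0// mulr_gt0.
(* Lipschitz constant of the Riemann sums; it does not depend on m and N *)
pose Cd := rho ^+ 2 * (L / d + (2 * L * rho) ^+ 2 / d ^+ 2).
have Cd0 : 0 <= Cd by rewrite mulr_ge0 ?(ltW r2)// addr_ge0// divr_ge0 ?sqr_ge0 ?(ltW d0).
pose s1 := e / (4 * (Cd + 1)).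
have s10 : 0 < s1 by rewrite divr_gt0// mulr_gt0// ltr_wpDl.
pose mu := Num.min xi (s1 ^+ 2).
have mu0 : 0 < mu by rewrite lt_min xi0 exprn_gt0.
pose m := (Num.truncn (rho ^+ 2 / mu)).+1.
have m0 : (0 < m)%N by [].
pose a := gstep rho m; have a0 : 0 < a := gstep_gt0 rho0 m0.
have amu : a <= mu.
  have mm : 0 < m%:R :> R by rewrite ltr0n.
  rewrite -(ler_pM2r mm) gstepM// mulrC -ler_pdivrMr//.
  have /andP[_] := truncn_itv (divr_ge0 (ltW r2) (ltW mu0)); exact: ltW.
have axi : a <= xi by apply: le_trans amu _; rewrite ge_min lexx.
have as1 : Num.sqrt a <= s1.
  rewrite -[leRHS]ger0_norm ?(ltW s10)// -sqrtr_sqr ler_wsqrtr//.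
  by apply: le_trans amu _; rewrite ge_min lexx orbT.
pose sa := Num.sqrt a; have sa0 : 0 < sa by rewrite sqrtr_gt0.
pose q := (Num.truncn (xi / a)).+1.
have q0 : (0 < q)%N by [].
have /andP[q1 q2] := truncn_itv (divr_ge0 (ltW xi0) (ltW a0)).
have aq1 : xi <= a * q%:R by rewrite mulrC -ler_pdivrMr// ltW.
have aq2 : a * q%:R <= 2 * xi.
  rewrite /q -natr1 mulrDr mulr1; move: q1; rewrite ler_pdivlMr// mulrC; lra.
pose eta := Num.min 3^-1 (e * sa / (8 * rho ^+ 2)).
have eta0 : 0 < eta by rewrite lt_min invr_gt0 ltr0n /= divr_gt0 ?mulr_gt0.
have eta3 : eta <= 3^-1 by rewrite ge_min lexx.
have etaE : eta * (8 * rho ^+ 2) <= e * sa.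
  by rewrite -ler_pdivlMr ?mulr_gt0// ge_min lexx orbT.
have rat : 0 <= (1 - (2 * m%:R)^-1 : R) < 1.
  have m1 : 1 <= m%:R :> R by rewrite ler1n.
  have i0 : 0 < (2 * m%:R)^-1 :> R by rewrite invr_gt0 mulr_gt0// ltr0n.
  have i1 : (2 * m%:R)^-1 <= 1 :> R by rewrite -[leRHS]invr1 lef_pV2 ?posrE ?mulr_gt0 ?ltr0n//; lra.
  by apply/andP; split; lra.
have [N1 hN1] := exp_small rat eta0.
pose N := N1.+1; have hN := hN1 N (leqnSn _).
have N0 : (0 < N)%N by [].
have [w wP] := @prim_root_exists R (2 * N) isT.
exists (gsum rho f m (2 * N) w d); first exact: (gsum_ualg rho0 kap0 af fm m0 _ wP d0).
move=> z Dz.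
have [z' [l [/andP[l0 lm] zl zz]]] := good_point m0 Dz.
rewrite -/a in zl zz.
have Dz' : D z'.
  rewrite /closed_disc /= -(ler_pXn2r (_ : 0 < 2)%N) ?nnegrE ?(ltW rho0)//.
  by rewrite zl -(gstepM rho m0) ler_wpM2l ?(ltW a0)// ler_nat.
have h1 := gsum_good rho0 kap0 L0 fm m0 N0 wP (ltW eta0) eta3 hN l0 lm d0 q0 zl.
have h2 := gsum_equicont rho0 kap0 L0 fL fm m0 (_ : 0 < 2 * N)%N wP d0 Dz Dz'.
have {}h2 := h2 isT.
(* the discretization error has a factor 1 / |z'|, which eta absorbs thanks to its factor sa *)
have z1 : sa <= `|z'|.
  rewrite -[leRHS]ger0_norm// -sqrtr_sqr ler_wsqrtr// zl -[leLHS]mulr1 ler_wpM2l ?(ltW a0)//.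
  by rewrite ler1n.
have t0 : rho ^+ 2 * (2 * eta / `|z'|) <= e / 4.
  have z'0 : 0 < `|z'| by apply: lt_le_trans z1.
  rewrite !mulrA ler_pdivrMr//.
  apply: le_trans (_ : e * sa / 4 <= _); first by lra.
  by rewrite mulrAC ler_wpM2l// divr_ge0// ltW.
have t1 : rho ^+ 2 * (d / (kap * (a * q%:R / (2 * rho)) ^+ 3)) <= e / 4.
  have rr : 0 < 2 * rho by rewrite mulr_gt0.
  apply: le_trans (_ : rho ^+ 2 * (d / (kap * (xi / (2 * rho)) ^+ 3)) <= _).
    rewrite ler_wpM2l ?(ltW r2)// ler_wpM2l ?(ltW d0)// lef_pV2 ?posrE.
    - rewrite ler_wpM2l ?(ltW kap0)// lerXn2r ?nnegrE ?divr_ge0 ?(ltW xi0) ?(ltW rr) ?mulr_ge0 ?(ltW a0)//.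
      by rewrite ler_wpM2r// invr_ge0 ltW.
    - by rewrite mulr_gt0// exprn_gt0// divr_gt0// mulr_gt0// ltr0n.
    - by rewrite mulr_gt0.
  rewrite /d; apply: le_of_eq; field.
  by rewrite !gt_eqF.
have t2 : 4 * Num.sqrt (2 * (a * q%:R)) <= e / 4.
  have -> : e / 4 = 4 * (e / 16) by field.
  rewrite ler_wpM2l// -[leRHS]ger0_norm ?divr_ge0 ?(ltW e0)// -sqrtr_sqr ler_wsqrtr//.
  apply: le_trans (_ : 2 * (2 * xi) <= _); first by rewrite ler_wpM2l.
  rewrite /xi !expr_div_n; have := sqr_ge0 e; lra.
have t3 : (Cd + 1) * sa <= e / 4.
  apply: le_trans (_ : (Cd + 1) * s1 <= _); first by rewrite ler_wpM2l ?addr_ge0.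
  rewrite /s1; apply: le_of_eq; field.
  by rewrite gt_eqF// ltr_wpDl.
have h3 : Cd * `|z - z' : K| <= Cd * sa by rewrite ler_wpM2l.
have cz : `|(conjc z' : K) - (conjc z : K) : K| <= sa.
  have -> : (conjc z' : K) - (conjc z : K) = (conjc (z' - z : K) : K).
    by apply: cplx_eqP; rewrite ?(Reconj, Imconj, ReD, ImD, ReN, ImN); ring.
  by rewrite mod_conj distrC.
have -> : gsum rho f m (2 * N) w d z - (conjc z : K) =
  (gsum rho f m (2 * N) w d z - gsum rho f m (2 * N) w d z') +
  ((gsum rho f m (2 * N) w d z' - (conjc z' : K)) + ((conjc z' : K) - (conjc z : K))) :> K by ring.
apply: le_trans (ler_normD _ _) _.
apply: le_trans (lerD (lexx _) (ler_normD _ _)) _.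
rewrite mulrA -/Cd in h2.
apply: le_trans (lerD h2 (lerD h1 cz)) _.
rewrite -/a; lra.
Qed.

End ConjInAlgebra.

(** * Compactness of the closed disc *)

Section DiscTopology.
Variable R : realType.
Local Notation K := (Cplx R).

Lemma within_continuousP (D : set K) (f : K -> K) :
  {within D, continuous f} <->
  forall x, D x -> forall e : R, 0 < e ->
    exists2 r : R, 0 < r & forall y, D y -> `|x - y : K| < r -> `|f x - f y : K| < e.
Proof.
split.
  move=> /subspace_continuousP h x Dx e e0.
  have /cvgrPdist_lt /(_ _ e0) := h x Dx.
  rewrite near_withinE => /nbhs_normP[r /= r0 hr].
  by exists r => // y Dy xy; exact: hr.
move=> h; apply/subspace_continuousP => x Dx.
apply/cvgrPdist_lt => e e0; have [r r0 hr] := h x Dx e e0.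
by rewrite near_withinE; apply/nbhs_normP; exists r => //= y xy Dy; exact: hr.
Qed.

Lemma closed_disc_compact (rho : R) : compact (closed_disc rho : set K).
Proof.
pose g (p : R * R) : K := p.1 *: (1 : K) + p.2 *: ('i%C : K).
have gc : continuous g.
  move=> p; apply: cvgD.
    by apply: cvgZr_tmp; exact: cvg_fst.
  by apply: cvgZr_tmp; exact: cvg_snd.
apply: (@subclosed_compact _ _ (g @` (`[- rho, rho] `*` `[- rho, rho]))).
- have -> : closed_disc rho = (fun z : K => `|z|) @^-1` [set x : R | x <= rho] by [].
  apply: closed_comp; last exact: closed_le.
  by move=> z _; exact: norm_continuous.
- apply: continuous_compact; first exact: continuous_subspaceT.
  by apply: compact_setX; exact: segment_compact.
move=> z zr; exists (Re z, Im z).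
  split; rewrite /= in_itv /= -ler_norml; [exact: le_trans (Re_le_mod z) zr|exact: le_trans (Im_le_mod z) zr].
by rewrite /g /= !rcZ mulr1 [RHS]cplxE [rc _ * _]mulrC.
Qed.

Lemma unif_continuous_disc (rho : R) (f : K -> K) : {within closed_disc rho, continuous f} ->
  forall e : R, 0 < e -> exists2 d : R, 0 < d &
    forall z c, closed_disc rho z -> closed_disc rho c -> `|z - c : K| < d -> `|f z - f c : K| <= e.
Proof.
move=> /within_continuousP fc e e0.
have e2 : 0 < e / 2 by rewrite divr_gt0.
have /compact_near_coveringP/near_covering_withinP cov := @closed_disc_compact rho.
pose P (d : R) (z : K) := forall c, closed_disc rho c -> `|z - c : K| < d -> `|f z - f c : K| <= e.
have : \forall d \near (0 : R)^'+, closed_disc rho `<=` P d.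
  apply: cov => x Dx; have [r r0 hr] := fc x Dx _ e2.
  have r2 : 0 < r / 2 by rewrite divr_gt0.
  exists ((ball x (r / 2) : set K), [set d : R | d < r / 2]) => /=.
    by split; [exact: nbhsx_ballx|exact: nbhs_right_lt].
  move=> [z d] /= [xz dr] Dz c Dc zc.
  rewrite -ball_normE /= in xz.
  have h1 := hr z Dz (lt_le_trans xz (_ : r / 2 <= r)).
  have h2 : `|x - c : K| < r.
    rewrite (splitr r) -(subrK z x) -addrA; apply: le_lt_trans (ler_normD _ _) _.
    by apply: ltrD => //; apply: lt_trans zc dr.
  have {}h2 := hr c Dc h2.
  have {}h1 : `|f x - f z : K| < e / 2 by apply: h1; rewrite ler_pdivrMr// ler_peMr ?(ltW r0)// ler1n.
  rewrite (splitr e) -(subrK (f x) (f z)) -addrA; apply: le_trans (ler_normD _ _) _.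
  by rewrite distrC lerD// ltW.
move=> h; have [d [d0 hd]] : exists d : R, 0 < d /\ closed_disc rho `<=` P d.
  near (0 : R)^'+ => d; exists d; split; first by near: d; exact: nbhs_right_gt.
  by near: d.
by exists d => // z c Dz; apply: hd.
Unshelve. all: by end_near.
Qed.

End DiscTopology.

(** * Density of polynomials in z and its conjugate *)

Section Bernstein.
Variable R : realType.
Local Notation K := (Cplx R).

(** The n-th Bernstein operator applied to the sequence phi and evaluated at u, as n tosses
    of a coin of bias u: the recursion conditions on the first toss, which avoids binomial
    coefficients. *)
Fixpoint bern (u : R) (n : nat) (phi : nat -> K) : K :=
  if n is m.+1 then rc u * bern u m (fun i => phi i.+1) + rc (1 - u) * bern u m phi
  else phi 0%N.

Fixpoint rbern (u : R) (n : nat) (phi : nat -> R) : R :=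
  if n is m.+1 then u * rbern u m (fun i => phi i.+1) + (1 - u) * rbern u m phi
  else phi 0%N.

Lemma bernB u n p q : bern u n (fun i => p i - q i) = bern u n p - bern u n q.
Proof. by elim: n p q => [//|n IH] p q /=; rewrite !IH; ring. Qed.

Lemma bern_cst u n c : bern u n (fun=> c) = c.
Proof. by elim: n => [//|n IH] /=; rewrite !IH rcD rcN rc1; ring. Qed.

Lemma bern_le u n p q : 0 <= u <= 1 -> (forall i, `|p i| <= q i) ->
  `|bern u n p| <= rbern u n q.
Proof.
move=> /andP[u0 u1]; elim: n p q => [|n IH] p q pq /=; first exact: pq.
have u1' : 0 <= 1 - u by rewrite subr_ge0.
apply: le_trans (ler_normD _ _) _; rewrite !modM !mod_rc (ger0_norm u0) (ger0_norm u1').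
by apply: lerD; rewrite ler_wpM2l// IH.
Qed.

(** The second moment of the binomial law. *)
Lemma rbern_sqr u n a b c : rbern u n (fun i => a + b * (i%:R + c) ^+ 2) =
  a + b * ((n%:R * u + c) ^+ 2 + n%:R * (u * (1 - u))).
Proof.
elim: n c => [|n IH] c /=; first by rewrite !mul0r !add0r addr0.
have -> : (fun i : nat => a + b * (i.+1%:R + c) ^+ 2) = (fun i : nat => a + b * (i%:R + (1 + c)) ^+ 2).
  by apply/funext => i; rewrite -natr1 addrA.
rewrite !IH -(@natr1 R n); ring.
Qed.

Lemma bern_ualg (D : set K) (F : K -> K) (u : K -> R) n (phi : nat -> K -> K) :
  ualg D F (fun z => rc (u z)) -> (forall i, ualg D F (phi i)) ->
  ualg D F (fun z => bern (u z) n (fun i => phi i z)).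
Proof.
move=> au; elim: n phi => [|n IH] phi ap /=; first exact: ap.
apply: ualgD; apply: ualgM => //; try exact: IH.
apply: ualg_eq (ualgB (ualg_cst _ _ 1) au) => z _.
by rewrite rcD rcN rc1.
Qed.

Variables (rho : R) (F : K -> K).
Local Notation D := (closed_disc rho).
Hypothesis rho0 : 0 < rho.
Hypothesis aconj : ualg D F (fun z => (conjc z : K)).

Lemma ualg_Re : ualg D F (fun z => rc (Re z)).
Proof.
have aid : ualg D F id by apply: (@ualg_id _ _ _ rho) => x.
apply: ualg_eq (ualgM (ualg_cst _ _ (rc 2^-1)) (ualgD aid aconj)) => z _.
by apply: cplx_eqP; rewrite !(ReM, ImM) !(ReD, ImD) Reconj Imconj !Rerc !Imrc; field.
Qed.

Lemma ualg_Im : ualg D F (fun z => rc (Im z)).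
Proof.
have aid : ualg D F id by apply: (@ualg_id _ _ _ rho) => x.
apply: ualg_eq (ualgM (ualg_cst _ _ (- ('i%C : K) * rc 2^-1)) (ualgB aid aconj)) => z _.
by apply: cplx_eqP; rewrite !(ReM, ImM, ReN, ImN) !(ReD, ImD) !(ReN, ImN) Reconj Imconj !(Re_i, Im_i) !Rerc !Imrc; field.
Qed.

Definition unitize (x : R) : R := x / (2 * rho) + 2^-1.
Definition gridc (n i j : nat) : K :=
  rc (2 * rho * (i%:R / n%:R - 2^-1)) + 'i%C * rc (2 * rho * (j%:R / n%:R - 2^-1)).

Lemma ualg_unitize (g : K -> R) : ualg D F (fun z => rc (g z)) -> ualg D F (fun z => rc (unitize (g z))).
Proof.
move=> ag; apply: ualg_eq (ualgD (ualgM (ualg_cst _ _ (rc (2 * rho)^-1)) ag) (ualg_cst _ _ (rc 2^-1))) => z _.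
by rewrite -rcM -rcD /unitize [_ * g z]mulrC.
Qed.

Lemma unitize01 x : `|x| <= rho -> 0 <= unitize x <= 1.
Proof.
rewrite ler_norml => /andP[h1 h2]; rewrite /unitize.
have r2 : 0 < 2 * rho by rewrite mulr_gt0.
have a1 : - 2^-1 <= x / (2 * rho) by rewrite ler_pdivlMr//; lra.
have a2 : x / (2 * rho) <= 2^-1 by rewrite ler_pdivrMr//; lra.
by apply/andP; split; lra.
Qed.

Lemma gridc_dist n i j z : (0 < n)%N ->
  `|gridc n i j - z : K| ^+ 2 = (2 * rho / n%:R) ^+ 2 *
    ((i%:R + - (n%:R * unitize (Re z))) ^+ 2 + (j%:R + - (n%:R * unitize (Im z))) ^+ 2).
Proof.
move=> n0; have nn : n%:R != 0 :> R by rewrite pnatr_eq0 -lt0n.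
rewrite sqr_modulus /gridc !(ReD, ImD, ReN, ImN) !(ReM, ImM) Re_i Im_i !Rerc !Imrc /unitize.
by field; rewrite nn gt_eqF.
Qed.

(** Bernstein's argument in the two coordinates: the sum of the variances is of order
    1 / N.  The function is evaluated at grid points of the square, which are not all in
    the disc. *)
Lemma ualg_of_modulus (h : K -> K) :
  (forall e : R, 0 < e -> exists2 C : R, 0 <= C & forall z c, D z -> `|h c - h z : K| <= e + C * `|c - z : K| ^+ 2) ->
  ualg D F h.
Proof.
move=> hm; apply: ualg_lim => e e0.
have [C C0 hC] := hm _ (divr_gt0 e0 (ltr0n R 2)).
(* each variance is at most N / 4, so that both contribute at most
     C (2 rho / N)^2 N / 4 <= e / 4 *)
pose N := (Num.truncn (4 * C * rho ^+ 2 / e)).+1.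
have N0 : (0 < N)%N by [].
have NN : 0 < N%:R :> R by rewrite ltr0n.
pose u z := unitize (Re z); pose v z := unitize (Im z).
exists (fun z => bern (u z) N (fun i => bern (v z) N (fun j => h (gridc N i j)))).
  apply: (@bern_ualg D F u N (fun i z => bern (v z) N (fun j => h (gridc N i j)))).
    exact: ualg_unitize ualg_Re.
  move=> i; apply: (@bern_ualg D F v N (fun j z => h (gridc N i j))).
    exact: ualg_unitize ualg_Im.
  by move=> j; exact: ualg_cst.
move=> z Dz.
have u01 : 0 <= u z <= 1 by apply: unitize01; apply: le_trans (Re_le_mod z) Dz.
have v01 : 0 <= v z <= 1 by apply: unitize01; apply: le_trans (Im_le_mod z) Dz.
pose B := C * (2 * rho / N%:R) ^+ 2.
have row i : `|bern (v z) N (fun j => h (gridc N i j)) - h z : K| <=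
   (e / 2 + B * (N%:R * (v z * (1 - v z)))) + B * (i%:R + - (N%:R * u z)) ^+ 2.
  rewrite -[X in _ - X](bern_cst (v z) N) -bernB.
  apply: le_trans (_ : rbern (v z) N (fun j => (e / 2 + B * (i%:R + - (N%:R * u z)) ^+ 2) + B * (j%:R + - (N%:R * v z)) ^+ 2) <= _).
    apply: bern_le => // j; apply: le_trans (hC z _ Dz) _.
    by rewrite gridc_dist// -/(u z) -/(v z) /B; apply: le_of_eq; ring.
  rewrite rbern_sqr subrr expr0n /= add0r; lra.
have -> : bern (u z) N (fun i => bern (v z) N (fun j => h (gridc N i j))) - h z =
    bern (u z) N (fun i => bern (v z) N (fun j => h (gridc N i j)) - h z).
  by rewrite bernB bern_cst.
apply: le_trans (bern_le N u01 row) _; rewrite rbern_sqr subrr expr0n /= add0r.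
have hN : 4 * C * rho ^+ 2 / e <= N%:R.
  have p0 : 0 <= 4 * C * rho ^+ 2 / e by rewrite divr_ge0 ?(ltW e0)// mulr_ge0 ?sqr_ge0// mulr_ge0.
  by have /andP[_] := truncn_itv p0; exact: ltW.
have uu : u z * (1 - u z) <= 4^-1 by have := sqr_ge0 (u z - 2^-1); nra.
have vv : v z * (1 - v z) <= 4^-1 by have := sqr_ge0 (v z - 2^-1); nra.
have BN : B * N%:R <= e.
  have -> : B * N%:R = 4 * C * rho ^+ 2 / N%:R by rewrite /B; field; rewrite gt_eqF.
  by rewrite ler_pdivrMr// [e * _]mulrC -ler_pdivrMr.
have BN0 : 0 <= B * N%:R by rewrite mulr_ge0// /B mulr_ge0// sqr_ge0.
have h1 : B * N%:R * (u z * (1 - u z)) <= e * 4^-1.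
  by apply: ler_pM => //; case/andP: u01 => ? ?; rewrite mulr_ge0// subr_ge0.
have h2 : B * N%:R * (v z * (1 - v z)) <= e * 4^-1.
  by apply: ler_pM => //; case/andP: v01 => ? ?; rewrite mulr_ge0// subr_ge0.
rewrite !mulrA in h1 h2 *; lra.
Qed.

(** The radial retraction onto the disc, used to extend continuous functions to the
    square. *)
Definition clamp (c : K) : K := if `|c| <= rho then c else rc (rho / `|c|) * c.

Lemma clamp_in c : D (clamp c).
Proof.
rewrite /clamp /closed_disc /=; case: ifPn => //; rewrite -ltNge => rc'.
have c0 : 0 < `|c| by apply: lt_trans rc'.
by rewrite modM mod_rc ger0_norm ?divr_ge0 ?(ltW rho0)// divfK ?gt_eqF.
Qed.

Lemma clamp_id c : D c -> clamp c = c.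
Proof. by rewrite /clamp /closed_disc /= => ->. Qed.

Lemma clamp_dist c z : D z -> `|clamp c - z : K| <= 2 * `|c - z : K|.
Proof.
move=> Dz; have [cr|cr] := leP `|c| rho.
  by rewrite clamp_id// ler_peMl// ler1n.
have c0 : 0 < `|c| by apply: lt_trans cr.
have -> : clamp c - z = (clamp c - c) + (c - z) :> K by ring.
apply: le_trans (ler_normD _ _) _; rewrite (mulr_natl _ 2) mulr2n lerD2r.
have -> : clamp c = rc (rho / `|c|) * c by rewrite /clamp leNgt cr.
have -> : rc (rho / `|c|) * c - c = rc (- ((`|c| - rho) / `|c|)) * c.
  by rewrite rcN mulrBl divff ?gt_eqF// rcD rcN rc1; ring.
rewrite modM mod_rc normrN ger0_norm ?divr_ge0 ?subr_ge0 ?(ltW cr)// divfK ?gt_eqF//.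
have := lerB_dist c z; have : `|z| <= rho by []; lra.
Qed.

(** Uniform continuity gives the modulus required by [ualg_of_modulus]: the quadratic term
    takes over when the points are not close, since f is bounded. *)
Lemma ualg_continuous (f : K -> K) : {within D, continuous f} -> ualg D F f.
Proof.
move=> fc.
apply: (@ualg_eq _ _ _ (f \o clamp)); first by move=> x Dx /=; rewrite clamp_id.
have [B fB] : exists B : R, forall x, D x -> `|f x| <= B.
  have := compact_bounded (continuous_compact fc (@closed_disc_compact R rho)).
  move=> [M [_ hM]]; exists (M + 1) => x Dx.
  by apply: (hM (M + 1)); [rewrite ltrDl|exists x].
apply: ualg_of_modulus => e e0.
have [d d0 hd] := unif_continuous_disc fc e0.
have B0 : 0 <= B by apply: le_trans (fB 0 _); rewrite // /closed_disc /= normr0 ltW.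
exists (2 * B / (d / 2) ^+ 2); first by rewrite divr_ge0 ?sqr_ge0// mulr_ge0.
move=> z c Dz /=; rewrite (clamp_id Dz).
have Dc := clamp_in c.
have [near|far] := ltP `|clamp c - z : K| d.
  apply: le_trans (hd _ _ Dc Dz near) _; rewrite lerDl !mulr_ge0// ?invr_ge0 ?sqr_ge0//.
apply: le_trans (ler_normB _ _) _.
apply: le_trans (lerD (fB _ Dc) (fB _ Dz)) _.
rewrite ler_wpDl ?(ltW e0)//.
have dd : d / 2 <= `|c - z : K| by have := clamp_dist c Dz; lra.
have -> : B + B = 2 * B / (d / 2) ^+ 2 * (d / 2) ^+ 2.
  by rewrite divfK ?gt_eqF ?exprn_gt0 ?divr_gt0//; ring.
rewrite ler_wpM2l ?divr_ge0 ?sqr_ge0// ?mulr_ge0// lerXn2r ?nnegrE ?divr_ge0 ?(ltW d0)//.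
Qed.

End Bernstein.

(** * Polynomial convexity of the graph *)

Section GraphHull.
Variable R : realType.
Local Notation K := (Cplx R).
Variables (rho : R) (F : K -> K).
Local Notation D := (closed_disc rho).
Hypothesis rho0 : 0 < rho.
Hypothesis Fc : {within D, continuous F}.
Hypothesis dense : forall f : K -> K, {within D, continuous f} -> ualg D F f.

Lemma uniform_algebra2_full : continuous_on D = uniform_algebra2 D id F.
Proof.
apply/seteqP; split => f /=; last by case.
move=> fc; split => // d d0; have [_ h] := dense fc.
have [P hP] := h _ (divr_gt0 d0 (ltr0n R 2)).
by exists P => x Dx; apply: le_lt_trans (hP x Dx) _; rewrite ltr_pdivrMr// ltr_pMr// ltr1n.
Qed.

Lemma within_continuous_conj (f : K -> K) : {within D, continuous f} ->
  {within D, continuous (fun z => (conjc (f z) : K))}.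
Proof.
move=> /within_continuousP fc; apply/within_continuousP => x Dx e e0.
have [r r0 hr] := fc x Dx e e0; exists r => // y Dy xy.
have -> : (conjc (f x) : K) - (conjc (f y) : K) = (conjc (f x - f y : K) : K).
  by apply: cplx_eqP; rewrite ?(Reconj, Imconj, ReD, ImD, ReN, ImN); ring.
by rewrite mod_conj; exact: hr.
Qed.

Lemma graph_compact : compact [set p : Cplx2 R | D p.1 /\ p.2 = F p.1].
Proof.
have E : ([set p : Cplx2 R | D p.1 /\ p.2 = F p.1] : set (Cplx2 R)) =
    [set ((z, F z) : Cplx2 R) | z in D].
  rewrite eqEsubset; split; first by move=> [z w] /= [Dz ->]; exists z.
  by move=> _ [z Dz <-].
rewrite E; apply: continuous_compact; last exact: closed_disc_compact.
apply/subspace_continuousP => x Dx; apply: (cvg_pair (G := nbhs x) (H := nbhs (F x))).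
  exact: cvg_within.
by move/subspace_continuousP : Fc; exact.
Qed.

Lemma graph_nonempty : [set p : Cplx2 R | D p.1 /\ p.2 = F p.1] (0, F 0).
Proof. by split => //=; rewrite /closed_disc /= normr0 ltW. Qed.

Lemma sup_graph_lt1 (P : {poly {poly K}}) (q : R) : q < 1 ->
  (forall z, D z -> `|eval2 P z (F z) : K| <= q) ->
  sup [set `|eval2 P x.1 x.2| | x in [set p : Cplx2 R | D p.1 /\ p.2 = F p.1]] < 1.
Proof.
move=> q1 h; apply: le_lt_trans q1; apply: ge_sup.
  by exists `|eval2 P 0 (F 0)|; exists (0, F 0); first exact: graph_nonempty.
by move=> _ [[z w] /= [Dz ->] <-]; exact: h.
Qed.

(** The inverse is the power -1 of (g - d/2) + d/2, in the form required by [ualg_pw]. *)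
Lemma ualg_inv (g : K -> K) (d : R) : 0 < d -> ualg D F g ->
  (forall x, D x -> d <= Re (g x)) -> ualg D F (fun x => (g x)^-1).
Proof.
move=> d0 ag gd.
have a1 : 0 <= (1 : R) <= 1 by rewrite ler01 lexx.
have d2 : 0 < d / 2 by rewrite divr_gt0.
have dd : d / 2 <= d by rewrite ler_pdivrMr// ler_peMr ?(ltW d0)// ler1n.
have h := @ualg_pw R D F (fun x => g x - rc (d / 2)) 1 (d / 2) a1 d2 (ualgB ag (ualg_cst _ _ _)).
apply: ualg_eq (h _) => x Dx.
  by rewrite subrK pwN1//; apply: lt_le_trans (gd x Dx).
by rewrite ReD ReN Rerc subr_ge0; apply: le_trans (gd x Dx).
Qed.

(** Over the disc, a point (a, b) off the graph is separated by 1 - (z - a) P1 - (w - b) P2,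
    where P1 and P2 approximate conj(z - a) / g and conj(F - b) / g with
    g = |z - a|^2 + |F - b|^2, so that the polynomial is nearly 0 on the graph. *)
Lemma graph_polynomially_convex :
  polynomially_convex [set p : Cplx2 R | D p.1 /\ p.2 = F p.1].
Proof.
split; first exact: graph_compact.
move=> [a b] /= nab; have [ar|ar] := leP `|a| rho; last first.
  have a0 : 0 < `|a| by apply: lt_trans ar.
  have an : a != 0 by rewrite -normr_gt0.
  (* outside the disc, the coordinate z / a separates *)
  exists ((a^-1)%:P%:P * 'X%:P); split; first by rewrite eval2M eval2C eval2XP mulVf.
  apply: (@sup_graph_lt1 _ (rho / `|a|)); first by rewrite ltr_pdivrMr// mul1r.
  move=> z Dz; rewrite eval2M eval2C eval2XP modM modV mulrC ler_wpM2r// invr_ge0//.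
have Da : D a by [].
have bF : F a != b by apply/eqP => e; apply: nab; split.
pose s := `|F a - b : K| / 2.
have s0 : 0 < s by rewrite divr_gt0// normr_gt0 subr_eq0.
have [r r0 hr] := (iffLR (@within_continuousP R D F) Fc) a Da s s0.
pose d := Num.min (r ^+ 2) (s ^+ 2).
have d0 : 0 < d by rewrite lt_min !exprn_gt0.
pose g (x : K) : K := (x - a) * (conjc (x - a : K) : K) + (F x - b) * (conjc (F x - b : K) : K).
have gd x : D x -> d <= Re (g x).
  move=> Dx; rewrite /g !mulzJ -rcD Rerc.
  have [xr|xr] := ltP `|a - x : K| r.
    have sF : s <= `|F x - b : K|.
      have := hr x Dx xr; have := ler_normD (F a - F x : K) (F x - b).
      by rewrite addrA subrK /s; lra.
    apply: le_trans (_ : s ^+ 2 <= _); first by rewrite ge_min lexx orbT.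
    by rewrite ler_wpDl ?sqr_ge0// lerXn2r ?nnegrE ?(ltW s0).
  apply: le_trans (_ : r ^+ 2 <= _); first by rewrite ge_min lexx.
  by rewrite ler_wpDr ?sqr_ge0// lerXn2r ?nnegrE ?(ltW r0)// distrC.
have aid : ualg D F id by apply: (@ualg_id _ _ _ rho) => x.
have idc : {within D, continuous (id : K -> K)}.
  by apply: continuous_subspaceT => y; exact: cvg_id.
have cB (f : K -> K) c : ualg D F f -> ualg D F (fun x => (conjc (f x) : K)) ->
   ualg D F (fun x => (conjc (f x - c : K) : K)).
  move=> _ h; apply: ualg_eq (ualgB h (ualg_cst _ _ (conjc c : K))) => x _.
  by apply: cplx_eqP; rewrite ?(Reconj, Imconj, ReD, ImD, ReN, ImN); ring.
have c1 : ualg D F (fun x => (conjc (x - a : K) : K)).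
  by apply: (cB id) => //; apply: dense; exact: within_continuous_conj.
have aF : ualg D F F by exact: dense.
have c2 : ualg D F (fun x => (conjc (F x - b : K) : K)).
  by apply: (cB F) => //; apply: dense; exact: within_continuous_conj.
have ag : ualg D F g.
  by apply: ualgD; apply: ualgM => //; apply: ualgB => //; exact: ualg_cst.
have ai := ualg_inv d0 ag gd.
have [[B1 hB1] _] := ualgB aid (ualg_cst D F a).
have [[B2 hB2] _] := ualgB aF (ualg_cst D F b).
have [_ k1] := ualgM c1 ai; have [_ k2] := ualgM c2 ai.
(* B1 and B2 bound z - a and F - b, so an error e on the cofactors costs at most 1/2 *)
pose e := (2 * (`|B1| + `|B2| + 1))^-1.
have e0 : 0 < e by rewrite invr_gt0 mulr_gt0// ltr_wpDl// addr_ge0.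
have [P1 h1] := k1 e e0; have [P2 h2] := k2 e e0.
exists (1 - ('X%:P - a%:P%:P) * P1 - ('X - b%:P%:P) * P2).
have eE z w : eval2 (1 - ('X%:P - a%:P%:P) * P1 - ('X - b%:P%:P) * P2) z w =
   1 - (z - a) * eval2 P1 z w - (w - b) * eval2 P2 z w.
  by rewrite /eval2 !hornerE.
split; first by rewrite eE !subrr !mul0r !subr0.
apply: (@sup_graph_lt1 _ (2^-1)); first by rewrite invf_lt1// ltr1n.
move=> z Dz; rewrite eE.
have gz : g z != 0 by rewrite -normr_gt0 ReP_mod_gt0// (lt_le_trans d0)// gd.
have -> : 1 - (z - a) * eval2 P1 z (F z) - (F z - b) * eval2 P2 z (F z) =
  - ((z - a) * (eval2 P1 z (F z) - (conjc (z - a : K) : K) * (g z)^-1)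
   + (F z - b) * (eval2 P2 z (F z) - (conjc (F z - b : K) : K) * (g z)^-1)) :> K.
  rewrite -{1}(divff gz) {1}/g; ring.
rewrite normrN; apply: le_trans (ler_normD _ _) _; rewrite !modM.
have m1 : `|z - a : K| * `|eval2 P1 z (F z) - (conjc (z - a : K) : K) * (g z)^-1 : K| <= `|B1| * e.
  by apply: ler_pM => //; [apply: le_trans (ler_norm _); exact: hB1|exact: h1].
have m2 : `|F z - b : K| * `|eval2 P2 z (F z) - (conjc (F z - b : K) : K) * (g z)^-1 : K| <= `|B2| * e.
  by apply: ler_pM => //; [apply: le_trans (ler_norm _); exact: hB2|exact: h2].
apply: le_trans (lerD m1 m2) _.
have ee : 2 * (`|B1| + `|B2| + 1) * e = 1.
  by rewrite mulfV// gt_eqF// mulr_gt0// ltr_wpDl// addr_ge0.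
lra.
Qed.

End GraphHull.

(** * Differentials and derivatives along curves *)

Section Bridge.
Variable R : realType.
Local Notation K := (Cplx R).

Lemma Re_continuous : continuous (@complex.Re R : K -> R).
Proof.
move=> z; apply: (iffRL (@cvgrPdist_lt _ _ _ (nbhs (z : K)) (nbhs_filter (z : K)) _ _)) => e e0; apply/nbhs_normP; exists e => //= t zt.
rewrite -ReN -ReD; exact: le_lt_trans (Re_le_mod _) zt.
Qed.

Lemma Im_continuous : continuous (@complex.Im R : K -> R).
Proof.
move=> z; apply: (iffRL (@cvgrPdist_lt _ _ _ (nbhs (z : K)) (nbhs_filter (z : K)) _ _)) => e e0; apply/nbhs_normP; exists e => //= t zt.
rewrite -ImN -ImD; exact: le_lt_trans (Im_le_mod _) zt.
Qed.

Lemma diff_derive1 (W : normedModType R) (f : R -> W) (t : R) d :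
  differentiable f t -> 'd f t 1 = d -> is_derive t (1 : R) f d.
Proof.
move=> df <-; split; first exact/derivable1_diffP.
by rewrite deriveE.
Qed.

Lemma diff_cder (f : R -> K) (t : R) :
  differentiable f t -> cder f t ('d f t 1).
Proof.
move=> df; split; apply: diff_derive1.
- by apply: (@differentiable_comp _ _ _ _ f (@complex.Re R : K -> R)) => //; apply/linear_differentiable/Re_continuous.
- rewrite (@diff_comp _ _ _ _ f (@complex.Re R : K -> R))//=; last exact/linear_differentiable/Re_continuous.
  by rewrite (diff_lin _ Re_continuous).
- by apply: (@differentiable_comp _ _ _ _ f (@complex.Im R : K -> R)) => //; apply/linear_differentiable/Im_continuous.
- rewrite (@diff_comp _ _ _ _ f (@complex.Im R : K -> R))//=; last exact/linear_differentiable/Im_continuous.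
  by rewrite (diff_lin _ Im_continuous).
Qed.

Lemma cder_diff (f : R -> K) (t : R) d : cder f t d ->
  differentiable f t /\ 'd f t 1 = d.
Proof.
move=> [f1 f2].
have d1 : differentiable (fun s => Re (f s)) t by apply/derivable1_diffP; case: f1.
have d2 : differentiable (fun s => Im (f s)) t by apply/derivable1_diffP; case: f2.
have fE : f = (fun s => Re (f s) *: (1 : K)) + (fun s => Im (f s) *: ('i%C : K)).
  apply/funext => s /=.
  rewrite -[RHS]/(Re (f s) *: (1 : K) + Im (f s) *: ('i%C : K)).
  rewrite !rcZ mulr1 [rc (Im _) * _]mulrC; exact: cplxE.
have i1 := @is_diff_comp _ _ _ _ _ _ (fun x : R => x *: (1 : K)) _ t (differentiableP d1) (is_diff_scalel _ (1 : K)).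
have i2 := @is_diff_comp _ _ _ _ _ _ (fun x : R => x *: ('i%C : K)) _ t (differentiableP d2) (is_diff_scalel _ ('i%C : K)).
have [h1 h2] := is_diffD i1 i2.
rewrite [f]fE; split; first exact: h1.
have h3 := congr1 (fun g : R -> K => g 1) h2.
apply: etrans h3 _ => /=.
rewrite -[LHS]/('d (fun s => Re (f s)) t 1 *: (1 : K) + 'd (fun s => Im (f s)) t 1 *: ('i%C : K)).
rewrite -!deriveE//; case: f1 => _ ->; case: f2 => _ ->.
rewrite !rcZ mulr1 [rc (Im _) * _]mulrC; symmetry; exact: cplxE.
Qed.

Lemma cder_chain (g : K -> K) (f : R -> K) t d : differentiable g (f t) ->
  cder f t d -> cder (fun s => g (f s)) t ('d g (f t) d).
Proof.
move=> dg /cder_diff[df <-].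
have := diff_cder (differentiable_comp df dg).
by rewrite diff_comp.
Qed.

Lemma cder_chain2 (g : Cplx2 R -> K) (f1 f2 : R -> K) t d1 d2 :
  differentiable g (f1 t, f2 t) -> cder f1 t d1 -> cder f2 t d2 ->
  cder (fun s => g (f1 s, f2 s)) t ('d g (f1 t, f2 t) (d1, d2)).
Proof.
move=> dg /cder_diff[df1 <-] /cder_diff[df2 <-].
have dp : differentiable (fun s => (f1 s, f2 s) : Cplx2 R) t by exact: differentiable_pair.
have := diff_cder (differentiable_comp dp dg).
by rewrite diff_comp//= diff_pair.
Qed.

Lemma is_derive_of_cder (g : K -> K) (z v d : K) :
  cder (fun s => g (z + rc s * v)) 0 d -> is_derive z v g d.
Proof.
move=> h; have [df dd] := cder_diff h.
have [h1 h2] := diff_derive1 df dd.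
have E : (fun h : R => h^-1 *: ((g \o shift z) (h *: v) - g z)) =
   (fun h : R => h^-1 *: (((fun s => g (z + rc s * v)) \o shift 0) (h *: (1 : R)) - g (z + rc 0 * v))).
  apply/funext => s /=; rewrite rc0 mul0r addr0 addr0 rcZ.
  by rewrite [s%:A]mulr1 [z + _]addrC.
split; first by rewrite /derivable E.
by rewrite /derive E.
Qed.

End Bridge.

(** * Functions smooth in one direction near the origin *)

Section Germs.
Variable R : realType.
Local Notation K := (Cplx R).

Lemma cder_unique (f : R -> K) t a b : cder f t a -> cder f t b -> a = b.
Proof. by move=> /cder_diff[_ <-] /cder_diff[_ <-]. Qed.

Lemma cder_shift (f : R -> K) t d : cder (fun s => f (t + s)) 0 d -> cder f t d.
Proof.
move=> [h1 h2].
have e : t - t = 0 by rewrite subrr.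
have ds := rderD (is_derive_id t (1 : R)) (rderc (- t) t).
rewrite -e in h1 h2; split.
  by apply: rder_eq (@rder_comp R _ (fun s : R => s - t) t _ _ h1 ds) => [s|]; rewrite ?addr0 ?mulr1// addrC subrK.
by apply: rder_eq (@rder_comp R _ (fun s : R => s - t) t _ _ h2 ds) => [s|]; rewrite ?addr0 ?mulr1// addrC subrK.
Qed.

Lemma cder_line_shift (f : K -> K) z v t d :
  cder (fun s => f (z + rc t * v + rc s * v)) 0 d ->
  cder (fun s => f (z + rc s * v)) t d.
Proof.
move=> h; apply: cder_shift; apply: cder_eq h => // s.
by rewrite rcD mulrDl addrA.
Qed.

(** f and its first n derivatives in the direction v exist and are bounded near 0, on discs
    that may shrink with the order: this is what Taylor's formula in the direction v draws
    from the smoothness of a germ. *)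
Fixpoint gsmooth (v : K) (n : nat) (f : K -> K) : Prop :=
  (exists d B : R, 0 < d /\ forall z, `|z| < d -> `|f z| <= B) /\
  (if n is m.+1 then exists f' : K -> K,
     (exists2 d : R, 0 < d & forall z, `|z| < d -> cder (fun s => f (z + rc s * v)) 0 (f' z))
     /\ gsmooth v m f'
   else True).

Variable v : K.

Lemma gsmooth_bnd n f : gsmooth v n f -> exists d B : R, 0 < d /\ forall z, `|z| < d -> `|f z| <= B.
Proof. by case: n => [|n] []. Qed.

Lemma gsmoothW n f : gsmooth v n.+1 f -> gsmooth v n f.
Proof.
elim: n f => [|n IH] f [hb [f' [hd hf]]]; first by split.
by split => //; exists f'; split => //; exact: IH.
Qed.

Lemma gsmooth_eq n f g : f =1 g -> gsmooth v n f -> gsmooth v n g.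
Proof. by move=> /funext ->. Qed.

Lemma gsmooth_cst n c : gsmooth v n (fun=> c).
Proof.
elim: n c => [|n IH] c; (split; first by exists 1, `|c|; split) => //.
exists (fun=> 0); split => //; exists 1 => // z _; exact: cderc.
Qed.

Lemma gsmoothD n f g : gsmooth v n f -> gsmooth v n g -> gsmooth v n (fun z => f z + g z).
Proof.
elim: n f g => [|n IH] f g [[d1 [B1 [d10 hB1]]] hf] [[d2 [B2 [d20 hB2]]] hg].
  split=> //; exists (Num.min d1 d2), (B1 + B2); split; first by rewrite lt_min d10.
  move=> z; rewrite lt_min => /andP[z1 z2]; apply: le_trans (ler_normD _ _) _.
  by apply: lerD; [exact: hB1|exact: hB2].
split.
  exists (Num.min d1 d2), (B1 + B2); split; first by rewrite lt_min d10.
  move=> z; rewrite lt_min => /andP[z1 z2]; apply: le_trans (ler_normD _ _) _.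
  by apply: lerD; [exact: hB1|exact: hB2].
case: hf => f' [[e1 e10 h1] sf]; case: hg => g' [[e2 e20 h2] sg].
exists (fun z => f' z + g' z); split; last exact: IH.
exists (Num.min e1 e2); first by rewrite lt_min e10.
by move=> z; rewrite lt_min => /andP[z1 z2]; apply: cderD; [exact: h1|exact: h2].
Qed.

Lemma gsmoothM n f g : gsmooth v n f -> gsmooth v n g -> gsmooth v n (fun z => f z * g z).
Proof.
elim: n f g => [|n IH] f g hf0 hg0.
  have [d1 [B1 [d10 hB1]]] := gsmooth_bnd hf0; have [d2 [B2 [d20 hB2]]] := gsmooth_bnd hg0.
  split=> //; exists (Num.min d1 d2), (B1 * B2); split; first by rewrite lt_min d10.
  move=> z; rewrite lt_min => /andP[z1 z2]; rewrite modM ler_pM//; [exact: hB1|exact: hB2].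
have [d1 [B1 [d10 hB1]]] := gsmooth_bnd hf0; have [d2 [B2 [d20 hB2]]] := gsmooth_bnd hg0.
split.
  exists (Num.min d1 d2), (B1 * B2); split; first by rewrite lt_min d10.
  move=> z; rewrite lt_min => /andP[z1 z2]; rewrite modM ler_pM//; [exact: hB1|exact: hB2].
have [_ [f' [[e1 e10 h1] sf]]] := hf0; have [_ [g' [[e2 e20 h2] sg]]] := hg0.
exists (fun z => f' z * g z + f z * g' z); split; last first.
  by apply: gsmoothD; apply: IH => //; exact: gsmoothW.
exists (Num.min e1 e2); first by rewrite lt_min e10.
move=> z; rewrite lt_min => /andP[z1 z2].
apply: cder_eq (cderM (h1 z z1) (h2 z z2)) => //.
by rewrite rc0 mul0r addr0.
Qed.

Lemma gsmooth_conj n f : gsmooth v n f -> gsmooth v n (fun z => (conjc (f z) : K)).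
Proof.
elim: n f => [|n IH] f [[d1 [B1 [d10 hB1]]] hf].
  by split=> //; exists d1, B1; split => // z zd; rewrite mod_conj; exact: hB1.
split; first by exists d1, B1; split => // z zd; rewrite mod_conj; exact: hB1.
case: hf => f' [[e1 e10 h1] sf]; exists (fun z => (conjc (f' z) : K)); split; last exact: IH.
by exists e1 => // z zd; apply: cder_conj; exact: h1.
Qed.

Lemma gsmooth_id n : gsmooth v n id.
Proof.
have hb : exists d B : R, 0 < d /\ forall z : K, `|z| < d -> `|id z| <= B.
  by exists 1, 1; split => // z /ltW.
case: n => [|n]; split => //.
exists (fun=> v); split; last exact: gsmooth_cst.
by exists 1 => // z _; apply: cder_affine.
Qed.

Lemma gsmoothX n f m : gsmooth v n f -> gsmooth v n (fun z => f z ^+ m).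
Proof.
move=> sf; elim: m => [|m IH]; first exact: gsmooth_cst.
by apply: gsmooth_eq (gsmoothM sf IH) => z; rewrite exprS.
Qed.

Lemma gsmooth_sum n (I : Type) (r : seq I) (f : I -> K -> K) :
  (forall i, gsmooth v n (f i)) -> gsmooth v n (fun z => \sum_(i <- r) f i z).
Proof.
move=> sf; elim: r => [|i r IH].
  by apply: gsmooth_eq (gsmooth_cst n 0) => z; rewrite big_nil.
by apply: gsmooth_eq (gsmoothD (sf i) IH) => z; rewrite big_cons.
Qed.

Lemma gsmooth_Re n f : gsmooth v n f -> gsmooth v n (fun z => rc (Re (f z))).
Proof.
move=> sf; apply: gsmooth_eq (gsmoothM (gsmooth_cst n (rc 2^-1)) (gsmoothD sf (gsmooth_conj sf))) => z.
by apply: cplx_eqP; rewrite !(ReM, ImM) !(ReD, ImD) Reconj Imconj !Rerc !Imrc; field.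
Qed.

Lemma gsmooth_Im n f : gsmooth v n f -> gsmooth v n (fun z => rc (Im (f z))).
Proof.
move=> sf; apply: gsmooth_eq (gsmooth_Re (gsmoothM (gsmooth_cst n (- ('i%C : K))) sf)) => z.
by congr rc; rewrite ReM ReN ImN Re_i Im_i; ring.
Qed.

(** Induction on the order by integrating the expansion of the derivative; besides the
    remainder, only the coefficients of degree 0 and 1 have to be identified. *)
Lemma gsmooth_taylor N f : gsmooth v N f -> exists d B : R, [/\ 0 < d, 0 <= B &
  forall z h, 0 <= h -> `|z| + h * `|v| < d -> exists p : {poly K},
    [/\ (size p <= N)%N, (0 < N)%N -> p`_0 = f z,
        (1 < N)%N -> forall a, cder (fun s => f (z + rc s * v)) 0 a -> p`_1 = a &
        forall s, 0 <= s <= h -> `|f (z + rc s * v) - p.[rc s] : K| <= B * s ^+ N]].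
Proof.
elim: N f => [|N IH] f [[d1 [B1 [d10 hB1]]] hf].
  exists d1, `|B1|; split => // z h h0 zh; exists 0; split => //; first by rewrite size_poly0.
  move=> s /andP[s0 sh]; rewrite horner0 subr0 expr0 mulr1; apply: le_trans (ler_norm _).
  apply: hB1; apply: le_lt_trans zh; apply: le_trans (ler_normD _ _) _.
  by rewrite lerD2l modM mod_rc ger0_norm// ler_wpM2r.
case: hf => f' [[e e0 he] sf].
have [d2 [B2 [d20 B20 hT]]] := IH _ sf.
exists (Num.min e d2), (2 * B2); split; [by rewrite lt_min e0|by rewrite mulr_ge0|].
move=> z h h0; rewrite lt_min => /andP[zh1 zh2].
have [p [sp p0 p1 hp]] := hT z h h0 zh2.
pose P : {poly K} := \poly_(i < N.+1) (if i is j.+1 then p`_j / j.+1%:R else f z).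
have nat0 j : (j.+1%:R : K) != 0 by rewrite -rcn rc_eq0 pnatr_eq0.
have dP : P^`() = p.
  apply/polyP => j; rewrite coef_deriv coef_poly ltnS.
  case: ltnP => jN; first by rewrite -(mulr_natr (_ / _)) divfK.
  by rewrite mul0rn nth_default// (leq_trans sp).
have zs s : 0 <= s <= h -> `|z + rc s * v : K| < e.
  move=> /andP[s0 sh]; apply: le_lt_trans zh1; apply: le_trans (ler_normD _ _) _.
  by rewrite lerD2l modM mod_rc ger0_norm// ler_wpM2r.
exists P; split; first exact: size_poly.
- by move=> _; rewrite coef_poly.
- move=> N1 a ha; rewrite coef_poly N1 /= divr1 p0//.
  apply: cder_unique ha; apply: he; apply: le_lt_trans zh1.
  by rewrite lerDl mulr_ge0.
move=> t /andP[t0 th].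
pose g s : K := f (z + rc s * v) - P.[rc s].
have g0 : g 0 = 0.
  rewrite /g rc0 mul0r addr0 horner_coef0 coef_poly /= subrr //.
have hg s : 0 <= s <= t -> cder g s (f' (z + rc s * v) - p.[rc s]).
  move=> /andP[s0 st]; apply: cderB.
    by apply: cder_line_shift; apply: he; apply: zs; rewrite s0 (le_trans st).
  have := cder_horner P (cder_rc (is_derive_id s (1 : R))).
  by rewrite dP rc1 mulr1.
have hB s : 0 <= s <= t -> `|f' (z + rc s * v) - p.[rc s] : K| <= B2 * t ^+ N.
  move=> /andP[s0 st]; apply: le_trans (hp s _) _; first by rewrite s0 (le_trans st).
  by rewrite ler_wpM2l// lerXn2r ?nnegrE.
have := cder_mvt t0 hg hB; rewrite g0 !subr0 /g exprSr => /le_trans; apply.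
by apply: le_of_eq; ring.
Qed.

(** A weak form of Markov's inequality at the end of an interval: for p of degree n > 1, the
    polynomial p(2x) - 2^n p(x) has lower degree and its linear coefficient is that of p up
    to the factor 2 - 2^n, so induction applies on half of the interval. *)
Lemma poly_coef1_bound N : exists2 C : R, 0 <= C & forall (p : {poly K}) (E h : R),
  (size p <= N)%N -> 0 < h -> (forall s, 0 <= s <= h -> `|p.[rc s] : K| <= E) ->
  `|p`_1 : K| * h <= C * E.
Proof.
have E0 (p : {poly K}) (E h : R) : 0 < h -> (forall s, 0 <= s <= h -> `|p.[rc s] : K| <= E) -> 0 <= E.
  by move=> h0 /(_ h); rewrite (ltW h0) lexx => /(_ isT); exact: le_trans.
case: N => [|[|N]].
- exists 0 => // p E h sp h0 hE; rewrite mul0r (nth_default _ (leq_trans sp _))//.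
  by rewrite normr0 mul0r.
- exists 0 => // p E h sp h0 hE; rewrite mul0r (nth_default _ (leq_trans sp _))//.
  by rewrite normr0 mul0r.
elim: N => [|N [C C0 IH]].
  exists 2 => // p E h sp h0 hE.
  have e : p.[rc h] - p.[rc 0] = p`_1 * rc h.
    rewrite !(horner_coef_wide _ sp) !big_ord_recl !big_ord0 /= /bump /= rc0 !expr0 !addn0 !expr1.
    by ring.
  have -> : `|p`_1 : K| * h = `|p`_1 * rc h : K| by rewrite modM mod_rc gtr0_norm.
  rewrite -e; apply: le_trans (ler_normB _ _) _; rewrite mulrDl mul1r.
  by apply: lerD; apply: hE; rewrite ?lexx ?(ltW h0).
pose T : R := 2 ^+ N.+2.
have T4 : 4 <= T.
  rewrite /T !exprS mulrA; have : 1 <= (2 : R) ^+ N by rewrite exprn_ege1// ler1n.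
  lra.
exists (C * (1 + T)); first by rewrite mulr_ge0//; lra.
move=> p E h sp h0 hE.
pose q : {poly K} := \poly_(i < N.+2) ((rc 2 ^+ i - rc T) * p`_i).
have qE x : q.[x] = p.[rc 2 * x] - rc T * p.[x].
  rewrite horner_poly !(horner_coef_wide _ sp) [in RHS]big_ord_recr [X in _ - _ * X]big_ord_recr /=.
  rewrite mulrDr opprD addrACA [X in _ = _ + X](_ : _ = 0) ?addr0.
    rewrite mulr_sumr -sumrB; apply: eq_bigr => i _; rewrite exprMn; ring.
  by rewrite exprMn /T rcX; ring.
have h2 : 0 < h / 2 by rewrite divr_gt0.
have sq : (size q <= N.+2)%N by exact: size_poly.
have EE := E0 _ _ _ h0 hE.
have := IH q ((1 + T) * E) (h / 2) sq h2 (_ : _).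
have hq s : 0 <= s <= h / 2 -> `|q.[rc s] : K| <= (1 + T) * E.
  move=> /andP[s0 sh]; rewrite qE; apply: le_trans (ler_normB _ _) _.
  have t1 : `|p.[rc 2 * rc s] : K| <= E by rewrite -rcM; apply: hE; apply/andP; split; [rewrite mulr_ge0|rewrite mulrC -ler_pdivlMr].
  have t2 : `|p.[rc s] : K| <= E by apply: hE; apply/andP; split; lra.
  rewrite mulrDl mul1r; apply: lerD => //.
  by rewrite modM mod_rc ger0_norm ?ler_wpM2l//; lra.
move=> /(_ hq); rewrite coef_poly /= expr1 modM -rcN -rcD mod_rc ler0_norm; last by lra.
have p1 := normr_ge0 (p`_1 : K); move: `|p`_1 : K| p1 => u u0 h3.
have h4 : 0 <= u * h * (T - 4) by rewrite mulr_ge0 ?subr_ge0// mulr_ge0// ltW.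
rewrite -mulrA; apply: le_trans h3; lra.
Qed.

(** Near z, f agrees up to O(|z|^N) with its Taylor polynomial in the direction v on a segment
    of length |z|; that polynomial is therefore O(|z|^N) on the segment, and its linear
    coefficient, which is the derivative of f, is O(|z|^(N-1)). *)
Lemma gsmooth_vanish N f f' (A d0 : R) : gsmooth v N f -> (1 < N)%N -> `|v| = 1 -> 0 < d0 ->
  (forall z, `|z| < d0 -> `|f z| <= A * `|z| ^+ N) ->
  (forall z, `|z| < d0 -> cder (fun s => f (z + rc s * v)) 0 (f' z)) ->
  exists d B : R, [/\ 0 < d, 0 <= B & forall z, z != 0 -> `|z| < d -> `|f' z| <= B * `|z| ^+ N.-1].
Proof.
move=> sf N1 v1 d00 hA hd.
have [d1 [B [d10 B0 hT]]] := gsmooth_taylor sf.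
have [C C0 hC] := poly_coef1_bound N.
pose d := Num.min (d0 / 2) (d1 / 2).
have A0 : 0 <= `|A| by [].
exists d, (C * (`|A| * 2 ^+ N + B)); split.
- by rewrite lt_min !divr_gt0.
- by rewrite mulr_ge0// addr_ge0// mulr_ge0.
move=> z z0; rewrite lt_min => /andP[zd0 zd1].
have zp : 0 < `|z| by rewrite normr_gt0.
have zz : `|z| + `|z| * `|v| < d1 by rewrite v1 mulr1; lra.
have [p [sp _ p1 hp]] := hT z `|z| (ltW zp) zz.
have {p1} p1 : p`_1 = f' z by apply: p1 => //; apply: hd; lra.
have hE s : 0 <= s <= `|z| -> `|p.[rc s] : K| <= (`|A| * 2 ^+ N + B) * `|z| ^+ N.
  move=> s01; have /andP[s0 sz] := s01.
  rewrite -(subrK (f (z + rc s * v)) p.[rc s]) mulrDl addrC.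
  apply: le_trans (ler_normD _ _) _; apply: lerD; last first.
    by rewrite distrC; apply: le_trans (hp s s01) _; rewrite ler_wpM2l// lerXn2r ?nnegrE.
  have zv : `|z + rc s * v : K| <= 2 * `|z|.
    apply: le_trans (ler_normD _ _) _; rewrite modM v1 mulr1 mod_rc ger0_norm//; lra.
  apply: le_trans (hA _ _) _; first by lra.
  rewrite -mulrA -exprMn; apply: le_trans (ler_wpM2r _ (ler_norm A)) _; first by rewrite exprn_ge0.
  by rewrite ler_wpM2l// lerXn2r ?nnegrE// mulr_ge0.
have := hC p _ _ sp zp hE; rewrite p1 => h.
rewrite -(ler_pM2r zp); apply: le_trans h _.
by rewrite -[leRHS]mulrA -exprSr prednK ?mulrA// ltnW.
Qed.

End Germs.

(** * Derivatives of the monomials *)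

Section Monomials.
Variable R : realType.
Local Notation K := (Cplx R).

Definition zzb (m n : nat) (z : K) : K := z ^+ m * (conjc z : K) ^+ n.
Definition dzzb (m n : nat) (v z : K) : K :=
  m%:R * z ^+ m.-1 * v * (conjc z : K) ^+ n + z ^+ m * (n%:R * (conjc z : K) ^+ n.-1 * (conjc v : K)).

Lemma cder_zzb m n (f : R -> K) t d : cder f t d ->
  cder (fun s => zzb m n (f s)) t (dzzb m n d (f t)).
Proof. by move=> fd; apply: cderM; [exact: cderX|exact/cderX/cder_conj]. Qed.

Lemma mod_zzb m n z : `|zzb m n z| = `|z| ^+ (m + n).
Proof. by rewrite modM !modX mod_conj exprD. Qed.

Lemma mod_dzzb m n v z : `|dzzb m n v z| <= (m + n)%:R * `|z| ^+ (m + n).-1 * `|v|.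
Proof.
apply: le_trans (ler_normD _ _) _; rewrite !modM !modX !mod_conj -!rcn !mod_rc !ger0_norm ?ler0n//.
case: m => [|m]; case: n => [|n]; rewrite ?mul0r ?mulr0 ?add0r ?addr0 ?expr0 ?mul1r ?mulr1 ?addn0 ?add0n//=.
rewrite le_eqVlt; apply/orP; left; apply/eqP.
rewrite natrD exprD !exprS; ring.
Qed.

Lemma gsmooth_dzzb v N m n : gsmooth v N (dzzb m n v).
Proof.
have g1 := gsmooth_id v N; have g2 := gsmooth_conj g1; have gc c := gsmooth_cst v N c.
by apply: gsmoothD; apply: gsmoothM; rewrite ?(gsmoothM, gsmoothX, gc)//; repeat (apply: gsmoothM => //); exact: gsmoothX.
Qed.

Variables (k : nat) (C : nat -> K).

Lemma monomE j z : monom k C j z = C j * zzb (k - j) j z.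
Proof. by rewrite /monom /zzb mulrA. Qed.

Definition dmonom j v z : K := C j * dzzb (k - j) j v z.

Lemma cder_monom j (f : R -> K) t d : cder f t d ->
  cder (fun s => monom k C j (f s)) t (dmonom j d (f t)).
Proof.
move=> fd; apply: cder_eq (cderZ (C j) (cder_zzb (k - j) j fd)) => // s.
by rewrite monomE.
Qed.

Lemma mod_monom j z : (j <= k)%N -> `|monom k C j z| = `|C j| * `|z| ^+ k.
Proof. by move=> jk; rewrite monomE modM mod_zzb subnK. Qed.

Lemma mod_dmonom j v z : (j <= k)%N -> `|dmonom j v z| <= `|C j| * (k%:R * `|z| ^+ k.-1 * `|v|).
Proof. by move=> jk; rewrite modM ler_wpM2l//; apply: le_trans (mod_dzzb _ _ _ _) _; rewrite subnK. Qed.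

Lemma cder_sum (I : Type) (r : seq I) (f df : I -> R -> K) t :
  (forall i, cder (f i) t (df i t)) ->
  cder (fun s => \sum_(i <- r) f i s) t (\sum_(i <- r) df i t).
Proof.
move=> h; elim: r => [|i r IH].
  by apply: cder_eq (cderc 0 t) => [s|]; rewrite big_nil.
by apply: cder_eq (cderD (h i) IH) => [s|]; rewrite big_cons.
Qed.

End Monomials.

(** * Restriction of smooth functions to a graph *)

Section SurfaceSmoothness.
Variable R : realType.
Local Notation K := (Cplx R).

Lemma nbhs_pair0 (N : set (Cplx2 R)) : nbhs ((0, 0) : Cplx2 R) N ->
  exists2 d : R, 0 < d & forall z w : K, `|z| < d -> `|w| < d -> N (z, w).
Proof.
move=> [[A B] /= [/nbhs_normP[d1 /= d10 hA] /nbhs_normP[d2 /= d20 hB]] hAB].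
exists (Num.min d1 d2); first by rewrite lt_min d10.
move=> z w; rewrite !lt_min => /andP[z1 z2] /andP[w1 w2]; apply: (hAB (z, w)).
by split; [apply: hA|apply: hB]; rewrite /= sub0r normrN.
Qed.

Lemma continuous_close (h : Cplx2 R -> K) : {for ((0, 0) : Cplx2 R), continuous h} ->
  forall e : R, 0 < e ->
  exists2 d : R, 0 < d & forall z w : K, `|z| < d -> `|w| < d -> `|h (z, w) - h (0, 0) : K| < e.
Proof.
move=> hc e e0.
have FF : Filter (nbhs ((0, 0) : Cplx2 R)) by exact: nbhs_filter.
have := iffLR (@cvgrPdist_lt _ _ _ (nbhs ((0, 0) : Cplx2 R)) FF _ _) hc e e0.
by move=> /nbhs_pair0[d d0 hd]; exists d => // z w zd wd; rewrite distrC; exact: hd.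
Qed.

Lemma continuous_bounded (h : Cplx2 R -> K) : {for ((0, 0) : Cplx2 R), continuous h} ->
  exists d B : R, [/\ 0 < d, 0 <= B & forall z w : K, `|z| < d -> `|w| < d -> `|h (z, w)| <= B].
Proof.
move=> hc; have [d d0 hd] := continuous_close hc ltr01.
exists d, (1 + `|h (0, 0)|); split => //.
move=> z w zd wd; rewrite -(subrK (h (0, 0)) (h (z, w))).
by apply: le_trans (ler_normD _ _) _; rewrite lerD2r ltW// hd.
Qed.

Definition e01 : Cplx2 R := (0, 1).
Definition e0i : Cplx2 R := (0, 'i%C).

(** The differential is expressed through directional derivatives in fixed directions, since
    it is those that are assumed to be smooth. *)
Lemma diff_split (h : Cplx2 R -> K) p (v w : K) : differentiable h p ->
  'd h p (v, w) = 'D_((v, 0) : Cplx2 R) h p +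
     (rc (Re w) * 'D_e01 h p + rc (Im w) * 'D_e0i h p) :> K.
Proof.
move=> dh; rewrite !deriveE// -!rcZ -!linearZ -!linearD; congr ('d h p _).
apply/pair_equal_spec; split => /=.
  by rewrite !rcZ !mulr0 !addr0.
by rewrite !rcZ mulr1 add0r [rc (Im w) * _]mulrC; exact: cplxE.
Qed.

Lemma derive_0 (h : Cplx2 R -> K) p : differentiable h p -> 'D_((0, 0) : Cplx2 R) h p = 0.
Proof. by move=> dh; rewrite deriveE// -[((0, 0) : Cplx2 R)]/(0 : Cplx2 R) linear0. Qed.

Variable U : set (Cplx2 R).
Hypothesis U0 : nbhs ((0, 0) : Cplx2 R) U.

Lemma Cclass_continuous0 n (h : Cplx2 R -> K) : Cclass n U h -> {for ((0, 0) : Cplx2 R), continuous h}.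
Proof.
have Up := nbhs_singleton U0.
case: n => [|n] hc; first exact: hc.
by apply: differentiable_continuous; case: hc => hd _; exact: hd.
Qed.

Lemma Cclass_lipschitz (h : Cplx2 R -> K) : Cclass 1 U h ->
  exists d B : R, [/\ 0 < d, 0 <= B & forall z w1 w2 : K, `|z| < d -> `|w1| < d -> `|w2| < d ->
    `|h (z, w1) - h (z, w2) : K| <= B * `|w1 - w2 : K|].
Proof.
move=> [hd hc]; have Up := nbhs_singleton U0.
have [d1 [B1 [d10 B10 h1]]] := continuous_bounded (hc e01 _ Up).
have [d2 [B2 [d20 B20 h2]]] := continuous_bounded (hc e0i _ Up).
have [d3 d30 h3] := nbhs_pair0 U0.
pose d := Num.min d1 (Num.min d2 d3).
have dd (z : K) : `|z| < d -> [/\ `|z| < d1, `|z| < d2 & `|z| < d3].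
  by rewrite !lt_min => /andP[? /andP[? ?]].
exists d, (2 * (B1 + B2)); split.
- by rewrite !lt_min d10 d20.
- by rewrite mulr_ge0// addr_ge0.
move=> z w1 w2 zd wd1 wd2.
have conv s : 0 <= s <= 1 -> `|w2 + rc s * (w1 - w2) : K| < d := disc_convex wd2 wd1.
have cd s : 0 <= s <= 1 -> cder (fun s => h (z, w2 + rc s * (w1 - w2))) s ('d h (z, w2 + rc s * (w1 - w2)) (0, w1 - w2)).
  move=> s01; apply: cder_chain2; [|exact: cderc|exact: cder_affine].
  by apply: hd; have [_ _ ?] := dd _ (conv s s01); have [_ _ ?] := dd _ zd; exact: h3.
have cb s : 0 <= s <= 1 -> `|'d h (z, w2 + rc s * (w1 - w2)) (0, w1 - w2) : K| <= (B1 + B2) * `|w1 - w2 : K|.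
  move=> s01; have [c1 c2 c3] := dd _ (conv s s01); have [z1 z2 z3] := dd _ zd.
  have hdd := hd _ (h3 _ _ z3 c3).
  rewrite diff_split// derive_0// add0r; apply: le_trans (ler_normD _ _) _.
  rewrite !modM !mod_rc mulrDl [B1 * _]mulrC [B2 * _]mulrC.
  by apply: lerD; apply: ler_pM; rewrite ?Re_le_mod ?Im_le_mod ?h1 ?h2.
have := cder_mvt ler01 cd cb.
by rewrite rc1 rc0 mul1r mul0r addr0 subrKC subr0 mulr1 mulrA.
Qed.

(** By the chain rule the derivative is a combination of derivatives of h along the graph of P
    and of coordinates of P', to which the induction hypothesis applies. *)
Lemma gsmooth_comp (v : K) (P P' : K -> K) :
  (forall z, cder (fun s => P (z + rc s * v)) 0 (P' z)) ->
  (forall n, gsmooth v n P') ->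
  (forall e : R, 0 < e -> exists2 d : R, 0 < d & forall z, `|z| < d -> `|P z| < e) ->
  forall n h, Cclass n U h -> gsmooth v n (fun z => h (z, P z)).
Proof.
move=> Pd sP P0; elim=> [|n IH] h hC.
  split=> //; have [d [B [d0 B0 hB]]] := continuous_bounded (Cclass_continuous0 hC).
  have [d' d'0 hP] := P0 d d0; exists (Num.min d d'), B; split; first by rewrite lt_min d0.
  by move=> z; rewrite lt_min => /andP[z1 z2]; apply: hB => //; exact: hP.
split.
  have [d [B [d0 B0 hB]]] := continuous_bounded (Cclass_continuous0 hC).
  have [d' d'0 hP] := P0 d d0; exists (Num.min d d'), B; split; first by rewrite lt_min d0.
  by move=> z; rewrite lt_min => /andP[z1 z2]; apply: hB => //; exact: hP.
have [hd hc] := hC.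
exists (fun z => 'D_((v, 0) : Cplx2 R) h (z, P z) +
   (rc (Re (P' z)) * 'D_e01 h (z, P z) + rc (Im (P' z)) * 'D_e0i h (z, P z))); split; last first.
  apply: gsmoothD; first exact: IH (hc _).
  by apply: gsmoothD; apply: gsmoothM; rewrite ?IH//; [exact: gsmooth_Re|exact: (IH _ (hc _))|exact: gsmooth_Im|exact: (IH _ (hc _))].
have [d d0 hU] := nbhs_pair0 U0.
have [d' d'0 hP] := P0 d d0; exists (Num.min d d'); first by rewrite lt_min d0.
move=> z; rewrite lt_min => /andP[z1 z2].
have dz : differentiable h (z, P z) by apply: hd; apply: hU => //; exact: hP.
rewrite -diff_split//.
have := @cder_chain2 R h (fun s => z + rc s * v) (fun s => P (z + rc s * v)) 0 v (P' z).
rewrite rc0 mul0r addr0; apply => //; exact: cder_affine.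
Qed.

End SurfaceSmoothness.

(** * The gradient of the remainder *)

Section GradientBound.
Variable R : realType.
Local Notation K := (Cplx R).

Lemma cder_local0 (f : R -> K) (e : R) d : 0 < e -> (forall s, `|s| < e -> f s = 0) ->
  cder f 0 d -> d = 0.
Proof.
move=> e0 hf [h1 h2].
have nz : \forall s \near (0 : R), f s = 0.
  by apply/nbhs_normP; exists e => // s /=; rewrite sub0r normrN; exact: hf.
have n1 : \forall s \near (0 : R), 0 = Re (f s).
  by near=> s; rewrite (_ : f s = 0)//; near: s.
have n2 : \forall s \near (0 : R), 0 = Im (f s).
  by near=> s; rewrite (_ : f s = 0)//; near: s.
have k1 := near_eq_is_derive n1 (rderc (0 : R) 0).
have k2 := near_eq_is_derive n2 (rderc (0 : R) 0).
apply: cplx_eqP.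
  by case: h1 => _ <-; case: k1 => _ ->.
by case: h2 => _ <-; case: k2 => _ ->.
Unshelve. all: by end_near. Qed.

Lemma bigO_bound (G : K -> K) (n : nat) : G =O_ (0 : K) (fun z : K => `|z| ^+ n : R) ->
  exists d A : R, [/\ 0 < d, 0 <= A & forall z, `|z| < d -> `|G z| <= A * `|z| ^+ n].
Proof.
move=> /eqO_exP[A [A0 hA]].
have : \forall z \near (0 : K), `|G z| <= A * `|(`|z| ^+ n : R)| by [].
move=> /nbhs_normP[d /= d0 hd]; exists d, A; split => //; first exact: ltW.
move=> z zd; have := hd z; rewrite /= sub0r normrN => /(_ zd).
by rewrite [X in A * X]ger0_norm// exprn_ge0.
Qed.

(** The determinant of a and b as vectors of the real plane. *)
Definition cdet (a b : K) : R := Re a * Im b - Im a * Re b.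

Lemma cdet_le a b : `|cdet a b| <= 2 * (`|a| * `|b|).
Proof.
apply: le_trans (ler_normB _ _) _; rewrite !normrM mulrDl mul1r.
by apply: lerD; rewrite ler_pM// ?Re_le_mod ?Im_le_mod.
Qed.

(** Cramer's formulas: a lower bound for the real linear map of columns a and b. *)
Lemma cdet_lower (a b w : K) :
  `|cdet a b| * `|w| <= 2 * (`|a| + `|b|) * `|rc (Re w) * a + rc (Im w) * b : K|.
Proof.
set T : K := _ + _.
have h1 : Re w * cdet a b = cdet T b.
  by rewrite /cdet /T !(ReD, ImD) !(ReM, ImM) !Rerc !Imrc; ring.
have h2 : Im w * cdet a b = cdet a T.
  by rewrite /cdet /T !(ReD, ImD) !(ReM, ImM) !Rerc !Imrc; ring.
apply: le_trans (ler_wpM2l _ (mod_le_ReIm w)) _; first by [].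
rewrite mulrDr ![`|cdet a b| * _]mulrC -!normrM h1 h2.
apply: le_trans (lerD (cdet_le _ _) (cdet_le _ _)) _.
by apply: le_of_eq; ring.
Qed.

Lemma cdet_near (a b a0 b0 : K) (e : R) : `|a - a0 : K| <= e -> `|b - b0 : K| <= e -> e <= 1 ->
  `|cdet a0 b0| - 2 * e * (`|a0| + `|b0| + 1) <= `|cdet a b|.
Proof.
move=> ha hb e1; have e0 : 0 <= e by apply: le_trans ha.
have -> : cdet a b = cdet a0 b0 + (cdet (a - a0) b + cdet a0 (b - b0)).
  by rewrite /cdet !(ReD, ImD, ReN, ImN); ring.
set x := cdet a0 b0; set y := _ + cdet a0 _.
have hy : `|y| <= 2 * e * (`|a0| + `|b0| + 1).
  apply: le_trans (ler_normD _ _) _.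
  apply: le_trans (lerD (cdet_le _ _) (cdet_le _ _)) _.
  have hb1 : `|b| <= `|b0| + 1.
    by rewrite -(subrK b0 b) addrC; apply: le_trans (ler_normD _ _) _; rewrite lerD2l (le_trans hb).
  have l1 : `|a - a0 : K| * `|b| <= e * (`|b0| + 1) by rewrite ler_pM.
  have l2 : `|a0| * `|b - b0 : K| <= `|a0| * e by rewrite ler_wpM2l.
  lra.
have := lerB_normD x y; lra.
Qed.

Variables (k : nat) (C : nat -> K) (G : K -> K) (S : set (Cplx2 R)) (r : R).
Hypothesis hk : (0 < k)%N.
Hypothesis hS : smooth_surface S.
Hypothesis hS0 : S (0, 0).
Hypothesis hr : 0 < r.
Hypothesis hG1 : Cclass 1 [set z : Cplx R | `|z| < r] G.
Hypothesis hGO : G =O_ (0 : Cplx R) (fun z : Cplx R => `|z| ^+ k.+1 : R).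
Hypothesis hSgraph : forall z w : Cplx R, `|z| < r -> (S (z, w) <-> w = Phi k C G z).

Definition polpart (z : K) : K := \sum_(0 <= j < k.+1) monom k C j z.
Definition dpolpart (v z : K) : K := \sum_(0 <= j < k.+1) dmonom k C j v z.

Lemma cder_polpart (f : R -> K) t d : cder f t d ->
  cder (fun s => polpart (f s)) t (dpolpart d (f t)).
Proof.
move=> fd; apply: (@cder_sum _ _ _ (fun j s => monom k C j (f s)) (fun j s => dmonom k C j d (f s))) => j.
exact: cder_monom.
Qed.

Lemma mod_polpart_le : exists2 A : R, 0 <= A & forall z, `|z| < 1 -> `|polpart z| <= A * `|z|.
Proof.
exists (\sum_(0 <= j < k.+1) `|C j|); first by apply: sumr_ge0.
move=> z z1; apply: le_trans (ler_norm_sum _ _ _) _; rewrite mulr_suml.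
rewrite big_nat_cond [leRHS]big_nat_cond; apply: ler_sum => j /andP[/andP[_ jk] _].
rewrite mod_monom// ler_wpM2l// -(prednK hk) exprS ler_piMr//.
by rewrite exprn_ile1// ltW.
Qed.

Lemma mod_dpolpart_le : exists2 A : R, 0 <= A & forall v z, `|z| < 1 -> `|v| <= 1 -> `|dpolpart v z| <= A.
Proof.
exists (\sum_(0 <= j < k.+1) `|C j| * k%:R); first by apply: sumr_ge0 => j _; rewrite mulr_ge0.
move=> v z z1 v1; apply: le_trans (ler_norm_sum _ _ _) _.
rewrite big_nat_cond [leRHS]big_nat_cond; apply: ler_sum => j /andP[/andP[_ jk] _].
apply: le_trans (mod_dmonom C v z (jk : (j <= k)%N)) _; rewrite ler_wpM2l// -mulrA ler_piMr//.
by rewrite -[leRHS]mulr1; apply: ler_pM; rewrite ?exprn_ge0// exprn_ile1// ltW.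
Qed.

(** On the graph of Phi, the function rho vanishes identically, and so does its derivative
    along the graph.  On the graph of the polynomial part P, the derivative of rho along the
    graph is O(|z|^k) by [gsmooth_vanish].  The two graphs are at distance |G| from each
    other, so the vertical component D rho (0, D_v G) is O(|z|^k) as well, and the vertical
    part of D rho is invertible near the origin. *)
Lemma gradient_bound_dir (v : K) : `|v| = 1 ->
  exists d B : R, [/\ 0 < d, 0 <= B & forall z, z != 0 -> `|z| < d -> `|'D_v G z| <= B * `|z| ^+ k].
Proof.
move=> v1.
have [U [rho [oU U00 rhoC surj zero]]] := hS hS0.
have U0 : nbhs ((0, 0) : Cplx2 R) U by exact: open_nbhs_nbhs.
have [hd1 hd2] := rhoC 1%N.
have [dG [A [dG0 A0 hA]]] := bigO_bound hGO.
have [AP AP0 hAP] := mod_polpart_le.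
have [AD AD0 hAD] := mod_dpolpart_le.
have Gd z : `|z| < r -> differentiable G z by case: hG1 => h _; exact: h.
have PhiE z : Phi k C G z = polpart z + G z by [].
have zn0 : `|(0 : K)| = 0 by exact: normr0.
have P00 : polpart 0 = 0.
  by apply/eqP; rewrite -normr_le0; have := hAP 0; rewrite zn0 mulr0; apply.
have G00 : G 0 = 0.
  by apply/eqP; rewrite -normr_le0; have := hA 0; rewrite zn0 expr0n /= mulr0; apply.
(* both graphs tend to the origin, where the local hypotheses apply *)
have small (e : R) : 0 < e -> exists2 d : R, 0 < d & forall z, `|z| < d ->
    [/\ `|z| < e, `|polpart z| < e & `|polpart z + G z : K| < e].
  move=> e0; pose d := Num.min (Num.min dG 1) (e / (AP + A + 1)).
  have AA : 0 < AP + A + 1 by rewrite ltr_wpDl// addr_ge0.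
  exists d; first by rewrite !lt_min dG0 ltr01 divr_gt0.
  move=> z; rewrite !lt_min => /andP[/andP[zG z1] ze].
  have ze' : `|z| * (AP + A + 1) < e by rewrite -ltr_pdivlMr.
  have zz := normr_ge0 z.
  have hP := hAP z z1; have hG := hA z zG.
  have zk : `|z| ^+ k.+1 <= `|z| by rewrite exprS ler_piMr// exprn_ile1// ltW.
  have hG2 : `|G z| <= A * `|z| by apply: le_trans hG _; rewrite ler_wpM2l.
  have n1 := ler_normD (polpart z : K) (G z).
  have zA : 0 <= A * `|z| by rewrite mulr_ge0.
  have zAP : 0 <= AP * `|z| by rewrite mulr_ge0.
  by split; lra.
have [dU dU0 hU] := nbhs_pair0 U0.
have graph0 : exists2 d : R, 0 < d & forall z, `|z| < d -> U (z, polpart z + G z) /\ rho (z, polpart z + G z) = 0.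
  have [d d0 hd] := small dU dU0.
  exists (Num.min d r); first by rewrite lt_min d0.
  move=> z; rewrite lt_min => /andP[zd zr]; have [h1 h2 h3] := hd z zd.
  have Uz : U (z, polpart z + G z) by exact: hU.
  by split => //; apply/(zero _ Uz)/hSgraph.
have [dg dg0 hg] := graph0.
(* rho vanishes along the graph, so its differential kills the tangent vectors *)
have tangent (u z : K) : `|z| < dg -> `|z| < r ->
    'd rho (z, polpart z + G z) (u, dpolpart u z + 'd G z u) = 0 :> K.
  move=> zd zr; have [Uz _] := hg z zd.
  have c1 := cder_affine z u 0.
  have z0E : z + rc 0 * u = z by rewrite rc0 mul0r addr0.
  have c2 := cder_polpart c1; rewrite z0E in c2.
  have c3 : cder (fun s => G (z + rc s * u)) 0 ('d G z u).
    have := @cder_chain R G (fun s => z + rc s * u) 0 u; rewrite z0E => h; apply: h => //; exact: Gd.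
  have c4 := cderD c2 c3.
  have := @cder_chain2 R rho (fun s => z + rc s * u) (fun s => polpart (z + rc s * u) + G (z + rc s * u)) 0 u (dpolpart u z + 'd G z u).
  rewrite z0E => /(_ (hd1 _ Uz) c1 c4) c5.
  have gap : 0 < (dg - `|z|) / (`|u| + 1) by rewrite divr_gt0 ?subr_gt0// ltr_wpDl.
  apply: cder_local0 gap _ c5 => s hs.
  apply: (hg _ _).2; apply: le_lt_trans (ler_normD _ _) _; rewrite modM mod_rc.
  have u1 : 0 < `|u| + 1 by rewrite ltr_wpDl.
  have : `|s| * (`|u| + 1) < dg - `|z| by rewrite -ltr_pdivlMr.
  have : `|s| * `|u| <= `|s| * (`|u| + 1) by rewrite ler_wpM2l// lerDl.
  lra.
(* D rho is onto and kills the tangent plane of a graph, so vertical vectors suffice to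
   reach every value: a and b, its values on the vertical basis, are independent *)
pose a p : K := 'D_(e01 R) rho p; pose b p : K := 'D_(e0i R) rho p.
have d00 : differentiable rho (0, 0) by exact: hd1.
have r0z : `|(0 : K)| < r by rewrite zn0.
have g0z : `|(0 : K)| < dg by rewrite zn0.
have vert c : exists w : K, rc (Re w) * a (0, 0) + rc (Im w) * b (0, 0) = c.
  have [[u w] huw] := surj c.
  have := tangent u 0 g0z r0z; rewrite P00 G00 addr0 => ht.
  exists (w - (dpolpart u 0 + 'd G 0 u)).
  rewrite -huw -[RHS]subr0 -[X in _ = _ - X]ht !diff_split//.
  rewrite -/(a (0, 0)) -/(b (0, 0)) !(ReD, ImD, ReN, ImN) !rcD !rcN !rcD.
  by ring.
have det0 : cdet (a (0, 0)) (b (0, 0)) != 0.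
  have [w1 h1] := vert 1; have [w2 h2] := vert 'i%C.
  have : cdet (1 : K) 'i%C = 1.
    by rewrite /cdet; have -> : Re (1 : K) = 1 by []; have -> : Im (1 : K) = 0 by []; rewrite Re_i Im_i; ring.
  rewrite -h1 -h2 => hdet; apply/eqP => e.
  have : cdet (rc (Re w1) * a (0, 0) + rc (Im w1) * b (0, 0))
              (rc (Re w2) * a (0, 0) + rc (Im w2) * b (0, 0)) =
     cdet w1 w2 * cdet (a (0, 0)) (b (0, 0)).
    by rewrite /cdet !(ReD, ImD) !(ReM, ImM) !Rerc !Imrc; ring.
  by rewrite hdet e mulr0 => /eqP; rewrite oner_eq0.
have ca := hd2 (e01 R) _ U00; have cb := hd2 (e0i R) _ U00.
have [da [Ba [da0 Ba0 hBa]]] := continuous_bounded ca.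
have [db [Bb [db0 Bb0 hBb]]] := continuous_bounded cb.
pose D0 := `|cdet (a (0, 0)) (b (0, 0))|.
have D00 : 0 < D0 by rewrite normr_gt0.
pose m := `|a (0, 0)| + `|b (0, 0)| + 1.
have m0 : 0 < m by rewrite ltr_wpDl// addr_ge0.
(* within ep of the origin values, the determinant is at least half of D0 *)
pose ep := Num.min 1 (D0 / (4 * m)).
have ep0 : 0 < ep by rewrite lt_min ltr01 divr_gt0// mulr_gt0.
have ep1 : ep <= 1 by rewrite ge_min lexx.
have epm : ep * (4 * m) <= D0 by rewrite -ler_pdivlMr ?mulr_gt0// ge_min lexx orbT.
have [dc dc0 hdc] := continuous_close ca ep0.
have [dd dd0 hdd] := continuous_close cb ep0.
(* these compare rho and its derivatives on the two graphs *)
have C1 u : Cclass 1 U (fun x => 'D_u rho x) by have [_] := rhoC 2%N; apply.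
have [l1 [L1 [l10 L10 hL1]]] := Cclass_lipschitz U0 (C1 ((v, 0) : Cplx2 R)).
have [l2 [L2 [l20 L20 hL2]]] := Cclass_lipschitz U0 (C1 (e01 R)).
have [l3 [L3 [l30 L30 hL3]]] := Cclass_lipschitz U0 (C1 (e0i R)).
have [l4 [L4 [l40 L40 hL4]]] := Cclass_lipschitz U0 (rhoC 1%N).
pose E := Num.min (Num.min (Num.min l1 l2) (Num.min l3 l4)) (Num.min (Num.min da db) (Num.min (Num.min dc dd) dU)).
have E0 : 0 < E by rewrite !lt_min l10 l20 l30 l40 da0 db0 dc0 dd0.
have [e e0 he] := small E E0.
(* P is a polynomial, so q is smooth, unlike rho along the graph of Phi *)
pose q z : K := rho (z, polpart z).
have sq : gsmooth v k.+1 q.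
  apply: (@gsmooth_comp R U U0 v polpart (dpolpart v)) => //.
  - move=> z; have := cder_polpart (cder_affine z v 0).
    by rewrite rc0 mul0r addr0.
  - move=> n; apply: gsmooth_sum => j; apply: gsmoothM; [exact: gsmooth_cst|exact: gsmooth_dzzb].
  - by move=> x x0; have [d d0 hd] := small x x0; exists d => // z /hd[].
pose E1 := Num.min e (Num.min dg (Num.min r (Num.min dG 1))).
have E10 : 0 < E1 by rewrite !lt_min e0 dg0 hr dG0 ltr01.
have hE1 (z : K) : `|z| < E1 -> [/\ `|z| < e, `|z| < dg, `|z| < r, `|z| < dG & `|z| < 1].
  by rewrite !lt_min => /andP[? /andP[? /andP[? /andP[? ?]]]].
have GE z : `|(polpart z + G z) - polpart z : K| = `|G z| by rewrite addrAC subrr add0r.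
have hq z : `|z| < E1 -> `|q z| <= (L4 * A) * `|z| ^+ k.+1.
  move=> /hE1[ze zg zr zG z1]; have [h1 h2 h3] := he z ze.
  have [_ hz] := hg z zg.
  move: h1 h2 h3; rewrite !lt_min => /andP[/andP[_ /andP[_ k1]] _] /andP[/andP[_ /andP[_ k2]] _] /andP[/andP[_ /andP[_ k3]] _].
  have := hL4 z _ _ k1 k3 k2; rewrite hz sub0r normrN GE => /le_trans; apply.
  by rewrite -mulrA ler_wpM2l// hA.
have hq' z : `|z| < E1 -> cder (fun s => q (z + rc s * v)) 0 ('d rho (z, polpart z) (v, dpolpart v z)).
  move=> /hE1[ze zg zr zG z1]; have [h1 h2 h3] := he z ze.
  have c1 := cder_affine z v 0.
  have z0E : z + rc 0 * v = z by rewrite rc0 mul0r addr0.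
  have c2 := cder_polpart c1; rewrite z0E in c2.
  have := @cder_chain2 R rho (fun s => z + rc s * v) (fun s => polpart (z + rc s * v)) 0 v (dpolpart v z).
  rewrite z0E; apply => //; apply: hd1; apply: hU.
    by move: h1; rewrite !lt_min => /andP[_ /andP[_ /andP[_ ?]]].
  by move: h2; rewrite !lt_min => /andP[_ /andP[_ /andP[_ ?]]].
have [d3 [B3 [d30 B30 hB3]]] := gsmooth_vanish sq (hk : (1 < k.+1)%N) v1 E10 hq hq'.
pose B := 4 * (Ba + Bb) / D0 * (B3 + (L1 + AD * (L2 + L3)) * A).
exists (Num.min d3 E1), B; split.
- by rewrite lt_min d30.
- have Q0 : 0 <= B3 + (L1 + AD * (L2 + L3)) * A.
    by rewrite addr_ge0// mulr_ge0// addr_ge0// mulr_ge0// addr_ge0.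
  by rewrite mulr_ge0// divr_ge0 ?(ltW D00)// mulr_ge0// addr_ge0.
move=> z z0; rewrite lt_min => /andP[zd3 zE1].
have [ze zg zr zG z1] := hE1 z zE1; have [h1 h2 h3] := he z ze.
have {}hB3 := hB3 z z0 zd3.
have ht := tangent v z zg zr.
have [Uz _] := hg z zg.
move: h1 h2 h3; rewrite !lt_min.
move=> /andP[/andP[/andP[z11 z12] /andP[z13 z14]] /andP[/andP[za zb] /andP[/andP[zc zd] zU]]].
move=> /andP[/andP[/andP[y11 y12] /andP[y13 y14]] /andP[/andP[ya yb] /andP[/andP[yc yd] yU]]].
move=> /andP[/andP[/andP[x11 x12] /andP[x13 x14]] /andP[/andP[xa xb] /andP[/andP[xc xd] xU]]].
set p1 := (z, polpart z + G z) in ht Uz; set p0 := (z, polpart z) in hB3.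
have dp1 : differentiable rho p1 by exact: hd1.
have dp0 : differentiable rho p0 by apply: hd1; exact: hU.
rewrite deriveE; last exact: Gd.
set g := 'd G z v in ht *.
pose T : K := rc (Re g) * a p1 + rc (Im g) * b p1.
(* the tangency relation at p1, solved for the part that contains DG *)
have TE : T = - (('D_((v, 0) : Cplx2 R) rho p1 - 'D_((v, 0) : Cplx2 R) rho p0) +
    (rc (Re (dpolpart v z)) * (a p1 - a p0) + rc (Im (dpolpart v z)) * (b p1 - b p0)) +
    'd rho p0 (v, dpolpart v z)) :> K.
  rewrite diff_split//; apply/eqP; rewrite -addr_eq0; apply/eqP; rewrite -[RHS]ht diff_split//.
  rewrite /T !ReD !ImD !rcD /a /b; ring.
have hGz : `|G z| <= A * `|z| ^+ k.
  by apply: le_trans (hA z zG) _; rewrite ler_wpM2l// exprS ler_piMl ?exprn_ge0// ltW.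
have hv : `|dpolpart v z| <= AD by apply: hAD; rewrite ?v1.
have t1 : `|'D_((v, 0) : Cplx2 R) rho p1 - 'D_((v, 0) : Cplx2 R) rho p0 : K| <= L1 * `|G z|.
  by rewrite -GE; exact: hL1.
have t2 : `|a p1 - a p0 : K| <= L2 * `|G z| by rewrite -GE; exact: hL2.
have t3 : `|b p1 - b p0 : K| <= L3 * `|G z| by rewrite -GE; exact: hL3.
have TB : `|T| <= (B3 + (L1 + AD * (L2 + L3)) * A) * `|z| ^+ k.
  rewrite TE normrN; apply: le_trans (ler_normD _ _) _; rewrite addrC mulrDl; apply: lerD => //.
  apply: le_trans (_ : (L1 + AD * (L2 + L3)) * `|G z| <= _); last first.
    rewrite -[leRHS]mulrA; apply: ler_wpM2l; last exact: hGz.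
    by apply: addr_ge0 => //; apply: mulr_ge0 => //; exact: addr_ge0.
  apply: le_trans (ler_normD _ _) _; rewrite mulrDl; apply: lerD => //.
  apply: le_trans (ler_normD _ _) _; rewrite !modM !mod_rc.
  rewrite -mulrA mulrDl mulrDr; apply: lerD; apply: ler_pM => //.
    exact: le_trans (Re_le_mod _) hv.
  exact: le_trans (Im_le_mod _) hv.
have la : `|a p1 - a (0, 0) : K| <= ep by rewrite ltW// hdc.
have lb : `|b p1 - b (0, 0) : K| <= ep by rewrite ltW// hdd.
have hdet := cdet_near la lb ep1.
have hdet2 : D0 / 2 <= `|cdet (a p1) (b p1)|.
  apply: le_trans hdet; rewrite -/D0 -/m; lra.
have hlow := cdet_lower (a p1) (b p1) g.
rewrite -/T in hlow.
have nab : `|a p1| + `|b p1| <= Ba + Bb by apply: lerD; [exact: hBa|exact: hBb].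
have h4 : D0 / 2 * `|g| <= 2 * (Ba + Bb) * ((B3 + (L1 + AD * (L2 + L3)) * A) * `|z| ^+ k).
  apply: le_trans (_ : `|cdet (a p1) (b p1)| * `|g| <= _); first by rewrite ler_wpM2r.
  apply: le_trans hlow _; apply: ler_pM; rewrite ?mulr_ge0 ?addr_ge0//.
  by rewrite ler_wpM2l.
rewrite -(ler_pM2l (_ : 0 < D0 / 2)) ?divr_gt0//.
apply: le_trans h4 _; rewrite /B; apply: le_of_eq; field.
by rewrite gt_eqF.
Qed.

End GradientBound.

(** * Homogeneity of tau *)

Section TauBounds.
Variable R : realType.
Local Notation K := (Cplx R).
Variables (k M : nat) (C : nat -> K).
Hypothesis k0 : (0 < k)%N.
Hypothesis Mk : (M <= k)%N.
Hypothesis CM : C M != 0.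

Local Notation mon := (monom k C M).
Local Notation dmon := (dmonom k C M).

Definition rest (z : K) : K := Sigma k C z - mon z.
Definition drest (v z : K) : K := \sum_(1 <= j < k.+1) dmonom k C j v z - dmon v z.
Definition dtau (v z : K) : K := drest v z * (mon z)^-1 + rest z * (- dmon v z / mon z ^+ 2).

Lemma tauE z : tau k C M z = rest z * (mon z)^-1. Proof. by []. Qed.

Lemma mon_neq0 z : z != 0 -> mon z != 0.
Proof.
move=> z0; rewrite -normr_eq0 mod_monom// mulf_neq0 ?normr_eq0//.
by rewrite expf_neq0// normr_eq0.
Qed.

Lemma cder_rest (f : R -> K) t d : cder f t d -> cder (fun s => rest (f s)) t (drest d (f t)).
Proof.
move=> fd; apply: cderB; last exact: cder_monom.
apply: (@cder_sum _ _ _ (fun j s => monom k C j (f s)) (fun j s => dmonom k C j d (f s))) => j.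
exact: cder_monom.
Qed.

Lemma cder_tau (f : R -> K) t d : f t != 0 -> cder f t d ->
  cder (fun s => tau k C M (f s)) t (dtau d (f t)).
Proof.
move=> f0 fd; apply: (cderM (cder_rest fd)).
by apply: cderV; [exact: mon_neq0|exact: cder_monom].
Qed.

Lemma monom_scale j (x : R) z : (j <= k)%N -> monom k C j (rc x * z) = rc (x ^+ k) * monom k C j z.
Proof.
move=> jk; rewrite !monomE /zzb conjM conj_rc !exprMn -{3}(subnK jk) rcX exprD; ring.
Qed.

(** tau is homogeneous of degree 0, so its supremum on the circle is its supremum on the
    punctured plane. *)
Lemma tau_scale (x : R) z : x != 0 -> tau k C M (rc x * z) = tau k C M z.
Proof.
move=> x0; have xk : rc (x ^+ k) != 0 by rewrite rc_eq0 expf_neq0.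
rewrite !tauE /rest.
have -> : Sigma k C (rc x * z) = rc (x ^+ k) * Sigma k C z.
  rewrite /Sigma mulr_sumr !big_nat; apply: eq_bigr => j /andP[_ jk].
  by rewrite monom_scale.
rewrite monom_scale// -mulrBr invfM mulrACA divff// mul1r //.
Qed.

Lemma dzzb_lin m n (v z : K) : dzzb m n v z = rc (Re v) * dzzb m n 1 z + rc (Im v) * dzzb m n 'i%C z.
Proof.
rewrite /dzzb.
have c1 : (conjc (1 : K) : K) = 1 by rewrite -rc1 conj_rc.
have ci : (conjc ('i%C : K) : K) = - 'i%C by apply: cplx_eqP; rewrite ?(Reconj, Imconj, ReN, ImN) ?oppr0 ?Re_i ?oppr0.
have cv : (conjc v : K) = rc (Re v) - 'i%C * rc (Im v).
  by apply: cplx_eqP; rewrite ?Reconj ?Imconj !(ReD, ImD, ReN, ImN) !(ReM, ImM) !(Re_i, Im_i) !Rerc !Imrc; ring.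
rewrite c1 ci cv {1}(cplxE v); ring.
Qed.

Lemma dmonom_lin j v z : dmonom k C j v z = rc (Re v) * dmonom k C j 1 z + rc (Im v) * dmonom k C j 'i%C z.
Proof. rewrite /dmonom dzzb_lin; ring. Qed.

Lemma drest_lin v z : drest v z = rc (Re v) * drest 1 z + rc (Im v) * drest 'i%C z.
Proof.
rewrite /drest (dmonom_lin _ v); under eq_bigr do rewrite dmonom_lin.
by rewrite big_split /= -!mulr_sumr; ring.
Qed.

Lemma dtau_lin v z : dtau v z = rc (Re v) * dtau 1 z + rc (Im v) * dtau 'i%C z.
Proof. by rewrite /dtau drest_lin (dmonom_lin _ v); ring. Qed.

Lemma derive_tau v z : z != 0 -> 'D_v (tau k C M) z = dtau v z.
Proof.
move=> z0; have zE : z + rc 0 * v = z by rewrite rc0 mul0r addr0.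
have := @cder_tau (fun s => z + rc s * v) 0 v; rewrite zE => h.
by have [_ ->] := is_derive_of_cder (h z0 (cder_affine z v 0)).
Qed.

(** This turns the bound on the two Wirtinger derivatives into a bound on the derivative in
    every direction. *)
Lemma wirtinger v z : z != 0 ->
  dtau v z = dz (tau k C M) z * v + dzbar (tau k C M) z * (conjc v : K).
Proof.
move=> z0; rewrite /dz /dzbar !derive_tau// dtau_lin.
have cv : (conjc v : K) = rc (Re v) - 'i%C * rc (Im v).
  by apply: cplx_eqP; rewrite ?Reconj ?Imconj !(ReD, ImD, ReN, ImN) !(ReM, ImM) !(Re_i, Im_i) !Rerc !Imrc; ring.
have ii : ('i%C : K) * 'i%C = -1 by apply: cplx_eqP; rewrite ?(ReM, ImM) ?Re_i ?Im_i ?(ReN, ImN) /=; ring.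
have n2 : (2%:R : K) != 0 by rewrite -rcn rc_eq0 pnatr_eq0.
rewrite cv [in X in _ = X + _](cplxE v).
set a := dtau 1 z; set b := dtau 'i%C z; set x := rc (Re v); set y := rc (Im v).
have -> : (a - 'i%C * b) / 2%:R * (x + 'i%C * y) + (a + 'i%C * b) / 2%:R * (x - 'i%C * y)
   = a * x - ('i%C * 'i%C) * (b * y) :> K by field.
by rewrite ii; ring.
Qed.

Lemma mod_dtau_nabla v z : z != 0 -> `|dtau v z| <= norm_nabla (tau k C M) z * `|v|.
Proof.
move=> z0; rewrite wirtinger// /norm_nabla mulrDl; apply: le_trans (ler_normD _ _) _.
by rewrite !modM mod_conj.
Qed.

Lemma rest_bound : exists2 A : R, 0 <= A & forall z v, `|z| = 1 -> `|rest z| <= A /\ `|drest v z| <= A * `|v|.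
Proof.
exists (\sum_(1 <= j < k.+1) (`|C j| * k%:R) + `|C M| * k%:R).
  by apply: addr_ge0; [apply: sumr_ge0 => j _|]; rewrite mulr_ge0.
have k1 : 1 <= k%:R :> R by rewrite ler1n.
move=> z v z1; split.
  apply: le_trans (ler_normB _ _) _; apply: lerD; last by rewrite mod_monom// z1 expr1n mulr1 ler_peMr.
  apply: le_trans (ler_norm_sum _ _ _) _.
  rewrite big_nat_cond [leRHS]big_nat_cond; apply: ler_sum => j /andP[/andP[_ jk] _].
  by rewrite mod_monom// z1 expr1n mulr1 ler_peMr.
have dm j : (j <= k)%N -> `|dmonom k C j v z| <= `|C j| * k%:R * `|v|.
  by move=> jk; apply: le_trans (mod_dmonom C v z jk) _; rewrite z1 expr1n mulr1 mulrA.
apply: le_trans (ler_normB _ _) _; rewrite mulrDl; apply: lerD; last exact: dm.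
apply: le_trans (ler_norm_sum _ _ _) _; rewrite mulr_suml.
rewrite big_nat_cond [leRHS]big_nat_cond; apply: ler_sum => j /andP[/andP[_ jk] _].
exact: dm.
Qed.

Lemma circle_neq0 (z : K) : `|z| = 1 -> z != 0.
Proof. by move=> z1; rewrite -normr_eq0 z1 oner_neq0. Qed.

(** Without a bound on the circle, the supremum would be a default value. *)
Lemma tau_circle_bound : exists B : R, forall z v, `|z| = 1 ->
  `|tau k C M z| <= B /\ `|dtau v z| <= B * `|v|.
Proof.
have [A A0 hA] := rest_bound.
have m0 : 0 < `|C M| by rewrite normr_gt0.
pose m := `|C M|; have k0' : 0 <= k%:R :> R by [].
exists (A / m + A * k%:R / m) => z v z1; have [h1 h2] := hA z v z1.
have mE : `|mon z| = m by rewrite mod_monom// z1 expr1n mulr1.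
have q1 : 0 <= A / m by rewrite divr_ge0 ?(ltW m0).
have q2 : 0 <= A * k%:R / m by rewrite divr_ge0 ?(ltW m0)// mulr_ge0.
split.
  rewrite tauE modM modV mE; apply: le_trans (_ : A / m <= _); last by rewrite lerDl.
  by rewrite ler_wpM2r// invr_ge0 ltW.
apply: le_trans (ler_normD _ _) _; rewrite !modM normrN !modV modX mE mulrDl; apply: lerD.
  by rewrite mulrAC ler_wpM2r// invr_ge0 ltW.
have hd : `|dmon v z| <= m * k%:R * `|v|.
  by apply: le_trans (mod_dmonom C v z Mk) _; rewrite z1 expr1n mulr1 mulrA.
apply: le_trans (_ : A * (m * k%:R * `|v| / m ^+ 2) <= _).
  apply: ler_pM => //; first by rewrite divr_ge0 ?exprn_ge0// ltW.
  by rewrite ler_wpM2r// invr_ge0 exprn_ge0// ltW.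
by apply: le_of_eq; field; rewrite gt_eqF.
Qed.

Lemma tau_le_sup z : z != 0 -> `|tau k C M z| <= sup_tau k C M.
Proof.
move=> z0; have zp : 0 < `|z| by rewrite normr_gt0.
have -> : tau k C M z = tau k C M (rc `|z|^-1 * z) by rewrite tau_scale// invr_neq0// gt_eqF.
have z1 : `|(rc `|z|^-1 * z : K)| = 1.
  by rewrite modM mod_rc ger0_norm ?invr_ge0// mulVf// gt_eqF.
have [B hB] := tau_circle_bound.
apply: ub_le_sup; last by exists (rc `|z|^-1 * z).
by exists B => _ [x x1 <-]; case: (hB x 0 x1).
Qed.

(** The derivative of tau is homogeneous of degree -1. *)
Lemma dtau_le_sup v z : z != 0 -> `|dtau v z| <= sup_nabla_tau k C M * (`|v| / `|z|).
Proof.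
move=> z0; have zp : 0 < `|z| by rewrite normr_gt0.
pose l := `|z|^-1; have l0 : 0 < l by rewrite invr_gt0.
have z1 : `|(rc l * z : K)| = 1.
  by rewrite modM mod_rc ger0_norm ?invr_ge0// mulVf// gt_eqF.
have e : dtau v z = dtau (rc l * v) (rc l * z).
  have zE : z + rc 0 * v = z by rewrite rc0 mul0r addr0.
  have zE' : rc l * z + rc 0 * (rc l * v) = rc l * z by rewrite rc0 mul0r addr0.
  have := @cder_tau (fun s => z + rc s * v) 0 v; rewrite zE => /(_ z0 (cder_affine z v 0)) h1.
  have := @cder_tau (fun s => rc l * z + rc s * (rc l * v)) 0 (rc l * v); rewrite zE' => h2.
  have {}h2 := h2 (circle_neq0 z1) (cder_affine _ _ 0).
  apply: cder_unique h1 _; apply: cder_eq h2 => // s.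
  rewrite -(tau_scale (z + rc s * v) (_ : l != 0)) ?gt_eqF//; congr tau.
  by ring.
rewrite e; apply: le_trans (mod_dtau_nabla _ (circle_neq0 z1)) _.
rewrite modM mod_rc (gtr0_norm l0) [l * _]mulrC ler_wpM2r ?mulr_ge0 ?(ltW l0)//.
have [B hB] := tau_circle_bound.
apply: ub_le_sup; last by exists (rc l * z) => //; rewrite z1 mul1r.
exists (2 * B) => _ [x x1 <-]; rewrite x1 mul1r.
have [_ b1] := hB x 1 x1; have [_ bi] := hB x 'i%C x1.
rewrite mod1 mulr1 in b1; rewrite mod_i mulr1 in bi.
have x0 := circle_neq0 x1.
rewrite /norm_nabla /dz /dzbar !derive_tau// !modM modV.
have -> : `|(2 : K)| = 2 by rewrite -rcn mod_rc ger0_norm.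
have n1 := ler_normB (dtau 1 x : K) ('i%C * dtau 'i%C x).
have n2 := ler_normD (dtau 1 x : K) ('i%C * dtau 'i%C x).
rewrite modM mod_i mul1r in n1; rewrite modM mod_i mul1r in n2.
lra.
Qed.

Lemma sup_tau_ge0 : 0 <= sup_tau k C M.
Proof. by apply: le_trans (tau_le_sup (oner_neq0 K)). Qed.

Lemma sup_nabla_ge0 : 0 <= sup_nabla_tau k C M.
Proof. by have := dtau_le_sup 1 (oner_neq0 K); rewrite !mod1 divr1 mulr1; apply: le_trans. Qed.

End TauBounds.


(** * A strongly monotone branch of the root *)

(** The disc of radius s about 1 subtends at the origin a cone whose half-angle has
    cosine sqrt(1 - s^2), which is at least 1 - s. *)
Lemma mod_le_Re_near1 (R : realType) (w : Cplx R) (s : R) : 0 <= s -> s < 1 ->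
  `|w - 1 : Cplx R| <= s -> (1 - s) * `|w| <= Re w.
Proof.
move=> s0 s1 h.
have h2 : `|w - 1 : Cplx R| ^+ 2 <= s ^+ 2 by rewrite lerXn2r ?nnegrE.
rewrite (sqr_modulus (w - 1)) !(ReD, ImD, ReN, ImN) in h2.
move: h2; have := sqr_modulus w.
have -> : Re (1 : Cplx R) = 1 by []; have -> : Im (1 : Cplx R) = 0 by [].
move: (`|w|) (Re w) (Im w) => r x y e h2.
have q1 := sqr_ge0 (r - (1 - s)).
have q2 : 0 <= s * (1 - s) by rewrite mulr_ge0// subr_ge0 ltW.
nra.
Qed.

Section RootFunction.
Variable R : realType.
Local Notation K := (Cplx R).
Variables (k M : nat) (C : nat -> K) (G : K -> K).
Hypothesis k0 : (0 < k)%N.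
Hypothesis Mk : (M <= k)%N.
Hypothesis kM : (k < 2 * M)%N.
Hypothesis CM : C M != 0.
Variables (d s n : R).
Hypothesis d0 : 0 < d.
Hypothesis Gd : forall z, `|z| < d -> differentiable G z.
Hypothesis s0 : 0 <= s.
Hypothesis s1 : s < 1.
Hypothesis n0 : 0 <= n.

Local Notation mon := (monom k C M).
Local Notation dmon := (dmonom k C M).
Let M0 : (0 < M)%N. Proof. by lia. Qed.

(** The quotient of Phi - C_0 z^k by its monomial of index M.  At the origin the quotients
    are 0, so the value there is 1. *)
Definition wfun (z : K) : K := 1 + tau k C M z + G z / mon z.
Definition dwfun (v z : K) : K :=
  dtau k M C v z + ('d G z v * (mon z)^-1 + G z * (- dmon v z / mon z ^+ 2)).

Hypothesis w1 : forall z, `|z| < d -> `|wfun z - 1 : K| <= s.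
Hypothesis dw : forall z v, z != 0 -> `|z| < d -> `|z| * `|dwfun v z| <= n * `|v|.
Hypothesis margin : n < M%:R * (1 - s) ^+ 2.

Definition rootf (z : K) : K := (conjc z : K) * pw (M%:R^-1) (wfun z).
Definition drootf (v z : K) : K :=
  (conjc v : K) * pw (M%:R^-1) (wfun z) +
  (conjc z : K) * (rc (M%:R^-1) * pw (M%:R^-1) (wfun z) * (dwfun v z / wfun z)).

Let b : R := M%:R^-1.
Let Mp : 0 < M%:R :> R. Proof. by rewrite ltr0n. Qed.
Let b01 : 0 <= b <= 1.
Proof. by rewrite invr_ge0 ltW//= -[leRHS]invr1 lef_pV2 ?posrE// ler1n. Qed.
Let b0 : 0 < b. Proof. by rewrite invr_gt0. Qed.

Let s1' : 0 < 1 - s. Proof. by rewrite subr_gt0. Qed.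

(** A lower bound for Re (v Df(v)) / |v|^2 with f = [rootf]: the main term Re Y is at
    least |Y| (1 - s) with Y = W^(1/M), the correction is at most |Y| n / (M (1 - s)), and
    |Y| >= 1 - s. *)
Definition kappa : R := (1 - s) ^+ 2 - n / M%:R.

Lemma kappa_gt0 : 0 < kappa.
Proof. by rewrite subr_gt0 ltr_pdivrMr// mulrC. Qed.

Lemma Re_wfun z : `|z| < d -> 1 - s <= Re (wfun z).
Proof.
move=> /w1 h; have := le_trans (Re_le_mod (wfun z - 1)) h; rewrite ler_norml ReD ReN.
have -> : Re (1 : K) = 1 by [].
by move=> /andP[]; lra.
Qed.

Lemma Re_wfun_gt0 z : `|z| < d -> 0 < Re (wfun z).
Proof. by move=> /Re_wfun; apply: lt_le_trans. Qed.

Lemma mod_wfun_ge z : `|z| < d -> 1 - s <= `|wfun z|.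
Proof. by move=> /Re_wfun /le_trans; apply; apply: le_trans (ler_norm _) (Re_le_mod _). Qed.

Lemma mod_wfun_le z : `|z| < d -> `|wfun z| <= 2.
Proof.
move=> /w1 h; rewrite -(subrK (1 : K) (wfun z)); apply: le_trans (ler_normD _ _) _.
by rewrite mod1 -[leRHS]/(1 + 1); apply: lerD => //; apply: le_trans h (ltW s1).
Qed.

Lemma Re_wfun_ratio z : `|z| < d -> 1 - s <= Re (wfun z) / `|wfun z|.
Proof.
move=> zd; have wp : 0 < `|wfun z| := lt_le_trans s1' (mod_wfun_ge zd).
by rewrite ler_pdivlMr//; exact: mod_le_Re_near1 s0 s1 (w1 zd).
Qed.

Let Y z : K := pw b (wfun z).

Lemma mod_Y_ge z : `|z| < d -> 1 - s <= `|Y z|.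
Proof.
move=> zd; have h := mod_wfun_ge zd; have wp : 0 < `|wfun z| := lt_le_trans s1' h.
rewrite mod_pw -[leLHS](@lnK R) ?posrE// ler_expR.
have l1 : ln (1 - s) <= 0 by rewrite ln_le0// gerBl.
have /andP[b0' b1] := b01.
apply: le_trans (_ : b * ln (1 - s) <= _); first by move: (ln _) l1 => x; nra.
by rewrite ler_wpM2l// ler_ln ?posrE.
Qed.

Lemma mod_Y_le z : `|z| < d -> `|Y z| <= 2.
Proof.
move=> zd; have h := mod_wfun_ge zd; have wp : 0 < `|wfun z| := lt_le_trans s1' h.
have /andP[b0' b1] := b01.
rewrite mod_pw -[leRHS](@lnK R) ?posrE// ler_expR.
have l2 : 0 <= ln (2 : R) by rewrite ln_ge0// ler1n.
apply: le_trans (_ : b * ln 2 <= _); last by rewrite ler_piMl.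
by rewrite ler_wpM2l// ler_ln ?posrE// mod_wfun_le.
Qed.

Lemma Re_Y_ge z : `|z| < d -> `|Y z| * (1 - s) <= Re (Y z).
Proof.
move=> zd; apply: le_trans (Re_pw_ge b01 (Re_wfun_gt0 zd)).
by rewrite ler_wpM2l// Re_wfun_ratio.
Qed.

Lemma kappa_le_ReY z : `|z| < d -> kappa <= Re (Y z).
Proof.
move=> zd; apply: le_trans (Re_Y_ge zd); have := mod_Y_ge zd => h.
apply: le_trans (_ : (1 - s) ^+ 2 <= _); first by rewrite /kappa gerBl divr_ge0// ltW.
by rewrite expr2 ler_wpM2r// ltW.
Qed.

Lemma cder_wfun v z : z != 0 -> `|z| < d -> forall (f : R -> K) t,
  f t = z -> cder f t v -> cder (fun x => wfun (f x)) t (dwfun v z).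
Proof.
move=> z0 zd f t ft fd.
have mz : mon (f t) != 0 by rewrite ft; exact: mon_neq0.
have fz : f t != 0 by rewrite ft.
have h1 := cder_tau Mk CM fz fd.
have h2 : cder (fun x => G (f x)) t ('d G (f t) v) by apply: cder_chain => //; rewrite ft; exact: Gd.
have h3 := cderM h2 (cderV mz (@cder_monom R k C M f t v fd)).
have h4 := cderD (cderD (cderc 1 t) h1) h3.
by apply: cder_eq h4 => //; rewrite ft add0r.
Qed.

Lemma cder_rootf v z : z != 0 -> `|z| < d -> forall (f : R -> K) t,
  f t = z -> cder f t v -> cder (fun x => rootf (f x)) t (drootf v z).
Proof.
move=> z0 zd f t ft fd.
have hw := cder_wfun z0 zd ft fd.
have re : 0 < Re (wfun (f t)) by rewrite ft; exact: Re_wfun_gt0.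
have := cderM (cder_conj fd) (cder_pw b hw re).
by rewrite ft.
Qed.

Lemma mod_corr (v z : K) : z != 0 -> `|z| < d ->
  `|(conjc z : K) * (rc b * Y z * (dwfun v z / wfun z)) : K| <= `|Y z| * (n / M%:R / (1 - s) * `|v|).
Proof.
move=> z0 zd; rewrite !modM mod_conj mod_rc (gtr0_norm b0) modV.
have h := mod_wfun_ge zd; have wp : 0 < `|wfun z| := lt_le_trans s1' h.
have -> : `|z| * (b * `|Y z| * (`|dwfun v z| / `|wfun z|)) =
   `|Y z| * (b * (`|z| * `|dwfun v z|) / `|wfun z|) by field; rewrite gt_eqF.
rewrite ler_wpM2l//.
have -> : n / M%:R / (1 - s) * `|v| = b * (n * `|v|) / (1 - s) by rewrite /b; field; rewrite !gt_eqF.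
apply: ler_pM; rewrite ?invr_ge0 ?mulr_ge0 ?(ltW b0)//.
  by rewrite ler_wpM2l ?(ltW b0)// dw.
by rewrite lef_pV2 ?posrE.
Qed.

(** The factor |W^(1/M)| is common to the main term, by [Re_Y_ge], and to the correction, by
    [mod_corr]; what is left is kappa / (1 - s). *)
Lemma Re_drootf (v z : K) : z != 0 -> `|z| < d -> kappa * `|v| ^+ 2 <= Re (v * drootf v z : K).
Proof.
move=> z0 zd; rewrite /drootf -/b -/(Y z) mulrDr mulrA mulzJ ReD ReM Rerc Imrc mul0r subr0.
set E : K := (conjc z : K) * _.
have hE : `|E| <= `|Y z| * (n / M%:R / (1 - s) * `|v|) by exact: mod_corr.
have h1 : - (`|v| * (`|Y z| * (n / M%:R / (1 - s) * `|v|))) <= Re (v * E : K).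
  have := Re_le_mod (v * E : K); rewrite modM ler_norml => /andP[h _].
  by apply: le_trans h; rewrite lerN2 ler_wpM2l.
have h2 := Re_Y_ge zd; have h3 := mod_Y_ge zd.
have v2 : 0 <= `|v| ^+ 2 by rewrite exprn_ge0.
have h4 := ler_wpM2l v2 h2.
apply: le_trans (lerD h4 h1).
have q0 : 0 <= (1 - s) - n / M%:R / (1 - s).
  by rewrite subr_ge0 ler_pdivrMr// -expr2 -subr_ge0 ltW// kappa_gt0.
have -> : `|v| ^+ 2 * (`|Y z| * (1 - s)) - `|v| * (`|Y z| * (n / M%:R / (1 - s) * `|v|)) =
  `|Y z| * ((1 - s) - n / M%:R / (1 - s)) * `|v| ^+ 2 by ring.
rewrite ler_wpM2r//.
have -> : kappa = (1 - s) * ((1 - s) - n / M%:R / (1 - s)) by rewrite /kappa; field; rewrite !gt_eqF.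
by rewrite ler_wpM2r.
Qed.

Definition rlip : R := 4 * (1 + n / M%:R / (1 - s)).

Lemma q_ge0 : 0 <= n / M%:R / (1 - s).
Proof. by rewrite !divr_ge0// ltW. Qed.

Lemma mod_drootf (v z : K) : z != 0 -> `|z| < d -> `|drootf v z| <= rlip / 2 * `|v|.
Proof.
move=> z0 zd; apply: le_trans (ler_normD _ _) _; rewrite modM mod_conj.
have h1 := mod_Y_le zd; have h2 := mod_corr v z0 zd.
have h3 : `|v| * `|Y z| <= `|v| * 2 by rewrite ler_wpM2l.
have h4 : `|Y z| * (n / M%:R / (1 - s) * `|v|) <= 2 * (n / M%:R / (1 - s) * `|v|).
  by rewrite ler_wpM2r// mulr_ge0// q_ge0.
apply: le_trans (lerD h3 (le_trans h2 h4)) _.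
by rewrite /rlip; apply: le_of_eq; field; rewrite !gt_eqF.
Qed.

Lemma mod_rootf z : `|z| < d -> `|rootf z| <= 2 * `|z|.
Proof. by move=> zd; rewrite modM mod_conj mulrC ler_wpM2r// mod_Y_le. Qed.

(** f need not be differentiable at the origin.  If the segment from c to z avoids it, the
    mean value theorem applies.  Otherwise z and -c are nonnegative multiples of z - c, and
    both estimates can be read on f(z) = zbar W^(1/M) and f(c) separately. *)
Lemma rootf_estimates z c : `|z| < d -> `|c| < d ->
  `|rootf z - rootf c : K| <= rlip * `|z - c : K| /\
  kappa * `|z - c : K| ^+ 2 <= Re ((z - c) * (rootf z - rootf c) : K).
Proof.
move=> zd cd.
have [[t [t01 ct]]|nt] := pselect (exists t, 0 <= t <= 1 /\ c + rc t * (z - c) = 0).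
  set v := z - c in ct *.
  have /andP[t0 t1] := t01; have t1' : 0 <= 1 - t by rewrite subr_ge0.
  have cE : c = - (rc t * v) by apply/eqP; rewrite -addr_eq0 ct.
  have zE : z = rc (1 - t) * v by rewrite -(subrK c z) -/v {1}cE rcD rcN rc1; ring.
  split.
    apply: le_trans (ler_normB _ _) _.
    apply: le_trans (lerD (mod_rootf zd) (mod_rootf cd)) _.
    rewrite {1}zE {1}cE normrN !modM !mod_rc (ger0_norm t0) (ger0_norm t1').
    have -> : 2 * ((1 - t) * `|v|) + 2 * (t * `|v|) = 2 * `|v| by ring.
    by rewrite ler_wpM2r// /rlip; have := q_ge0; lra.
  have part (x : R) (u : K) : 0 <= x -> `|u| < d -> (conjc u : K) = rc x * (conjc v : K) ->
      x * (kappa * `|v| ^+ 2) <= Re (v * rootf u : K).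
    move=> x0 ud ux; rewrite /rootf -/b -/(Y u) ux.
    have -> : v * (rc x * (conjc v : K) * Y u) = rc (x * `|v| ^+ 2) * Y u.
      by rewrite rcM -mulzJ; ring.
    rewrite ReM Rerc Imrc mul0r subr0 -mulrA ler_wpM2l// mulrC ler_wpM2l ?exprn_ge0//.
    exact: kappa_le_ReY.
  have p1 : (1 - t) * (kappa * `|v| ^+ 2) <= Re (v * rootf z : K).
    by apply: part => //; rewrite {1}zE conjM conj_rc.
  have p2 : t * (kappa * `|v| ^+ 2) <= Re (v * - rootf c : K).
    have nu : `|- c : K| < d by rewrite normrN.
    have -> : v * - rootf c = rc (t * `|v| ^+ 2) * Y c.
      rewrite /rootf -/b -/(Y c) {1}cE.
      have -> : (conjc (- (rc t * v) : K) : K) = - (rc t * (conjc v : K)).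
        by rewrite -mulN1r conjM conjM conj_rc -rc1 -rcN conj_rc rcN rc1; ring.
      by rewrite rcM -mulzJ; ring.
    rewrite ReM Rerc Imrc mul0r subr0 -mulrA ler_wpM2l// mulrC ler_wpM2l ?exprn_ge0//.
    exact: kappa_le_ReY.
  rewrite mulrDr ReD; lra.
set v := z - c.
have nz t : 0 <= t <= 1 -> c + rc t * v != 0.
  by move=> t01; apply/eqP => e; apply: nt; exists t.
have cd1 t : 0 <= t <= 1 -> cder (fun x => rootf (c + rc x * v)) t (drootf v (c + rc t * v)).
  by move=> t01; apply: cder_rootf (nz t t01) (disc_convex cd zd t01) _ _ erefl (cder_affine c v t).
have e1 : c + rc 1 * v = z by rewrite rc1 mul1r /v addrC subrK.
have e0 : c + rc 0 * v = c by rewrite rc0 mul0r addr0.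
split.
  have := cder_mvt ler01 cd1 (fun t t01 => mod_drootf v (nz t t01) (disc_convex cd zd t01)).
  rewrite e1 e0 subr0 mulr1 => /le_trans; apply.
  by rewrite mulrA [2 * _]mulrC divfK.
have [t t01] := real_mvt ler01 (fun t t01 => (cderZ v (cd1 t t01)).1).
rewrite e1 e0 subr0 mulr1 -ReN -ReD -mulrBr => ->.
exact: Re_drootf (nz t t01) (disc_convex cd zd t01).
Qed.

End RootFunction.

(** * The root belongs to the algebra *)

Section RootInAlgebra.
Variable R : realType.
Local Notation K := (Cplx R).

Lemma modDrc_ge (h : K) (x : R) : 0 <= Re h -> 0 <= x -> `|h| <= `|h + rc x : K|.
Proof.
move=> h0 x0; rewrite !normcE ler_wsqrtr// ReD ImD Rerc Imrc addr0 lerD2r.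
by rewrite lerXn2r ?nnegrE ?addr_ge0// lerDl.
Qed.

Lemma mod_pwN_le (a : R) (h h' : K) : 0 <= a -> 0 < `|h| -> `|h| <= `|h'| -> `|pw (- a) h'| <= `|pw (- a) h|.
Proof.
move=> a0 hp hh; rewrite !mod_pw ler_expR !mulNr lerN2 ler_wpM2l//.
by rewrite ler_ln ?posrE// (lt_le_trans hp).
Qed.

(** The first bound serves where h is close to 0, the second one elsewhere. *)
Lemma pw_perturb (a x : R) (h : K) : 0 <= a <= 1 -> 0 < Re h -> 0 < x ->
  `|pw (- a) (h + rc x) - pw (- a) h : K| <= 2 * `|pw (- a) h| /\
  `|pw (- a) (h + rc x) - pw (- a) h : K| <= 2 * (`|pw (- a) h| * (x / `|h|)).
Proof.
move=> /andP[a0 a1] h0 x0; have hp := ReP_mod_gt0 h0.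
have mono t : 0 <= t -> `|h| <= `|h + rc t : K| by move=> t0; apply: modDrc_ge => //; exact: ltW.
split.
  apply: le_trans (ler_normB _ _) _; rewrite mulrDl !mul1r lerD2r.
  by apply: mod_pwN_le => //; apply: mono; exact: ltW.
have re t : 0 <= t <= 1 -> 0 < Re (h + rc t * rc x : K).
  by move=> /andP[t0 _]; rewrite -rcM ReD Rerc ltr_pwDl// mulr_ge0// ltW.
have hd t (t01 : 0 <= t <= 1) := cder_pw (- a) (cder_affine h (rc x) t) (re t t01).
have hB t : 0 <= t <= 1 ->
   `|rc (- a) * pw (- a) (h + rc t * rc x) * (rc x / (h + rc t * rc x)) : K| <= `|pw (- a) h| * (x / `|h|).
  move=> /andP[t0 t1]; rewrite !modM modV !mod_rc normrN (ger0_norm a0) (gtr0_norm x0) -rcM.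
  have hh := mono (t * x) (mulr_ge0 t0 (ltW x0)).
  apply: ler_pM; rewrite ?mulr_ge0 ?invr_ge0 ?(ltW x0)//.
    rewrite -[leRHS]mul1r; apply: ler_pM => //; exact: mod_pwN_le.
  by rewrite ler_wpM2l ?(ltW x0)// lef_pV2 ?posrE// (lt_le_trans hp).
have := cder_mvt ler01 hd hB.
by rewrite rc1 mul1r rc0 mul0r addr0 subr0 mulr1.
Qed.

Variables (k M : nat) (C : nat -> K) (G : K -> K).
Hypothesis k0 : (0 < k)%N.
Hypothesis Mk : (M <= k)%N.
Hypothesis kM : (k < 2 * M)%N.
Hypothesis CM : C M != 0.
Hypothesis G0 : G 0 = 0.
Variables (d s rho : R).
Hypothesis s0 : 0 <= s.
Hypothesis s1 : s < 1.
Hypothesis w1 : forall z, `|z| < d -> `|wfun k M C G z - 1 : K| <= s.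
Hypothesis rho0 : 0 < rho.
Hypothesis rhod : rho < d.

Local Notation D := (closed_disc rho).
Local Notation mon := (monom k C M).
Local Notation wf := (wfun k M C G).
Local Notation Ph := (Phi k C G).
Let M0 : (0 < M)%N. Proof. by lia. Qed.
Let p := (2 * M - k)%N.
Let p0 : (0 < p)%N. Proof. by rewrite /p; lia. Qed.
Let b : R := M%:R^-1.
Let Mp : 0 < M%:R :> R. Proof. by rewrite ltr0n. Qed.
Let b01 : 0 <= 1 - b <= 1.
Proof.
have h : b <= 1 by rewrite -[leRHS]invr1 lef_pV2 ?posrE// ler1n.
by rewrite subr_ge0 h gerBl invr_ge0 ltW.
Qed.

Definition mainpart (z : K) : K := Sigma k C z + G z.
Definition hfun (z : K) : K := z ^+ p * (mainpart z / C M).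

Lemma monom_at0 j : (j <= k)%N -> monom k C j 0 = 0.
Proof.
move=> jk; apply/eqP; rewrite -normr_eq0 mod_monom//.
have -> : `|(0 : K)| = 0 by exact: normr0.
by rewrite expr0n -(prednK k0) /= mulr0.
Qed.

Lemma mainpart0 : mainpart 0 = 0.
Proof.
rewrite /mainpart G0 addr0 /Sigma big_nat big1// => j /andP[_ jk].
exact: monom_at0.
Qed.

(** p is the power of z that makes the monomial of index M a multiple of |z|^(2M). *)
Lemma mon_pow (z : K) : z ^+ p * mon z = C M * rc ((`|z| ^+ 2) ^+ M).
Proof.
rewrite monomE /zzb rcX -mulzJ exprMn.
have -> : z ^+ M = z ^+ p * z ^+ (k - M) by rewrite -exprD; congr (_ ^+ _); rewrite /p; lia.
ring.
Qed.

Lemma mainpartE (z : K) : z != 0 -> mainpart z = mon z * wf z.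
Proof.
move=> z0; have mz : mon z != 0 by exact: mon_neq0.
rewrite /mainpart /wfun tauE /rest; field.
exact: mz.
Qed.

Lemma hfunE (z : K) : z != 0 -> hfun z = rc ((`|z| ^+ 2) ^+ M) * wf z.
Proof.
move=> z0; rewrite /hfun mainpartE//.
have -> : z ^+ p * (mon z * wf z / C M) = (z ^+ p * mon z) * wf z / C M by ring.
by rewrite mon_pow; field.
Qed.

Lemma Re_hfun (z : K) : z != 0 -> `|z| < d -> (1 - s) * (`|z| ^+ 2) ^+ M <= Re (hfun z).
Proof.
move=> z0 zd; rewrite hfunE// ReM Rerc Imrc mul0r subr0 mulrC ler_wpM2l ?exprn_ge0//.
exact: (Re_wfun w1 zd).
Qed.

Lemma zpow_gt0 (z : K) : z != 0 -> 0 < (`|z| ^+ 2) ^+ M.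
Proof. by move=> z0; rewrite !exprn_gt0// normr_gt0. Qed.

Lemma Re_hfun_gt0 (z : K) : z != 0 -> `|z| < d -> 0 < Re (hfun z).
Proof.
move=> z0 zd; apply: lt_le_trans (Re_hfun z0 zd).
by rewrite mulr_gt0 ?subr_gt0 ?zpow_gt0.
Qed.

(** 1/M = 1 + (1/M - 1): the power 1 is a polynomial in z and Phi, and the remaining exponent
    is negative, as in [pw_poly_approx]; one factor z cancels. *)
Lemma rootfE (z : K) : z != 0 -> `|z| < d ->
  rootf k M C G z = z ^+ p.-1 * (mainpart z / C M) * pw (- (1 - b)) (hfun z).
Proof.
move=> z0 zd; have h0 := Re_hfun_gt0 z0 zd.
have e1 : z ^+ p.-1 * (mainpart z / C M) = hfun z / z.
  rewrite /hfun -{2}(prednK p0) exprS; field.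
  by rewrite z0.
rewrite e1 mulrAC -{1}(pw1 h0) -pwD.
have -> : 1 + - (1 - b) = b by ring.
have X0 : 0 < `|z| ^+ 2 by rewrite exprn_gt0// normr_gt0.
rewrite hfunE// pw_scale ?zpow_gt0//; last exact: (Re_wfun_gt0 s1 w1 zd).
have -> : b * ln ((`|z| ^+ 2) ^+ M) = ln (`|z| ^+ 2).
  by rewrite lnXn// -(mulr_natl (ln _)) mulrA mulVf ?mul1r// gt_eqF.
rewrite lnK ?posrE// -mulzJ /rootf -/b; field.
exact: z0.
Qed.

(** The function h vanishes at the origin, so its negative power is taken at h + x, and x is
    then sent to 0.  For |z| <= eta both f and its approximation are O(eta); elsewhere |h| is
    bounded below and the perturbation is O(x). *)
Lemma rootf_ualg : ualg D Ph Ph -> ualg D Ph (rootf k M C G).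
Proof.
move=> aPh.
have aid : ualg D Ph id by apply: (@ualg_id _ _ _ rho) => x.
have am : ualg D Ph mainpart.
  apply: ualg_eq (ualgB aPh (ualgM (ualg_cst D Ph (C 0%N)) (ualgX k aid))) => z _.
  rewrite /Phi /mainpart /Sigma big_ltn// /monom subn0 expr0 mulr1; ring.
have amC := ualgM am (ualg_cst D Ph (C M)^-1).
have ah : ualg D Ph hfun := ualgM (ualgX p aid) amC.
have a1 := ualgM (ualgX p.-1 aid) amC.
have hre x : D x -> 0 <= Re (hfun x).
  move=> Dx; have [->|x0] := eqVneq x 0; first by rewrite /hfun mainpart0 mul0r mulr0.
  by apply/ltW/Re_hfun_gt0 => //; apply: le_lt_trans rhod.
apply: ualg_lim => e e0.
pose eta := Num.min 1 (e / 4); have eta0 : 0 < eta by rewrite lt_min ltr01 divr_gt0.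
have eta4 : 4 * eta <= e by rewrite mulrC -ler_pdivlMr// ge_min lexx orbT.
have E0 : 0 < (eta ^+ 2) ^+ M by rewrite !exprn_gt0.
(* (1 - s) eta^(2M) bounds |h| below for |z| >= eta, and |f| <= 2 rho *)
pose x := e * ((1 - s) * (eta ^+ 2) ^+ M) / (4 * rho).
have s1' : 0 < 1 - s by rewrite subr_gt0.
have x0 : 0 < x by rewrite divr_gt0 ?mulr_gt0.
exists (fun z => z ^+ p.-1 * (mainpart z / C M) * pw (- (1 - b)) (hfun z + rc x)).
  exact: ualgM a1 (ualg_pw b01 x0 ah hre).
move=> z Dz; have zd : `|z| < d by apply: le_lt_trans rhod.
have [->|z0] := eqVneq z 0.
  rewrite mainpart0 !(mul0r, mulr0) /rootf.
  have -> : (conjc (0 : K) : K) = 0 by rewrite -rc0 conj_rc.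
  by rewrite mul0r subrr normr0 ltW.
have h0 := Re_hfun_gt0 z0 zd; have hp := ReP_mod_gt0 h0.
have [b1 b2] := pw_perturb b01 h0 x0.
rewrite rootfE// -mulrBr modM.
set A : K := z ^+ p.-1 * _.
have fE : `|A| * `|pw (- (1 - b)) (hfun z)| = `|rootf k M C G z| by rewrite rootfE// modM.
have fz : `|rootf k M C G z| <= 2 * `|z|.
  rewrite /rootf modM mod_conj mulrC ler_wpM2r//.
  have hw := Re_wfun w1 zd.
  have mw := mod_wfun_le s1 w1 zd.
  have wp : 0 < `|wf z| by apply: ReP_mod_gt0; exact: lt_le_trans s1' hw.
  rewrite mod_pw -[leRHS](@lnK R) ?posrE// ler_expR.
  have l2 : 0 <= ln (2 : R) by rewrite ln_ge0// ler1n.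
  have bb : 0 <= b <= 1 by move: b01 => /andP[]; lra.
  have /andP[bb0 bb1] := bb.
  apply: le_trans (_ : b * ln 2 <= _); last by rewrite ler_piMl.
  by rewrite ler_wpM2l// ler_ln ?posrE.
have [zs|zl] := ltP `|z| eta.
  apply: le_trans (ler_wpM2l (normr_ge0 A) b1) _.
  rewrite mulrCA fE; lra.
apply: le_trans (ler_wpM2l (normr_ge0 A) b2) _.
rewrite mulrCA [X in 2 * X]mulrA fE.
have hlow : (1 - s) * (eta ^+ 2) ^+ M <= `|hfun z|.
  apply: le_trans (_ : Re (hfun z) <= _); last exact: le_trans (ler_norm _) (Re_le_mod _).
  apply: le_trans (Re_hfun z0 zd); rewrite ler_wpM2l ?(ltW s1')//.
  rewrite lerXn2r ?nnegrE ?exprn_ge0 ?(ltW eta0)//.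
  by rewrite lerXn2r ?nnegrE ?(ltW eta0).
have zr : `|z| <= rho by [].
have q0 : 0 < (1 - s) * (eta ^+ 2) ^+ M by rewrite mulr_gt0.
apply: le_trans (_ : 2 * (2 * rho * (x / ((1 - s) * (eta ^+ 2) ^+ M))) <= _).
  rewrite ler_wpM2l//; apply: ler_pM => //.
  - by rewrite divr_ge0// ltW.
  - by apply: le_trans fz _; rewrite ler_wpM2l.
  - by rewrite ler_wpM2l ?(ltW x0)// lef_pV2 ?posrE.
rewrite /x; apply: le_of_eq; field.
by rewrite !gt_eqF// exprn_gt0.
Qed.

End RootInAlgebra.

(** * Choice of the disc *)

Section SmallDisc.
Variable R : realType.
Local Notation K := (Cplx R).

(** The quotient t / (1 + t) is smaller than 1 for t > 0; for index 1 the tangent is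
    tan pi = 0 and the hypotheses are contradictory. *)
Lemma tan_bound_le1 (q : nat) (x : R) : (0 < q)%N -> 0 <= x -> x < tan_bound R q -> x < 1.
Proof.
move=> q0 x0; rewrite /tan_bound; case: eqP => [//|q2].
have piT := pi_gt0 R.
case: (ltngtP q 2) => [|q3|//].
  case: q q0 q2 => [|[|]]// _ _ _; rewrite divr1 tanpi mul0r => x1.
  by have := le_lt_trans x0 x1; rewrite ltxx.
have qp : 0 < q%:R :> R by rewrite ltr0n.
have q2' : 2 < q%:R :> R by rewrite ltr_nat.
have t0 : 0 < tan (pi / q%:R) :> R.
  have h1 : 0 < pi / q%:R :> R by rewrite divr_gt0.
  have h2 : pi / q%:R < pi / 2 :> R by rewrite ltr_pM2l// ltf_pV2 ?posrE.
  rewrite /tan divr_gt0//; first by rewrite sin_gt0_pihalf// h1.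
  by rewrite cos_gt0_pihalf// h2 andbT (lt_trans _ h1)// oppr_lt0 divr_gt0.
move=> /lt_trans; apply; rewrite ltr_pdivrMr ?addr_gt0// mul1r ltrDr//.
Qed.

Variables (k M : nat) (C : nat -> K) (G : K -> K).
Hypothesis k0 : (0 < k)%N.
Hypothesis Mk : (M <= k)%N.
Hypothesis kM : (k < 2 * M)%N.
Hypothesis CM : C M != 0.
Local Notation st := (sup_tau k C M).
Local Notation nt := (sup_nabla_tau k C M).
Let M0 : (0 < M)%N. Proof. by lia. Qed.
Let Mp : 0 < M%:R :> R. Proof. by rewrite ltr0n. Qed.

(** Since M <= k, 2M - k - k sup|tau| <= M (1 - sup|tau|). *)
Lemma gradient_condition : st < 1 ->
  k%:R * st + (1 - st)^-1 * nt < (2 * M - k)%:R -> nt < M%:R * (1 - st) ^+ 2.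
Proof.
move=> st1 h; have st0 := sup_tau_ge0 k0 Mk CM.
have u0 : 0 < 1 - st by rewrite subr_gt0.
have hM : M%:R <= k%:R :> R by rewrite ler_nat.
have hp : (2 * M - k)%:R = 2 * M%:R - k%:R :> R by rewrite natrB ?natrM// ltnW.
rewrite hp in h.
have h2 : (1 - st)^-1 * nt < M%:R * (1 - st).
  apply: lt_le_trans (_ : 2 * M%:R - k%:R - k%:R * st <= _); first by lra.
  have : (k%:R - M%:R) * (1 + st) >= 0 by rewrite mulr_ge0 ?subr_ge0 ?addr_ge0.
  lra.
by move: h2; rewrite ltr_pdivrMl// => h2; rewrite expr2 mulrA mulrC.
Qed.

(** The inequality is strict, so it survives the replacement of tau by W - 1, which differs
    from it by O(|z|). *)
Lemma margin_exists : st < 1 -> nt < M%:R * (1 - st) ^+ 2 ->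
  exists2 sg : R, 0 < sg & st + sg < 1 /\ nt + sg < M%:R * (1 - (st + sg)) ^+ 2.
Proof.
move=> st1 h; set u := 1 - st in h *; have u0 : 0 < u by rewrite subr_gt0.
pose D0 := M%:R * u ^+ 2 - nt; have D00 : 0 < D0 by rewrite subr_gt0.
(* the derivative at sg = 0 of the difference of both sides is 1 + 2Mu *)
pose c := 2 * (1 + 2 * M%:R * u).
have c0 : 0 < c by rewrite mulr_gt0// addr_gt0// !mulr_gt0.
pose sg := Num.min (u / 2) (D0 / c).
have sg0 : 0 < sg by rewrite lt_min !divr_gt0.
have sg1 : sg <= u / 2 by rewrite ge_min lexx.
have sg2 : sg * c <= D0 by rewrite -ler_pdivlMr// ge_min lexx orbT.
exists sg => //; split; first by rewrite /u in sg1 u0; lra.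
have -> : 1 - (st + sg) = u - sg by rewrite /u; ring.
have e : M%:R * (u - sg) ^+ 2 = M%:R * u ^+ 2 - 2 * M%:R * u * sg + M%:R * sg ^+ 2 by ring.
have q : 0 <= M%:R * sg ^+ 2 by rewrite mulr_ge0 ?sqr_ge0// ltW.
have q2 : 0 < sg * (1 + 2 * M%:R * u) by rewrite mulr_gt0// addr_gt0// !mulr_gt0.
rewrite e; rewrite /c /D0 in sg2; lra.
Qed.

Variables (d0 A B : R).
Hypothesis d00 : 0 < d0.
Hypothesis A0 : 0 <= A.
Hypothesis B0 : 0 <= B.
Hypothesis hG : forall z, `|z| < d0 -> `|G z| <= A * `|z| ^+ k.+1.
Hypothesis hdG : forall z v, z != 0 -> `|z| < d0 -> `|'d G z v : K| <= B * `|z| ^+ k * `|v|.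

(** W - 1 - tau is G divided by a monomial of degree k; by the bounds on G and DG this
    perturbation is O(|z|), and its derivative is O(1). *)
Lemma small_disc (sg : R) : 0 < sg -> exists2 d : R, 0 < d <= d0 &
  (forall z, `|z| < d -> `|wfun k M C G z - 1 : K| <= st + sg) /\
  (forall z v, z != 0 -> `|z| < d -> `|z| * `|dwfun k M C G v z| <= (nt + sg) * `|v|).
Proof.
move=> sg0.
pose m := `|C M|; have m0 : 0 < m by rewrite normr_gt0.
pose c := (A + B + A * k%:R) / m + 1.
have kk : 0 <= k%:R :> R by [].
have AB : 0 <= A + B + A * k%:R by rewrite !addr_ge0// mulr_ge0.
have c0 : 0 < c by rewrite ltr_wpDl// divr_ge0// ltW.
exists (Num.min d0 (sg / c)); first by rewrite lt_min d00 divr_gt0//= ge_min lexx.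
have st0 := sup_tau_ge0 k0 Mk CM.
have cz z : `|z| < Num.min d0 (sg / c) -> `|z| < d0 /\ `|z| * c <= sg.
  by rewrite lt_min => /andP[-> h]; split => //; rewrite -ler_pdivlMr// ltW.
have mE z : `|monom k C M z| = m * `|z| ^+ k by rewrite mod_monom.
split=> [z /cz[zd zc]|z v z0 /cz[zd zc]].
  have [->|z0] := eqVneq z 0.
    have mz : monom k C M 0 = 0 by apply: monom_at0.
    rewrite /wfun tauE mz invr0 !mulr0 !addr0 subrr.
    have -> : `|(0 : K)| = 0 by exact: normr0.
    by rewrite addr_ge0// ltW.
  have zp : 0 < `|z| by rewrite normr_gt0.
  have -> : wfun k M C G z - 1 = tau k C M z + G z / monom k C M z by rewrite /wfun; ring.
  apply: le_trans (ler_normD _ _) _; apply: lerD; first exact: tau_le_sup.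
  rewrite modM modV mE ler_pdivrMr ?mulr_gt0 ?exprn_gt0//.
  apply: le_trans (hG zd) _; rewrite exprS mulrA mulrA ler_wpM2r ?exprn_ge0//.
  apply: le_trans (_ : `|z| * c * m <= _); last by rewrite ler_wpM2r// ltW.
  have -> : `|z| * c * m = `|z| * (A + B + A * k%:R + m) by rewrite /c; field; rewrite gt_eqF.
  by rewrite mulrC ler_wpM2l// -!addrA lerDl !addr_ge0// ?mulr_ge0// ltW.
have zp : 0 < `|z| by rewrite normr_gt0.
have mz0 : 0 < m * `|z| ^+ k by rewrite mulr_gt0 ?exprn_gt0.
rewrite /dwfun.
have t1 : `|dtau k M C v z| <= nt * (`|v| / `|z|) by exact: dtau_le_sup.
have t2 : `|'d G z v * (monom k C M z)^-1 : K| <= B / m * `|v|.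
  rewrite modM modV mE ler_pdivrMr//; apply: le_trans (hdG v z0 zd) _.
  by apply: le_of_eq; field; rewrite gt_eqF.
have t3 : `|G z * (- dmonom k C M v z / monom k C M z ^+ 2) : K| <= A * k%:R / m * `|v|.
  rewrite !modM normrN modV modX mE.
  apply: le_trans (_ : A * `|z| ^+ k.+1 * (m * (k%:R * `|z| ^+ k.-1 * `|v|) / (m * `|z| ^+ k) ^+ 2) <= _).
    apply: ler_pM; rewrite ?divr_ge0 ?sqr_ge0//; first exact: hG.
    rewrite ler_wpM2r ?invr_ge0 ?sqr_ge0//; exact: mod_dmonom.
  have -> : `|z| ^+ k = `|z| * `|z| ^+ k.-1 by rewrite -exprS prednK.
  have -> : `|z| ^+ k.+1 = `|z| * (`|z| * `|z| ^+ k.-1) by rewrite -exprS prednK // -exprS.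
  have zk : `|z| ^+ k.-1 != 0 by rewrite expf_neq0// gt_eqF.
  by apply: le_of_eq; field; rewrite zk !gt_eqF.
apply: le_trans (_ : `|z| * (nt * (`|v| / `|z|) + (B / m * `|v| + A * k%:R / m * `|v|)) <= _).
  rewrite ler_wpM2l//; apply: le_trans (ler_normD _ _) _; apply: lerD => //.
  by apply: le_trans (ler_normD _ _) _; apply: lerD.
have -> : `|z| * (nt * (`|v| / `|z|) + (B / m * `|v| + A * k%:R / m * `|v|)) =
  (nt + `|z| * ((B + A * k%:R) / m)) * `|v| by field; rewrite !gt_eqF.
rewrite ler_wpM2r// lerD2l; apply: le_trans zc; rewrite ler_wpM2l// /c.
apply: le_trans (_ : (A + B + A * k%:R) / m <= _); last by rewrite lerDl.
by rewrite ler_wpM2r ?invr_ge0 ?(ltW m0)// -addrA lerDr.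
Qed.

End SmallDisc.

(** * The theorem *)

Section GraphContinuity.
Variable R : realType.
Local Notation K := (Cplx R).

(** The differential is determined by the derivatives in the directions 1 and i. *)
Lemma gradient_bound (k : nat) (C : nat -> K) (G : K -> K) (S : set (Cplx2 R)) (r : R) :
  (0 < k)%N -> smooth_surface S -> S (0, 0) -> 0 < r ->
  Cclass 1 [set z : K | `|z| < r] G ->
  G =O_ (0 : K) (fun z : K => `|z| ^+ k.+1 : R) ->
  (forall z w : K, `|z| < r -> (S (z, w) <-> w = Phi k C G z)) ->
  exists d B : R, [/\ 0 < d, 0 <= B &
    forall z v, z != 0 -> `|z| < d -> `|'d G z v : K| <= B * `|z| ^+ k * `|v|].
Proof.
move=> hk hS hS0 hr hG1 hGO hSg.
have [d1 [B1 [d10 B10 h1]]] := gradient_bound_dir hk hS hS0 hr hG1 hGO hSg (mod1 R).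
have [d2 [B2 [d20 B20 h2]]] := gradient_bound_dir hk hS hS0 hr hG1 hGO hSg (mod_i R).
exists (Num.min r (Num.min d1 d2)), (B1 + B2); split.
- by rewrite !lt_min hr d10.
- exact: addr_ge0.
move=> z v z0; rewrite !lt_min => /andP[zr /andP[z1 z2]].
have dG : differentiable G z by case: hG1 => h _; exact: h.
have -> : 'd G z v = rc (Re v) * 'D_(1 : K) G z + rc (Im v) * 'D_('i%C : K) G z :> K.
  rewrite !deriveE// -!rcZ -!linearZ -linearD; congr ('d G z _).
  by rewrite !rcZ mulr1 [rc (Im v) * _]mulrC; exact: cplxE.
apply: le_trans (ler_normD _ _) _; rewrite !modM !mod_rc.
have a1 : `|Re v| * `|'D_(1 : K) G z| <= `|v| * (B1 * `|z| ^+ k).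
  by apply: ler_pM; rewrite ?Re_le_mod ?h1.
have a2 : `|Im v| * `|'D_('i%C : K) G z| <= `|v| * (B2 * `|z| ^+ k).
  by apply: ler_pM; rewrite ?Im_le_mod ?h2.
apply: le_trans (lerD a1 a2) _; apply: le_of_eq; ring.
Qed.

(** The polynomial part is Lipschitz on the disc by the mean value estimate. *)
Lemma Phi_continuous (k : nat) (C : nat -> K) (G : K -> K) (rho : R) :
  rho < 1 -> (forall z, closed_disc rho z -> differentiable G z) ->
  {within closed_disc rho, continuous (Phi k C G)}.
Proof.
move=> rho1 Gd; apply/within_continuousP => x Dx e e0.
have [A A0 hA] := mod_dpolpart_le k C.
have Gc : {for x, continuous G} by apply: differentiable_continuous; exact: Gd.
have FF : Filter (nbhs (x : K)) by exact: nbhs_filter.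
have e2 : 0 < e / 2 by rewrite divr_gt0.
have := iffLR (@cvgrPdist_lt _ _ _ (nbhs (x : K)) FF _ _) Gc _ e2.
move=> /nbhs_normP[d1 /= d10 hd1].
pose A1 := 4 * (A + 1).
have A10 : 0 < A1 by rewrite mulr_gt0// ltr_wpDl.
exists (Num.min d1 (e / A1)); first by rewrite lt_min d10 divr_gt0.
move=> y Dy; rewrite lt_min => /andP[xy1 xy2].
have -> : Phi k C G x - Phi k C G y = (polpart k C x - polpart k C y) + (G x - G y) :> K.
  by rewrite /Phi -/(polpart k C x) -/(polpart k C y); ring.
apply: le_lt_trans (ler_normD _ _) _; rewrite (splitr e); apply: ler_ltD; last exact: hd1.
have [->|xyn] := eqVneq x y; first by rewrite subrr normr0 ltW.
have vn : 0 < `|x - y : K| by rewrite normr_gt0 subr_eq0.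
pose l := `|x - y : K|; pose v : K := rc l^-1 * (x - y).
have v1 : `|v| = 1.
  by rewrite modM mod_rc ger0_norm ?invr_ge0 ?(ltW vn)// mulVf// gt_eqF.
have seg t : 0 <= t <= l -> `|y + rc t * v : K| < 1.
  move=> /andP[t0 tl]; have -> : y + rc t * v = y + rc (t / l) * (x - y) by rewrite /v rcM; ring.
  apply: disc_convex; [exact: le_lt_trans rho1|exact: le_lt_trans rho1|].
  by rewrite divr_ge0 ?(ltW vn)//= ler_pdivrMr// mul1r.
have hd t (t01 : 0 <= t <= l) := cder_polpart k C (cder_affine y v t).
have hB t : 0 <= t <= l -> `|dpolpart k C v (y + rc t * v)| <= A.
  by move=> t01; apply: hA; [exact: seg|rewrite v1].
have := cder_mvt (ltW vn) hd hB.
have -> : y + rc l * v = x.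
  by rewrite /v mulrA -rcM divff ?gt_eqF// rc1 mul1r addrC subrK.
rewrite rc0 mul0r addr0 subr0 => /le_trans; apply.
have h : l * A1 < e by rewrite -ltr_pdivlMr.
have l0 : 0 <= l * (A + 1) by apply: mulr_ge0; [exact: ltW|exact: addr_ge0].
rewrite -/l.
have : l * (A * 4) + l * 4 < e by move: h; rewrite /A1 [4 * _]mulrC mulrDl mulrDr mul1r.
by have := vn; rewrite -/l; have := l0; lra.
Qed.

End GraphContinuity.

Theorem theorem1p2 (R : realType) (k : nat) (C : nat -> Cplx R)
  (G : Cplx R -> Cplx R) (S : set (Cplx2 R)) (r : R) (M : nat)
  (hk : (2 < k)%N)
  (hS : smooth_surface S)
  (hS0 : S (0, 0))
  (hr : 0 < r)
  (hG1 : Cclass 1 [set z : Cplx R | `|z| < r] G)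
  (hGO : G =O_ (0 : Cplx R) (fun z : Cplx R => `|z| ^+ k.+1 : R))
  (hSgraph : forall z w : Cplx R, `|z| < r -> (S (z, w) <-> w = Phi k C G z))
  (hI : I_S k C !=set0)
  (hM : I_S k C M)
  (htau : sup_tau k C M < tan_bound R (2 * M - k))
  (hgrad : k%:R * sup_tau k C M
           + (1 - sup_tau k C M)^-1 * sup_nabla_tau k C M
           < (2 * M - k)%:R) :
  exists eps : R,
    [/\ 0 < eps, eps < r,
        polynomially_convex (S `&` [set p : Cplx2 R | `|p.1| <= eps]) &
        continuous_on (closed_disc eps)
          = uniform_algebra2 (closed_disc eps) id (Phi k C G)].
Proof.
have [kM [Mk CM]] := hM.
have k0 : (0 < k)%N by apply: leq_trans hk.
have st0 := sup_tau_ge0 k0 Mk CM.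
have nt0 := sup_nabla_ge0 k0 Mk CM.
have p0 : (0 < 2 * M - k)%N by rewrite subn_gt0.
have st1 := tan_bound_le1 p0 st0 htau.
have mar := gradient_condition k0 Mk kM CM st1 hgrad.
have [sg sg0 [s1 n1]] := margin_exists k0 Mk kM CM st1 mar.
have [dA [A [dA0 A0 hA]]] := bigO_bound hGO.
have [dB [B [dB0 B0 hB]]] := gradient_bound k0 hS hS0 hr hG1 hGO hSgraph.
pose d0 := Num.min (Num.min r 1) (Num.min dA dB).
have d00 : 0 < d0 by rewrite !lt_min hr ltr01 dA0 dB0.
have hd0 z : `|z| < d0 -> [/\ `|z| < r, `|z| < dA & `|z| < dB].
  by rewrite !lt_min => /andP[/andP[-> _] /andP[-> ->]].
have hG' z : `|z| < d0 -> `|G z| <= A * `|z| ^+ k.+1 by move=> /hd0[_ zA _]; exact: hA.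
have hdG' z v : z != 0 -> `|z| < d0 -> `|'d G z v : Cplx R| <= B * `|z| ^+ k * `|v|.
  by move=> z0 /hd0[_ _ zB]; exact: hB.
have [d /andP[dp dd] [w1 dw]] := small_disc k0 Mk CM d00 A0 B0 hG' hdG' sg0.
pose rho := d / 2.
have rho0 : 0 < rho by rewrite divr_gt0.
have rhod : rho < d by rewrite ltr_pdivrMr// ltr_pMr// ltr1n.
have dr : d <= r by apply: (le_trans dd); rewrite /d0 !ge_min lexx.
have d1 : d <= 1 by apply: (le_trans dd); rewrite /d0 !ge_min lexx orbT.
have Gd z : `|z| < d -> differentiable G z.
  by move=> zd; case: hG1 => h _; apply: h; exact: lt_le_trans dr.
have G0 : G 0 = 0.
  have zn0 : `|(0 : Cplx R)| = 0 by exact: normr0.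
  by apply/eqP; rewrite -normr_le0; have := hA 0; rewrite zn0 expr0n /= mulr0; apply.
have in_d z : closed_disc rho z -> `|z| < d by move=> h; exact: le_lt_trans rhod.
have s0' : 0 <= sup_tau k C M + sg by rewrite addr_ge0// ltW.
have n0' : 0 <= sup_nabla_tau k C M + sg by rewrite addr_ge0// ltW.
have Phc : {within closed_disc rho, continuous (Phi k C G)}.
  apply: Phi_continuous => //; first exact: lt_le_trans d1.
  by move=> z /in_d; exact: Gd.
have aPh : ualg (closed_disc rho) (Phi k C G) (Phi k C G).
  have := compact_bounded (continuous_compact Phc (@closed_disc_compact R rho)).
  move=> [Mb [_ hMb]]; apply: (@ualg_gen _ _ _ (Mb + 1)) => x Dx.
  by apply: (hMb (Mb + 1)); [rewrite ltrDl|exists x].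
have af := rootf_ualg k0 Mk kM CM G0 s0' s1 w1 rho0 rhod aPh.
have est z c : closed_disc rho z -> closed_disc rho c -> _ :=
  fun Dz Dc => rootf_estimates k0 Mk kM CM dp Gd s0' s1 n0' w1 dw n1 (in_d z Dz) (in_d c Dc).
have kap0 := kappa_gt0 k0 Mk kM CM dp s0' s1 n0' n1.
have L0 : 0 <= rlip M (sup_tau k C M + sg) (sup_nabla_tau k C M + sg).
  by rewrite mulr_ge0// addr_ge0// !divr_ge0// subr_ge0 ltW.
have ac := ualg_conj rho0 kap0 L0 af (fun z c Dz Dc => (est z c Dz Dc).1) (fun z c Dz Dc => (est z c Dz Dc).2).
have dense (f : Cplx R -> Cplx R) : {within closed_disc rho, continuous f} ->
  ualg (closed_disc rho) (Phi k C G) f by apply: ualg_continuous.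
exists rho; split => //; first exact: (lt_le_trans rhod dr).
  have -> : S `&` [set p : Cplx2 R | `|p.1| <= rho] =
     [set p : Cplx2 R | closed_disc rho p.1 /\ p.2 = Phi k C G p.1].
    rewrite eqEsubset; split.
      move=> [z w] /= [Szw zr]; split => //.
      by apply/hSgraph => //; apply: le_lt_trans zr _; exact: lt_le_trans dr.
    move=> [z w] /= [zr ->]; split => //.
    by apply/hSgraph => //; apply: le_lt_trans zr _; exact: lt_le_trans dr.
  exact: graph_polynomially_convex.
exact: uniform_algebra2_full.
Qed.
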